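(* Let $1<p<\infty$ and let $T$ be a bounded operator on $\mathcal{F}^p$ which belongs to the operator-norm closure of $\mathcal{A}(\mathbb{C}^n)$ in the bounded operators on $\mathcal{F}^p$. If $\lim_{|z|\to\infty}\left|\langle Tk_z,k_z\rangle_{\mathcal{F}^2}\right|=0$, then $T$ is compact on $\mathcal{F}^p$.
   Context: For $1\le p\le\infty$, the Bargmann-Fock space $\mathcal{F}^p=\mathcal{F}^p(\mathbb{C}^n)$ is the space of entire functions $f$ on $\mathbb{C}^n$ with $f(\cdot)e^{-|\cdot|^2/2}\in L^p(\mathbb{C}^n,dv)$, with the corresponding $L^p$ norm, where $dv$ is Lebesgue measure normalized so that $\int_{\mathbb{C}^n}e^{-|z|^2}dv(z)=1$. Write $\langle f,g\rangle_{\mathcal{F}^2}=\int_{\mathbb{C}^n}f\overline g\,e^{-|z|^2}dv(z)$ (also used for $f\in\mathcal{F}^p$, $g\in\mathcal{F}^q$, $\frac1p+\frac1q=1$). The reproducing kernel of $\mathcal{F}^2$ is $K_z(w)=e^{\overline z w}$, where $\overline z w=\sum_j\overline{z_j}w_j$, and $k_z=K_z/\|K_z\|_{\mathcal{F}^2}$; these functions lie in every $\mathcal{F}^p$. Sufficiently localized operators: $\mathcal{A}(\mathbb{C}^n)$ is the set of bounded operators $T$ on $\mathcal{F}^2$ for which there exist constants $2n<\beta<\infty$ and $0<C<\infty$ with $$|\langle Tk_z,k_w\rangle_{\mathcal{F}^2}|\le\frac{C}{(1+|z-w|)^\beta}\qquad\text{for all }z,w\in\mathbb{C}^n.$$ Such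 an operator, restricted to the linear span of the reproducing kernels, extends to a bounded operator on $\mathcal{F}^p$ for every $1\le p\le\infty$, and elements of $\mathcal{A}(\mathbb{C}^n)$ are regarded as operators on $\mathcal{F}^p$ in this way. *)

(* Defs.v *)
From HB Require Import structures.
From mathcomp Require Import all_boot all_order all_algebra.
From mathcomp Require Import complex.
From mathcomp Require Import all_classical all_reals all_analysis.
From mathcomp Require Import measurable_realfun gauss_integral.

Set Implicit Arguments.
Unset Strict Implicit.
Unset Printing Implicit Defensive.

Import Order.TTheory GRing.Theory Num.Theory.
Import numFieldNormedType.Exports.
Import Normc.

Local Open Scope classical_set_scope.
Local Open Scope ring_scope.
Local Open Scope complex_scope.

Lemma sigma_finite_prod d1 d2 (T1 : measurableType d1) (T2 : measurableType d2)
    (R : realType) (m1 : {sigma_finite_measure set T1 -> \bar R})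
    (m2 : {sigma_finite_measure set T2 -> \bar R}) :
  sigma_finite setT (m1 \x m2)%E.
Proof.
have /sigma_finiteP[F [TF ndF Foo]] := sigma_finiteT m1.
have /sigma_finiteP[G [TG ndG Goo]] := sigma_finiteT m2.
exists (fun n => F n `*` G n).
  apply/seteqP; split => // -[x y] _.
  have : [set: T1] x by []. have : [set: T2] y by [].
  rewrite TF TG => -[k _ Gky] [n _ Fnx]; exists (maxn n k) => //; split => /=.
    by move: x Fnx; exact/subsetPset/ndF/leq_maxl.
  by move: y Gky; exact/subsetPset/ndG/leq_maxr.
move=> k; have [? ?] := Foo k; have [? ?] := Goo k.
split; first exact: measurableX.
by rewrite product_measure1E// lte_mul_pinfty// ge0_fin_numE.
Qed.

Definition cons_pair (T : Type) n (x : T * n.-tuple T) : n.+1.-tuple T :=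
  [tuple of x.1 :: x.2].

Lemma measurable_cons_pair d (T : measurableType d) n :
  measurable_fun [set: T * n.-tuple T] (@cons_pair T n).
Proof. exact: measurable_cons. Qed.

Section cons_measure.
Context d (T : measurableType d) (R : realType) (n : nat).
Variables (m1 : {sigma_finite_measure set T -> \bar R}).
Variables (m : {sigma_finite_measure set (n.-tuple T) -> \bar R}).

Definition cons_measure : set (n.+1.-tuple T) -> \bar R :=
  pushforward (m1 \x m)%E (@cons_pair T n).

HB.instance Definition _ := Measure.copy cons_measure
  (measure_function_pushforward__canonical__measure_function_Measure
    (m1 \x m)%E (@measurable_cons_pair d T n)).

Let cons_measure_sigma_finite : sigma_finite setT cons_measure.
Proof.
have [F TF Foo] := sigma_finite_prod m1 m.
pose uncons (x : n.+1.-tuple T) := (thead x, [tuple of behead x]).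
have unconsK y : uncons (cons_pair y) = y.
  by case: y => a t; congr pair; exact: val_inj.
have muncons : measurable_fun setT uncons.
  apply/measurable_fun_pairP; split; first exact: measurable_tnth.
  exact: measurable_behead.
exists (fun k => uncons @^-1` F k).
  apply/seteqP; split => // x _; have : setT (uncons x) by [].
  by rewrite TF => -[k _ Fk]; exists k.
move=> k; have [mFk Fk] := Foo k; split.
  by rewrite -[X in measurable X]setTI; exact: muncons.
rewrite /cons_measure /pushforward (_ : _ @^-1` _ = F k)//.
by apply/seteqP; split => y /=; rewrite unconsK.
Qed.

HB.instance Definition _ :=
  Measure_isSigmaFinite.Build _ _ _ cons_measure cons_measure_sigma_finite.

End cons_measure.

Fixpoint tuple_measure d (T : measurableType d) (R : realType)
    (m : {sigma_finite_measure set T -> \bar R}) (n : nat) :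
    {sigma_finite_measure set (n.-tuple T) -> \bar R} :=
  if n is k.+1 then cons_measure m (tuple_measure m k) else \d_([tuple]).

Lemma measurable_prod_tnth d (T : measurableType d) (R : realType) (n : nat)
    (g : T -> R) : measurable_fun setT g ->
  measurable_fun setT (fun x : n.-tuple T => \prod_j g (tnth x j)).
Proof.
move=> mg; apply: measurable_prod => j _.
by apply: measurableT_comp => //; exact: measurable_tnth.
Qed.

Lemma fubini_tonelli_prod d1 d2 (T1 : measurableType d1) (T2 : measurableType d2)
    (R : realType) (m1 : {sigma_finite_measure set T1 -> \bar R})
    (m2 : {sigma_finite_measure set T2 -> \bar R}) (g : T1 -> R) (h : T2 -> R) :
  measurable_fun setT g -> (forall x, 0 <= g x) ->
  measurable_fun setT h -> (forall x, 0 <= h x) ->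
  (\int[m1 \x m2]_x (g x.1 * h x.2)%:E =
   \int[m1]_x (g x)%:E * \int[m2]_x (h x)%:E)%E.
Proof.
move=> mg g0 mh h0.
rewrite fubini_tonelli1/=; last 2 first.
- by apply/measurable_EFinP; apply: measurable_funM; exact: measurableT_comp.
- by move=> x; rewrite lee_fin mulr_ge0.
rewrite /fubini_F/= -ge0_integralZr//; last 3 first.
- by apply/measurable_EFinP.
- by move=> x _; rewrite lee_fin.
- by apply: integral_ge0 => x _; rewrite lee_fin.
apply: eq_integral => x _; rewrite -ge0_integralZl//.
- by apply/measurable_EFinP.
- by move=> y _; rewrite lee_fin.
- by rewrite lee_fin.
Qed.

Lemma integral_tuple_prod d (T : measurableType d) (R : realType)
    (m : {sigma_finite_measure set T -> \bar R}) (n : nat) (g : T -> R) :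
  measurable_fun setT g -> (forall x, 0 <= g x) ->
  (\int[m]_x (g x)%:E = 1)%E ->
  (\int[tuple_measure m n]_x (\prod_j g (tnth x j))%:E = 1)%E.
Proof.
move=> mg g0 g1; elim: n => [|n IH] /=.
  rewrite integral_dirac// ?diracT ?mul1e ?big_ord0//.
  by apply/measurable_EFinP; exact: measurable_prod_tnth.
rewrite ge0_integral_pushforward//=; last 3 first.
- exact: measurable_cons_pair.
- by apply/measurable_EFinP; exact: measurable_prod_tnth.
- by move=> x _; rewrite lee_fin prodr_ge0.
rewrite preimage_setT.
under eq_integral => x _.
  rewrite big_ord_recl [tnth _ ord0]tnth0/=.
  under eq_bigr do rewrite tnthS.
  over.
rewrite (@fubini_tonelli_prod _ _ _ _ R m _ g (fun y => \prod_j g (tnth y j)))//.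
- transitivity (1 * 1 : \bar R)%E; last by rewrite mule1.
  congr (_ * _)%E; rewrite // -IH.
- exact: measurable_prod_tnth.
- by move=> x; exact: prodr_ge0.
Qed.

Section area.
Context {R : realType}.

Lemma invpi_ge0 : 0 <= (pi : R)^-1.
Proof. by rewrite invr_ge0 pi_ge0. Qed.

Definition area : set (measurableTypeR R * measurableTypeR R) -> \bar R :=
  mscale (NngNum invpi_ge0) (@lebesgue_measure R \x @lebesgue_measure R)%E.

HB.instance Definition _ := Measure.copy area
  (mscale (NngNum invpi_ge0) (@lebesgue_measure R \x @lebesgue_measure R)%E).

Let area_sigma_finite : sigma_finite setT area.
Proof.
have [F TF Foo] := sigma_finite_prod (@lebesgue_measure R) (@lebesgue_measure R).
exists F => // k; have [mFk Fk] := Foo k; split => //.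
by rewrite /area /mscale/= lte_mul_pinfty// lee_fin invpi_ge0.
Qed.

HB.instance Definition _ :=
  Measure_isSigmaFinite.Build _ _ _ area area_sigma_finite.

Lemma integral_area_gauss :
  (\int[area]_z (expR (- (z.1 ^+ 2 + z.2 ^+ 2)))%:E = 1)%E.
Proof.
rewrite ge0_integral_mscale//=; last first.
  apply/measurable_EFinP; apply: measurableT_comp => //.
  apply: measurableT_comp => //.
  by apply: measurable_funD; apply: measurable_funX.
under eq_integral do rewrite opprD expRD.
rewrite (@fubini_tonelli_prod _ _ _ _ R lebesgue_measure lebesgue_measure
  (@gauss_fun R) (@gauss_fun R)).
- rewrite !integralT_gauss -!EFinM; congr EFin.
  by rewrite -expr2 sqr_sqrtr ?pi_ge0// mulVf// gt_eqF// pi_gt0.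
all: by move=> *; rewrite ?expR_ge0//; exact: measurable_gauss_fun.
Qed.

End area.

Section fock_space.
Context {R : realType} {n : nat}.

Notation Cn := 'rV[R[i]]_n.
Notation Rn := (n.-tuple (measurableTypeR R * measurableTypeR R)%type).

Definition dv : {sigma_finite_measure set Rn -> \bar R} := tuple_measure area n.

(* MathComp-Analysis puts no sigma-algebra on matrices: functions on C^n are
   integrated against dv after composition with this bijection. *)
Definition cvec (x : Rn) : Cn := \row_j ((tnth x j).1 +i* (tnth x j).2).

(* The Euclidean norm; the library norm of 'rV[R[i]]_n is the sup norm. *)
Definition enorm (z : Cn) : R := Num.sqrt (\sum_j normc (z 0 j) ^+ 2).

Lemma enorm_sqr (x : Rn) :
  enorm (cvec x) ^+ 2 = \sum_j ((tnth x j).1 ^+ 2 + (tnth x j).2 ^+ 2).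
Proof.
rewrite sqr_sqrtr; last by apply: sumr_ge0 => j _; exact: sqr_ge0.
apply: eq_bigr => j _; rewrite mxE /= sqr_sqrtr//.
by rewrite addr_ge0// sqr_ge0.
Qed.

Lemma dv_normalized :
  (\int[dv]_x (expR (- enorm (cvec x) ^+ 2))%:E = 1)%E.
Proof.
rewrite -(@integral_tuple_prod _ _ _ (@area R) n _ _ _ integral_area_gauss).
- by apply: eq_integral => x _; rewrite enorm_sqr -sumrN expR_sum.
- apply: measurableT_comp => //; apply: measurableT_comp => //.
  by apply: measurable_funD; apply: measurable_funX.
- by move=> x; exact: expR_ge0.
Qed.

Definition dotc (z w : Cn) : R[i] := \sum_j (z 0 j)^* * w 0 j.

Definition cexp (z : R[i]) : R[i] :=
  (expR (complex.Re z))%:C * (cos (complex.Im z) +i* sin (complex.Im z)).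

Definition cintegral (g : Cn -> R[i]) : R[i] :=
  (\int[dv]_x complex.Re (g (cvec x))) +i* (\int[dv]_x complex.Im (g (cvec x))).

Definition pairing (f g : Cn -> R[i]) : R[i] :=
  cintegral (fun z => f z * (g z)^* * (expR (- enorm z ^+ 2))%:C).

(* C^n and C are normed spaces over R[i] here: complex differentiability. *)
Definition entire (f : Cn -> R[i]) : Prop :=
  forall z, differentiable (f : Cn -> R[i]^o) z.

Definition fock_norm (p : \bar R) (f : Cn -> R[i]) : \bar R :=
  Lnorm dv p (fun x =>
    (normc (f (cvec x)) * expR (- (enorm (cvec x) ^+ 2 / 2)))%:E).

Definition fock (p : \bar R) : set (Cn -> R[i]) :=
  [set f | entire f /\ (fock_norm p f < +oo)%E].

Definition rkernel (z w : Cn) : R[i] := cexp (dotc z w).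

Definition nkernel (z w : Cn) : R[i] :=
  rkernel z w / (fine (fock_norm 2%:E (rkernel z)))%:C.

Definition kernel_span : set (Cn -> R[i]) :=
  [set f | exists (m : nat) (c : 'I_m -> R[i]) (z : 'I_m -> Cn),
    f = fun w => \sum_i c i * rkernel (z i) w].

(* An operator on F^p is a map on all functions of which only the restriction
   to F^p is ever used. *)
Implicit Types T S : (Cn -> R[i]) -> (Cn -> R[i]).

Definition opnorm (p : \bar R) T : \bar R :=
  ereal_sup [set fock_norm p (T f) | f in
    [set f | fock p f /\ (fock_norm p f <= 1)%E]].

Definition bounded_op (p : \bar R) T : Prop :=
  [/\ forall f, fock p f -> fock p (T f),
      forall (a : R[i]) f g, fock p f -> fock p g ->
        T (fun z => a * f z + g z) = (fun z => a * T f z + T g z)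
    & (opnorm p T < +oo)%E].

Definition sufficiently_localized S : Prop :=
  bounded_op 2%:E S /\
  exists beta C : R, [/\ 2 * n%:R < beta, 0 < C &
    forall z w, normc (pairing (S (nkernel z)) (nkernel w))
      <= C / (1 + enorm (z - w)) `^ beta].

(* T is the bounded operator on F^p obtained by extending the restriction of
   some S in A(C^n) to the span of the reproducing kernels. *)
Definition sufficiently_localized_on (p : \bar R) T : Prop :=
  bounded_op p T /\
  exists2 S, sufficiently_localized S & forall g, kernel_span g -> T g = S g.

Definition in_localized_closure (p : \bar R) T : Prop :=
  forall e : R, 0 < e -> exists2 S, sufficiently_localized_on p S &
    (opnorm p (fun f z => (T f z - S f z)%R) < e%:E)%E.

Definition compact_op (p : \bar R) T : Prop :=
  forall f : nat -> Cn -> R[i], (forall k, fock p (f k)) ->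
    (exists M : R, forall k, (fock_norm p (f k) <= M%:E)%E) ->
  exists (phi : nat -> nat) (g : Cn -> R[i]),
    [/\ {homo phi : i j / (i < j)%N}, fock p g &
      fock_norm p (fun z => T (f (phi k)) z - g z) @[k --> \oo] --> 0%E].

End fock_space.

Arguments dv {R} n.

(* Main.v *)
Require Import Defs.
From HB Require Import structures.
From mathcomp Require Import all_boot all_order all_algebra.
From mathcomp Require Import complex.
From mathcomp Require Import all_classical all_reals all_analysis.
From mathcomp Require Import measurable_realfun gauss_integral.
From mathcomp Require Import ring lra.
Import Order.TTheory GRing.Theory Num.Theory.
Import numFieldNormedType.Exports.
Import Normc.

Set Implicit Arguments.
Unset Strict Implicit.
Unset Printing Implicit Defensive.

Local Open Scope classical_set_scope.
Local Open Scope ring_scope.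

(** Write [t(z, w)] for the modulus of the pairing of [T k_z] with [k_w] ([tkernel]),
    and [P] for the Gaussian projection ([transform]), which is the identity on [F^p]
    by the reproducing formula and is bounded by Young's inequality
    ([energy_transform]), because after weighting by [e^{-|z|^2/2}] its kernel becomes
    [e^{-|z-w|^2/2}].

    An operator [T] bounded on [F^p] is an integral operator: at each point, the
    weighted modulus of [T P u] is at most twice the integral of the weighted modulus
    of [u] against [t] ([kernel_bound]). This is clear if the reproducing kernel is
    replaced by its truncated power series, a finite sum of products of monomials, and
    the truncations converge fast enough.

    The kernel [t] is bounded, and on the diagonal it is the Berezin transform. Since
    [T K_z (w)] is antiholomorphic in [z] and holomorphic in [w], its values off the
    diagonal are controlled by those on the diagonal: restricted to suitable complex
    lines, real parameters give diagonal values. With a quantitative identity theorem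
    in one variable ([null_seq_off_real]), the decay of the Berezin transform implies
    that [t(z, w)] tends to 0 at infinity uniformly for [|z - w| <= rho], for every
    [rho] ([off_diagonal]).

    Let [h_k] be bounded in [F^p] and tend to 0 at every point. If [T] itself were
    sufficiently localized, Young's inequality would give that the norm of [T h_k]
    tends to 0: split the kernel into the part with [|z - w| > rho], of small mass, and
    the part with [|z - w| <= rho], which is small at infinity. In general [T] is close
    to a localized [S], but [rho] depends on [S], so the error [E = T - S] must not be
    multiplied by a power of [rho]. Therefore [S] is only used for the part of [h_k] far
    from a point [c], the remaining terms with [E] are estimated by the norm of [E], and
    the result is averaged over [c] ([local_estimate], [box_average], [energy_estimate],
    [energy_null]).

    Compactness follows: by Montel's theorem and Fatou's lemma ([montel]) a bounded
    sequence in [F^p] has a subsequence that converges at every point to some [g] in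
    [F^p], and the previous paragraph applies to the differences with [g].

    The analysis in several variables behind this is obtained from one variable: Goursat's
    theorem by bisection gives the mean value property on circles, averaging over the
    Gaussian gives the reproducing formula ([reproducing]), and conversely every
    function of the form [transform f] is entire ([entire_transform]). *)

Local Notation "x %:C" := (real_complex _ x) : ring_scope.
Local Notation "x +i* y" := (Complex x y) : ring_scope.

(** * Complex numbers and the Euclidean norm of C^n *)

Section complex_basics.
Context {R : realType}.
Implicit Types (z w a b : R[i]) (r s : R).

Lemma normr_normc z : `|z| = (normc z)%:C.
Proof. by case: z. Qed.

Lemma normcD z w : normc (z + w) <= normc z + normc w.
Proof. exact: le_normcD. Qed.

Lemma normc_ge0 z : 0 <= normc z.
Proof. by case: z => x y; exact: sqrtr_ge0. Qed.

Lemma normcNc z : normc (- z) = normc z.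
Proof. exact: normcN. Qed.

Lemma normcB z w : normc (z - w) <= normc z + normc w.
Proof. by rewrite -(normcNc w) normcD. Qed.

Lemma normc_real r : normc r%:C = `|r|.
Proof. by rewrite /= expr0n addr0 sqrtr_sqr. Qed.

Lemma normcX z m : normc (z ^+ m) = normc z ^+ m.
Proof. by elim: m => [|m IH]; rewrite ?expr0 ?normc1// !exprS normcM IH. Qed.

Lemma normc_conj z : normc z^* = normc z.
Proof. by case: z => x y; rewrite /= sqrrN. Qed.

Lemma normc_sum (I : Type) (s : seq I) (P : pred I) (F : I -> R[i]) :
  normc (\sum_(i <- s | P i) F i) <= \sum_(i <- s | P i) normc (F i).
Proof.
elim/big_ind2 : _ => [|x1 x2 y1 y2 h1 h2|//]; first by rewrite normc0.
by rewrite (le_trans (normcD _ _))// lerD.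
Qed.

Lemma normc_prod (I : Type) (s : seq I) (P : pred I) (F : I -> R[i]) :
  normc (\prod_(i <- s | P i) F i) = \prod_(i <- s | P i) normc (F i).
Proof. by elim/big_ind2 : _ => [|x1 x2 y1 y2 <- <-|//]; rewrite ?normc1 ?normcM. Qed.

Lemma ReD z w : complex.Re (z + w) = complex.Re z + complex.Re w.
Proof. by case: z; case: w. Qed.

Lemma ImD z w : complex.Im (z + w) = complex.Im z + complex.Im w.
Proof. by case: z; case: w. Qed.

Lemma ReN z : complex.Re (- z) = - complex.Re z.
Proof. by case: z. Qed.

Lemma ImN z : complex.Im (- z) = - complex.Im z.
Proof. by case: z. Qed.

Lemma Re_mul z w :
  complex.Re (z * w) = complex.Re z * complex.Re w - complex.Im z * complex.Im w.
Proof. by case: z; case: w. Qed.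

Lemma Im_mul z w :
  complex.Im (z * w) = complex.Re z * complex.Im w + complex.Im z * complex.Re w.
Proof. by case: z; case: w. Qed.

Lemma Re_conj z : complex.Re z^* = complex.Re z. Proof. by case: z. Qed.

Lemma Im_conj z : complex.Im z^* = - complex.Im z. Proof. by case: z. Qed.

Lemma Re_le_normc z : `|complex.Re z| <= normc z.
Proof.
case: z => x y /=; rewrite -[leLHS]sqrtr_sqr ler_wsqrtr// lerDl.
exact: sqr_ge0.
Qed.

Lemma Im_le_normc z : `|complex.Im z| <= normc z.
Proof.
case: z => x y /=; rewrite -[leLHS]sqrtr_sqr ler_wsqrtr// lerDr.
exact: sqr_ge0.
Qed.

Lemma normc_le_ReIm z : normc z <= `|complex.Re z| + `|complex.Im z|.
Proof.
case: z => x y /=; rewrite -(ler_pXn2r (n := 2))// ?nnegrE ?addr_ge0 ?sqrtr_ge0//.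
rewrite sqr_sqrtr ?addr_ge0 ?sqr_ge0// sqrrD !real_normK ?num_real//.
by rewrite -addrA lerD2l lerDr mulrn_wge0// mulr_ge0.
Qed.

Lemma complex_eq z w :
  complex.Re z = complex.Re w -> complex.Im z = complex.Im w -> z = w.
Proof. by case: z; case: w => /= ? ? ? ? -> ->. Qed.

Lemma realcM r s : (r * s)%:C = r%:C * s%:C. Proof. exact: rmorphM. Qed.

Lemma realcD r s : (r + s)%:C = r%:C + s%:C. Proof. exact: rmorphD. Qed.

Lemma conj_real r : (r%:C)^* = r%:C.
Proof. by apply: complex_eq; rewrite ?Re_conj ?Im_conj//= oppr0. Qed.

Lemma normc_sqr z : normc z ^+ 2 = complex.Re z ^+ 2 + complex.Im z ^+ 2.
Proof. by case: z => x y /=; rewrite sqr_sqrtr// addr_ge0 ?sqr_ge0. Qed.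

Lemma conj_mulc z : z^* * z = (normc z ^+ 2)%:C.
Proof.
rewrite normc_sqr; case: z => x y; apply: complex_eq.
  by rewrite Re_mul Re_conj Im_conj /=; ring.
by rewrite Im_mul Re_conj Im_conj /=; ring.
Qed.

End complex_basics.

Section euclidean.
Context {R : realType}.

Lemma sum_cauchy_schwarz (I : finType) (a b : I -> R) :
  \sum_i a i * b i <= Num.sqrt (\sum_i a i ^+ 2) * Num.sqrt (\sum_i b i ^+ 2).
Proof.
set A := Num.sqrt _; set B := Num.sqrt _.
have A2 : A ^+ 2 = \sum_i a i ^+ 2 by rewrite sqr_sqrtr// sumr_ge0// => i _; exact: sqr_ge0.
have B2 : B ^+ 2 = \sum_i b i ^+ 2 by rewrite sqr_sqrtr// sumr_ge0// => i _; exact: sqr_ge0.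
have A0 : 0 <= A := sqrtr_ge0 _. have B0 : 0 <= B := sqrtr_ge0 _.
have key : 2 * (A * B) * \sum_i a i * b i <= 2 * (A * B) * (A * B).
  have -> : 2 * (A * B) * (A * B) = B ^+ 2 * A ^+ 2 + A ^+ 2 * B ^+ 2 by ring.
  rewrite {1}A2 {2}B2 !mulr_sumr -big_split/=; apply: ler_sum => i _.
  by have := sqr_ge0 (B * a i - A * b i); nra.
have [AB0|AB0] := eqVneq (A * B) 0.
  rewrite AB0 (eq_bigr (fun=> 0)) ?big1// => i _.
  have zero c (e : \sum_i c i ^+ 2 = 0 :> R) : c i = 0.
    move/eqP : e; rewrite psumr_eq0; last by move=> ? _; exact: sqr_ge0.
    by move=> /allP /(_ i (mem_index_enum _)) /= /eqP /eqP; rewrite sqrf_eq0 => /eqP.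
  by case/eqP : AB0; rewrite mulf_eq0 => /orP[] /eqP e;
    [rewrite e expr0n in A2; rewrite (zero a)// mul0r
    |rewrite e expr0n in B2; rewrite (zero b)// mulr0].
by rewrite -(ler_pM2l (x := 2 * (A * B)))// mulr_gt0// lt0r AB0 mulr_ge0.
Qed.

Context {n : nat}.
Notation Cn := 'rV[R[i]]_n.
Implicit Types (z w : Cn) (a : R[i]).

Lemma enorm_ge0 z : 0 <= enorm z. Proof. exact: sqrtr_ge0. Qed.

Lemma enorm_sq z : enorm z ^+ 2 = \sum_j normc (z 0 j) ^+ 2.
Proof. by rewrite sqr_sqrtr// sumr_ge0// => i _; exact: sqr_ge0. Qed.

Lemma normc_le_enorm z j : normc (z 0 j) <= enorm z.
Proof.
rewrite -(ger0_norm (normc_ge0 _)) -sqrtr_sqr ler_wsqrtr//.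
by rewrite (bigD1 j)//= lerDl sumr_ge0// => i _; exact: sqr_ge0.
Qed.

Lemma dotcDr z w w' : dotc z (w + w') = dotc z w + dotc z w'.
Proof.
by rewrite /dotc -big_split/=; apply: eq_bigr => j _; rewrite mxE mulrDr.
Qed.

Lemma dotcDl z w w' : dotc (w + w') z = dotc w z + dotc w' z.
Proof.
by rewrite /dotc -big_split/=; apply: eq_bigr => j _; rewrite mxE rmorphD mulrDl.
Qed.

Lemma dotcZr a z w : dotc z (a *: w) = a * dotc z w.
Proof.
by rewrite /dotc mulr_sumr; apply: eq_bigr => j _; rewrite mxE mulrCA.
Qed.

Lemma dotcZl a z w : dotc (a *: z) w = a^* * dotc z w.
Proof.
by rewrite /dotc mulr_sumr; apply: eq_bigr => j _; rewrite mxE rmorphM mulrA.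
Qed.

Lemma dotcNr z w : dotc z (- w) = - dotc z w.
Proof. by rewrite -scaleN1r dotcZr mulN1r. Qed.

Lemma dotcNl z w : dotc (- z) w = - dotc z w.
Proof. by rewrite -scaleN1r dotcZl rmorphN rmorph1 mulN1r. Qed.

Lemma dotc0r z : dotc z 0 = 0.
Proof. by rewrite -(scale0r 0) dotcZr mul0r. Qed.

Lemma dotcC z w : (dotc z w)^* = dotc w z.
Proof.
rewrite /dotc rmorph_sum; apply: eq_bigr => j _.
by rewrite /= rmorphM /= conjCK mulrC.
Qed.

Lemma Re_dotcC z w : complex.Re (dotc w z) = complex.Re (dotc z w).
Proof. by rewrite -dotcC Re_conj. Qed.

Lemma dotcc z : dotc z z = (enorm z ^+ 2)%:C.
Proof.
rewrite enorm_sq rmorph_sum; apply: eq_bigr => j _; exact: conj_mulc.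
Qed.

Lemma normc_dotc z w : normc (dotc z w) <= enorm z * enorm w.
Proof.
rewrite (le_trans (normc_sum _ _ _))//=.
under eq_bigr do rewrite normcM normc_conj.
exact: sum_cauchy_schwarz.
Qed.

Lemma enormD_sq z w :
  enorm (z + w) ^+ 2 = enorm z ^+ 2 + enorm w ^+ 2 + 2 * complex.Re (dotc z w).
Proof.
have e (u : Cn) : enorm u ^+ 2 = complex.Re (dotc u u) by rewrite dotcc.
by rewrite !e dotcDr !dotcDl !ReD (Re_dotcC z w); ring.
Qed.

Lemma enormB_sq z w :
  enorm (z - w) ^+ 2 = enorm z ^+ 2 + enorm w ^+ 2 - 2 * complex.Re (dotc z w).
Proof.
have e (u : Cn) : enorm u ^+ 2 = complex.Re (dotc u u) by rewrite dotcc.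
by rewrite enormD_sq dotcNr ReN (e (- w)) dotcNr dotcNl opprK -e; ring.
Qed.

Lemma Re_dotc_le z w : complex.Re (dotc z w) <= enorm z * enorm w.
Proof.
by rewrite (le_trans (ler_norm _))// (le_trans (Re_le_normc _))// normc_dotc.
Qed.

Lemma enormD z w : enorm (z + w) <= enorm z + enorm w.
Proof.
rewrite -(ler_pXn2r (n := 2))// ?nnegrE ?addr_ge0 ?enorm_ge0//.
by rewrite enormD_sq; have := Re_dotc_le z w; nra.
Qed.

Lemma enormZ a z : enorm (a *: z) = normc a * enorm z.
Proof.
apply/eqP; rewrite -(eqrXn2 (n := 2))// ?mulr_ge0 ?enorm_ge0 ?normc_ge0//.
rewrite exprMn !enorm_sq mulr_sumr; apply/eqP/eq_bigr => j _.
by rewrite mxE normcM exprMn.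
Qed.

Lemma enormN z : enorm (- z) = enorm z.
Proof. by rewrite -scaleN1r enormZ normcNc normc1 mul1r. Qed.

Lemma enormC z w : enorm (z - w) = enorm (w - z).
Proof. by rewrite -enormN opprB. Qed.

Lemma enormB z w : enorm (z - w) <= enorm z + enorm w.
Proof. by rewrite -(enormN w) enormD. Qed.

Lemma enorm_le_sum z : enorm z <= \sum_j normc (z 0 j).
Proof.
rewrite -[leRHS]ger0_norm ?sumr_ge0// -?sqrtr_sqr; last by move=> *; exact: normc_ge0.
rewrite ler_wsqrtr// expr2 mulr_suml ler_sum// => j _.
rewrite expr2 ler_wpM2l ?normc_ge0// (bigD1 j)//= lerDl sumr_ge0// => *.
exact: normc_ge0.
Qed.

End euclidean.

(** * The complex exponential *)

Section exponential.
Context {R : realType}.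
Implicit Types (a b : R[i]) (r t : R).

Lemma Re_realM r a : complex.Re (r%:C * a) = r * complex.Re a.
Proof. by rewrite Re_mul /= mul0r subr0. Qed.

Lemma Im_realM r a : complex.Im (r%:C * a) = r * complex.Im a.
Proof. by rewrite Im_mul /= mul0r addr0. Qed.

Lemma Re_cexp a : complex.Re (cexp a) = expR (complex.Re a) * cos (complex.Im a).
Proof. by rewrite /cexp Re_realM. Qed.

Lemma Im_cexp a : complex.Im (cexp a) = expR (complex.Re a) * sin (complex.Im a).
Proof. by rewrite /cexp Im_realM. Qed.

Lemma cexp0 : cexp 0 = 1 :> R[i].
Proof.
by apply: complex_eq; rewrite ?Re_cexp ?Im_cexp/= expR0 ?cos0 ?sin0 ?mulr1 ?mulr0.
Qed.

Lemma cexpD a b : cexp (a + b) = cexp a * cexp b.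
Proof.
apply: complex_eq.
  by rewrite Re_cexp [RHS]Re_mul !Re_cexp !Im_cexp ReD ImD expRD cosD; ring.
by rewrite Im_cexp [RHS]Im_mul !Re_cexp !Im_cexp ReD ImD expRD sinD; ring.
Qed.

Lemma normc_cexp a : normc (cexp a) = expR (complex.Re a).
Proof.
rewrite /cexp normcM normc_real ger0_norm ?expR_ge0//=.
by rewrite cos2Dsin2 sqrtr1 mulr1.
Qed.

Lemma cexp_conj a : cexp a^* = (cexp a)^*.
Proof.
apply: complex_eq; rewrite ?Re_conj ?Im_conj ?Re_cexp ?Im_cexp Re_conj Im_conj.
  by rewrite cosN.
by rewrite sinN mulrN.
Qed.

Lemma cexp_real r : cexp r%:C = (expR r)%:C.
Proof.
by apply: complex_eq; rewrite ?Re_cexp ?Im_cexp/= ?cos0 ?sin0 ?mulr1 ?mulr0.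
Qed.

Lemma le_expR_normc_cexp a : normc (cexp a) <= expR (normc a).
Proof. by rewrite normc_cexp ler_expR (le_trans (ler_norm _))// Re_le_normc. Qed.

Definition cexp_trunc (N : nat) a : R[i] :=
  \sum_(m < N) (m`!%:R^-1)%:C * a ^+ m.

Let der_mono (c t : R) m :
  is_derive t (1 : R) (fun s : R => c * s ^+ m) (c * (m%:R * t ^+ m.-1)).
Proof.
have dX := @is_deriveX R R id m t 1 1 (is_derive_id t 1).
have := @is_deriveZ _ _ _ _ c _ _ _ dX.
rewrite /GRing.scale/= /GRing.scale/= mulr1.
rewrite (_ : c \*: id ^+ m = fun s : R => c * s ^+ m)//.
by apply/funext => s; rewrite /= exprfctE.
Qed.

(** Integration of a monomial bound, through the sign of a derivative. *)
Let der_le (h dh : R -> R) (B : R) N :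
  (forall t, is_derive t 1 h (dh t)) -> h 0 = 0 ->
  (forall t, 0 <= t <= 1 -> `|dh t| <= B * t ^+ N) ->
  forall t, 0 <= t <= 1 -> `|h t| <= B / N.+1%:R * t ^+ N.+1.
Proof.
move=> hd h0 hB.
have half (f df : R -> R) : (forall t, is_derive t 1 f (df t)) -> f 0 = 0 ->
    (forall t, 0 <= t <= 1 -> df t <= B * t ^+ N) ->
    forall t, 0 <= t <= 1 -> f t <= B / N.+1%:R * t ^+ N.+1.
  move=> fd f0 fB t /andP[t0 t1].
  pose g s := B / N.+1%:R * s ^+ N.+1 - f s.
  have gd (s : R) : is_derive s (1 : R) g (B * s ^+ N - df s).
    have dB := @is_deriveB _ _ _ _ _ _ _ _ _ (der_mono (B / N.+1%:R) s N.+1) (fd s).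
    have e : B / N.+1%:R * (N.+1%:R * s ^+ N) = B * s ^+ N.
      by field; rewrite nat1r pnatr_eq0.
    by rewrite /= e in dB.
  have : g 0 <= g t.
    apply: (@ger0_derive1_le_cc _ g 0 1).
    - by move=> x _; apply: (@ex_derive _ _ _ _ _ _ _ (gd x)).
    - move=> x; rewrite in_itv/= => /andP[x0 x1].
      by rewrite derive1E (@derive_val _ _ _ _ _ _ _ (gd x)) subr_ge0 fB// !ltW.
    - apply: derivable_within_continuous => x _.
      by apply: (@ex_derive _ _ _ _ _ _ _ (gd x)).
    - by rewrite in_itv/= lexx ler01.
    - by rewrite in_itv/= t0 t1.
    - by [].
  by rewrite /g f0 expr0n/= mulr0 subr0 subr_ge0.
move=> t tI; rewrite ler_norml lerNl; apply/andP; split.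
  have hNd (s : R) : is_derive s (1 : R) (fun s => - h s) (- dh s).
    exact: is_deriveN.
  have hN0 : - h 0 = 0 by rewrite h0 oppr0.
  refine (half _ _ hNd hN0 _ t tI) => s sI.
  by rewrite (le_trans _ (hB _ sI))// (le_trans (ler_norm _))// normrN.
refine (half _ _ hd h0 _ t tI) => s sI.
by rewrite (le_trans _ (hB _ sI))// ler_norm.
Qed.

(** The remainder along the segment from 0 to [a]: its derivative in [t] is [a]
    times the previous remainder, so that the bounds follow by induction on [N]. *)
Let rem N a t : R[i] := cexp (t%:C * a) - cexp_trunc N (t%:C * a).

Let rem_term a t m :
  (m`!%:R^-1)%:C * (t%:C * a) ^+ m = (m`!%:R^-1 * t ^+ m)%:C * a ^+ m.
Proof. by rewrite exprMn mulrA -rmorphXn -realcM. Qed.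

Let Re_trunc N a t : complex.Re (cexp_trunc N (t%:C * a)) =
  \sum_(m < N) (m`!%:R^-1 * complex.Re (a ^+ m)) * t ^+ m.
Proof.
rewrite /cexp_trunc; elim/big_ind2 : _ => // [x1 x2 y1 y2 <- <-|m _].
  by rewrite ReD.
by rewrite rem_term Re_realM mulrAC.
Qed.

Let Im_trunc N a t : complex.Im (cexp_trunc N (t%:C * a)) =
  \sum_(m < N) (m`!%:R^-1 * complex.Im (a ^+ m)) * t ^+ m.
Proof.
rewrite /cexp_trunc; elim/big_ind2 : _ => // [x1 x2 y1 y2 <- <-|m _].
  by rewrite ImD.
by rewrite rem_term Im_realM mulrAC.
Qed.

Let der_poly N (c : nat -> R) t :
  is_derive t 1 (fun s => \sum_(m < N.+1) c m * s ^+ m)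
    (\sum_(m < N) m.+1%:R * c m.+1 * t ^+ m).
Proof.
have -> : (fun s => \sum_(m < N.+1) c m * s ^+ m) =
          \sum_(m < N.+1) (fun s => c m * s ^+ m).
  by apply/funext => s; rewrite fct_sumE.
have -> : \sum_(m < N) m.+1%:R * c m.+1 * t ^+ m =
          \sum_(m < N.+1) c m * (m%:R * t ^+ m.-1).
  rewrite big_ord_recl/= mul0r mulr0 add0r; apply: eq_bigr => m _.
  by rewrite mulrAC mulrC mulrA.
by apply: is_derive_sum => m; exact: der_mono.
Qed.

Let der_rem_Re N a t :
  is_derive t 1 (fun s => complex.Re (rem N.+1 a s)) (complex.Re (a * rem N a t)).
Proof.
have -> : (fun s => complex.Re (rem N.+1 a s)) =
   (fun s => expR (s * complex.Re a) * cos (s * complex.Im a)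
     - \sum_(m < N.+1) (m`!%:R^-1 * complex.Re (a ^+ m)) * s ^+ m).
  apply/funext => s.
  by rewrite /rem ReD ReN Re_cexp Re_realM Im_realM Re_trunc.
have -> : complex.Re (a * rem N a t) =
   (expR (t * complex.Re a) * complex.Re a * cos (t * complex.Im a)
    - expR (t * complex.Re a) * (sin (t * complex.Im a) * complex.Im a))
   - \sum_(m < N) m.+1%:R * (m.+1`!%:R^-1 * complex.Re (a ^+ m.+1)) * t ^+ m.
  rewrite /rem mulrBr ReD ReN [X in _ - X]Re_mul; congr (_ - _).
    by rewrite Re_mul Re_cexp Im_cexp Re_realM Im_realM; ring.
  rewrite Re_trunc Im_trunc !mulr_sumr -sumrB; apply: eq_bigr => m _.
  rewrite exprS Re_mul factS natrM invfM.
  by field; rewrite ?nat1r ?pnatr_eq0 -?lt0n ?fact_gt0.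
apply: is_deriveB; last exact: (der_poly N (fun m => m`!%:R^-1 * complex.Re (a ^+ m))).
by apply: is_derive_eq; rewrite /GRing.scale/= /GRing.scale/= !mulr1; ring.
Qed.

Let der_rem_Im N a t :
  is_derive t 1 (fun s => complex.Im (rem N.+1 a s)) (complex.Im (a * rem N a t)).
Proof.
have -> : (fun s => complex.Im (rem N.+1 a s)) =
   (fun s => expR (s * complex.Re a) * sin (s * complex.Im a)
     - \sum_(m < N.+1) (m`!%:R^-1 * complex.Im (a ^+ m)) * s ^+ m).
  apply/funext => s.
  by rewrite /rem ImD ImN Im_cexp Re_realM Im_realM Im_trunc.
have -> : complex.Im (a * rem N a t) =
   (expR (t * complex.Re a) * complex.Re a * sin (t * complex.Im a)
    + expR (t * complex.Re a) * (cos (t * complex.Im a) * complex.Im a))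
   - \sum_(m < N) m.+1%:R * (m.+1`!%:R^-1 * complex.Im (a ^+ m.+1)) * t ^+ m.
  rewrite /rem mulrBr ImD ImN [X in _ - X]Im_mul; congr (_ - _).
    by rewrite Im_mul Re_cexp Im_cexp Re_realM Im_realM; ring.
  rewrite Re_trunc Im_trunc !mulr_sumr -big_split/=; apply: eq_bigr => m _.
  rewrite exprS Im_mul factS natrM invfM.
  by field; rewrite ?nat1r ?pnatr_eq0 -?lt0n ?fact_gt0.
apply: is_deriveB; last exact: (der_poly N (fun m => m`!%:R^-1 * complex.Im (a ^+ m))).
by apply: is_derive_eq; rewrite /GRing.scale/= /GRing.scale/= !mulr1; ring.
Qed.

Let rem_at0 N a : rem N.+1 a 0 = 0.
Proof.
rewrite /rem mul0r cexp0 /cexp_trunc big_ord_recl/= expr0 mulr1 fact0 invr1.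
by rewrite big1 ?addr0 ?subrr// => m _; rewrite expr0n/= mulr0.
Qed.

Let rem_le N a t : 0 <= t <= 1 ->
  normc (rem N a t) <= (2 * normc a) ^+ N / N`!%:R * expR (normc a) * t ^+ N.
Proof.
elim: N t => [|N IH] t tI.
  rewrite !expr0 fact0 divr1 mul1r mulr1 /rem /cexp_trunc big_ord0 subr0.
  rewrite (le_trans (le_expR_normc_cexp _))// ler_expR normcM normc_real.
  by case/andP: tI => t0 t1; rewrite ger0_norm// ler_piMl ?normc_ge0.
set B := (2 * normc a) ^+ N / N`!%:R * expR (normc a) in IH.
have B0 : 0 <= B by rewrite !mulr_ge0 ?invr_ge0 ?exprn_ge0 ?mulr_ge0 ?expR_ge0 ?normc_ge0.
have hb s : 0 <= s <= 1 -> normc (a * rem N a s) <= normc a * B * s ^+ N.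
  by move=> sI; rewrite normcM -mulrA ler_wpM2l ?normc_ge0 ?IH.
have hR := der_le (der_rem_Re N a) (congr1 (@complex.Re _) (rem_at0 N a))
  (fun s sI => le_trans (Re_le_normc _) (hb s sI)) tI.
have hI := der_le (der_rem_Im N a) (congr1 (@complex.Im _) (rem_at0 N a))
  (fun s sI => le_trans (Im_le_normc _) (hb s sI)) tI.
rewrite (le_trans (normc_le_ReIm _))// (le_trans (lerD hR hI))//.
rewrite exprS factS natrM invfM le_eqVlt; apply/orP; left; apply/eqP.
rewrite /B [(2 * _) ^+ N.+1]exprS; field.
by rewrite ?nat1r ?pnatr_eq0 -?lt0n ?fact_gt0.
Qed.

(** The factor 2 comes from estimating real and imaginary parts separately by
    the real mean value inequality; the factorial absorbs it. *)
Lemma cexp_trunc_le N a :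
  normc (cexp a - cexp_trunc N a) <= (2 * normc a) ^+ N / N`!%:R * expR (normc a).
Proof. by have := @rem_le N a 1; rewrite /rem mul1r expr1n mulr1 ler01 lexx; apply. Qed.

Lemma exp_term_le (x : R) N : 0 <= x -> x ^+ N / N`!%:R <= expR x.
Proof.
case: N => [|N] x0; first by rewrite expr0 fact0 divr1 -expR0 ler_expR.
by rewrite (le_trans _ (expR_ge1Dxn N x0))// lerDr.
Qed.



End exponential.

(** * Goursat's theorem on rectangles and the circle mean value property *)

Section goursat.
Context {R : realType}.

(** The bisection argument behind Goursat's theorem, for an additive function
    [D] of rectangles that is negligible compared with the area near every
    point: a nonzero value would persist, at the scale of the area, in a nested
    sequence of quarters that shrinks to a point. *)
Lemma rectangle_bisection (D : R -> R -> R -> R -> R) :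
  (forall x0 x1 x2 y0 y1, x0 <= x1 -> x1 <= x2 -> y0 <= y1 ->
     D x0 x2 y0 y1 = D x0 x1 y0 y1 + D x1 x2 y0 y1) ->
  (forall x0 x1 y0 y1 y2, x0 <= x1 -> y0 <= y1 -> y1 <= y2 ->
     D x0 x1 y0 y2 = D x0 x1 y0 y1 + D x0 x1 y1 y2) ->
  (forall a b e, 0 < e -> exists2 d : R, 0 < d & forall x0 x1 y0 y1,
     x0 <= a <= x1 -> y0 <= b <= y1 -> x1 - x0 < d -> y1 - y0 < d ->
     `|D x0 x1 y0 y1| <= e * ((x1 - x0) + (y1 - y0)) ^+ 2) ->
  forall x0 x1 y0 y1, x0 <= x1 -> y0 <= y1 -> D x0 x1 y0 y1 = 0.
Proof.
move=> addx addy small x0 x1 y0 y1 x01 y01.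
have [->//|Dn0] := eqVneq (D x0 x1 y0 y1) 0.
pose half (b : bool) (I : R * R) : R * R :=
  if b then ((I.1 + I.2) / 2, I.2) else (I.1, (I.1 + I.2) / 2).
pose Dq (q : (R * R) * (R * R)) := D q.1.1 q.1.2 q.2.1 q.2.2.
pose good (q : (R * R) * (R * R)) := q.1.1 <= q.1.2 /\ q.2.1 <= q.2.2.
have halfle b I : I.1 <= I.2 ->
    [/\ (half b I).1 <= (half b I).2, I.1 <= (half b I).1 & (half b I).2 <= I.2].
  by move=> ?; rewrite /half; case: b => /=; split; lra.
have halfsize b I : (half b I).2 - (half b I).1 = (I.2 - I.1) / 2.
  by rewrite /half; case: b => /=; field.
have stepE q : exists c : bool * bool, good q ->
    `|Dq q| / 4 <= `|Dq (half c.1 q.1, half c.2 q.2)|.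
  have [gq|] := pselect (good q); last by exists (true, true).
  apply: contrapT => /forallNP H.
  have {}H c : `|Dq (half c.1 q.1, half c.2 q.2)| < `|Dq q| / 4.
    by rewrite ltNge; apply/negP => h; apply: (H c).
  case: q gq H => -[a1 a2] [b1 b2] [/= a12 b12] H.
  have E : Dq (a1, a2, (b1, b2)) =
    (Dq (half false (a1, a2), half false (b1, b2)) +
     Dq (half false (a1, a2), half true (b1, b2))) +
    (Dq (half true (a1, a2), half false (b1, b2)) +
     Dq (half true (a1, a2), half true (b1, b2))).
    rewrite /Dq /half/= -!addy; try lra.
    by rewrite -addx//; lra.
  have ch c1 c2 : `|Dq (half c1 (a1, a2), half c2 (b1, b2))|
      < `|Dq (a1, a2, (b1, b2))| / 4 by exact: (H (c1, c2)).
  have h1 := ch false false; have h2 := ch false true.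
  have h3 := ch true false; have h4 := ch true true.
  move: E h1 h2 h3 h4.
  set d4 := Dq (half true _, half true _); set d3 := Dq (half true _, half false _).
  set d2 := Dq (half false _, half true _); set d1 := Dq (half false _, half false _).
  move=> E; have := ler_normD (d1 + d2) (d3 + d4); rewrite -E.
  have := ler_normD d1 d2; have := ler_normD d3 d4; lra.
have [ch chP] := choice stepE.
pose step q := (half (ch q).1 q.1, half (ch q).2 q.2).
pose Q n := iter n step ((x0, x1), (y0, y1)).
have Qgood n : good (Q n).
  elim: n => [//|n [h1 h2]]; split; rewrite /Q iterS -/(Q n) /step /=.
    by have [] := halfle (ch (Q n)).1 _ h1.
  by have [] := halfle (ch (Q n)).2 _ h2.
have QD n : `|D x0 x1 y0 y1| / 4 ^+ n <= `|Dq (Q n)|.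
  elim: n => [|n IH]; first by rewrite expr0 divr1.
  rewrite /Q iterS -/(Q n) (le_trans _ (chP _ (Qgood n)))//.
  by rewrite exprSr invfM mulrA ler_pM2r.
have Qsize n : ((Q n).1.2 - (Q n).1.1 = (x1 - x0) / 2 ^+ n) /\
               ((Q n).2.2 - (Q n).2.1 = (y1 - y0) / 2 ^+ n).
  elim: n => [|n [h1 h2]]; first by rewrite expr0 !divr1.
  rewrite /Q iterS -/(Q n) /step /= !halfsize h1 h2 exprSr.
  by split; rewrite invfM mulrA.
have Qnest n k : [/\ (Q n).1.1 <= (Q (n + k)%N).1.1, (Q (n + k)%N).1.2 <= (Q n).1.2,
    (Q n).2.1 <= (Q (n + k)%N).2.1 & (Q (n + k)%N).2.2 <= (Q n).2.2].
  elim: k => [|k [h1 h2 h3 h4]]; first by rewrite addn0.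
  rewrite addnS /Q iterS -/(Q _) /step/=; have [g1 g2] := Qgood (n + k)%N.
  have [_ a1 a2] := halfle (ch (Q (n + k)%N)).1 _ g1.
  have [_ b1 b2] := halfle (ch (Q (n + k)%N)).2 _ g2.
  by split; [apply: le_trans a1|apply: (le_trans a2)|apply: le_trans b1|apply: (le_trans b2)].
have Qcross n m : (Q n).1.1 <= (Q m).1.2 /\ (Q n).2.1 <= (Q m).2.2.
  have [h1 h2 h3 h4] := Qnest n m; have [k1 k2 k3 k4] := Qnest m n.
  rewrite addnC in k1 k2 k3 k4; have [g1 g2] := Qgood (n + m)%N.
  by split; [exact: (le_trans h1 (le_trans g1 k2))|exact: (le_trans h3 (le_trans g2 k4))].
pose A := [set (Q n).1.1 | n in [set: nat]].
pose B := [set (Q n).2.1 | n in [set: nat]].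
have supA n : (Q n).1.1 <= sup A <= (Q n).1.2.
  apply/andP; split.
    apply: ub_le_sup; last by exists n.
    by exists (Q n).1.2 => _ [m _ <-]; case: (Qcross m n).
  apply: ge_sup; first by exists (Q n).1.1; exists n.
  by move=> _ [m _ <-]; case: (Qcross m n).
have supB n : (Q n).2.1 <= sup B <= (Q n).2.2.
  apply/andP; split.
    apply: ub_le_sup; last by exists n.
    by exists (Q n).2.2 => _ [m _ <-]; case: (Qcross m n).
  apply: ge_sup; first by exists (Q n).2.1; exists n.
  by move=> _ [m _ <-]; case: (Qcross m n).
have D0 : 0 < `|D x0 x1 y0 y1| by rewrite normr_gt0.
pose S := (x1 - x0) + (y1 - y0).
have S0 : 0 <= S by rewrite addr_ge0 ?subr_ge0.
pose e := `|D x0 x1 y0 y1| / (2 * (S ^+ 2 + 1)).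
have e0 : 0 < e by rewrite divr_gt0// mulr_gt0// ltr_wpDl ?sqr_ge0.
have [d d0 hd] := small (sup A) (sup B) e e0.
have [n hn] : exists n : nat, S / d < 2 ^+ n.
  have [n hn] : exists n : nat, S / d < n%:R.
    by exists (Num.truncn (S / d)).+1; rewrite truncnS_gt.
  exists n; rewrite (lt_le_trans hn)// -natrX ler_nat.
  by rewrite ltnW// ltn_expl.
have p0 : 0 < 2 ^+ n :> R by rewrite exprn_gt0.
have Sd : S / 2 ^+ n < d by rewrite ltr_pdivrMr// mulrC -ltr_pdivrMr.
have [s1 s2] := Qsize n.
have := hd _ _ _ _ (supA n) (supB n).
rewrite s1 s2 => /(_ _)/(_ _) H.
have {H} : `|Dq (Q n)| <= e * (S / 2 ^+ n) ^+ 2.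
  have sub T : 0 <= T -> T <= S -> T / 2 ^+ n < d.
    by move=> T0 TS; rewrite (le_lt_trans _ Sd)// ler_pM2r ?invr_gt0.
  have := H _ _; rewrite -mulrDl -/S; apply.
    by apply: sub; rewrite ?subr_ge0// lerDl subr_ge0.
  by apply: sub; rewrite ?subr_ge0// lerDr subr_ge0.
move=> /(le_trans (QD n)).
rewrite expr_div_n -exprM mulnC exprM (_ : 2 ^+ 2 = 4 :> R); last by ring.
rewrite mulrA ler_pM2r ?invr_gt0 ?exprn_gt0// /e.
rewrite mulrAC ler_pdivlMr ?mulr_gt0 ?ltr_wpDl ?sqr_ge0// leNgt => /negP[].
by rewrite ltr_pM2l//; have := sqr_ge0 S; lra.
Qed.


Local Notation mu := (@lebesgue_measure R).
Local Notation "'I[' f , a , b ]" := (\int[mu]_(x in `[a, b]) (f x)).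

Let int_cont (f : R -> R) a b : continuous f -> mu.-integrable `[a, b] (EFin \o f).
Proof.
move=> cf; apply: continuous_compact_integrable; first exact: segment_compact.
by apply: continuous_subspaceT => x; exact: cf.
Qed.

Let int_add (f : R -> R) a b c : continuous f -> a <= b -> b <= c ->
  I[f, a, c] = I[f, a, b] + I[f, b, c].
Proof.
move=> cf ab bc; rewrite -(@Rintegral_itv_obnd_cbnd _ b).
  by rewrite -(@Rintegral_itvB _ f (BLeft a) (BRight c) b) ?bnd_simp//;
    [rewrite addrCA subrr addr0|exact: int_cont].
apply: integrableS (int_cont b c cf) => //.
exact: subset_itv_oc_cc.
Qed.

Let int_bound (f : R -> R) a b M : continuous f -> a <= b ->
  (forall x, a <= x <= b -> `|f x| <= M) -> `|I[f, a, b]| <= M * (b - a).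
Proof.
move=> cf ab fM; rewrite (le_trans (le_normr_Rintegral _ _))//; first exact: int_cont.
have -> : M * (b - a) = I[(fun=> M), a, b].
  rewrite Rintegral_cst//= lebesgue_measure_itv/= lte_fin.
  by case: ltgtP ab => //= ->; rewrite subrr.
apply: le_Rintegral => //.
- by apply: int_cont => x; apply: continuous_comp; [exact: cf|exact: norm_continuous].
- by apply: int_cont => x; exact: cst_continuous.
Qed.

Let int_sub (f g : R -> R) a b : continuous f -> continuous g ->
  I[(fun x => f x - g x), a, b] = I[f, a, b] - I[g, a, b].
Proof. by move=> cf cg; apply: RintegralB => //; exact: int_cont. Qed.

(** Near a point, [u] and [v] are their first order expansions, whose boundary
    integral vanishes by the Cauchy-Riemann equations, up to an error that is
    small compared with the size of the rectangle; bisection does the rest. The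
    two sides are the parts of the real part of the boundary integral of
    [(u + i v) d(x + i y)]. *)
Lemma goursat_rectangle (u v : R -> R -> R) :
  (forall y, continuous (u ^~ y)) -> (forall x, continuous (v x)) ->
  (forall a b, exists al be, forall e : R, 0 < e -> exists2 d : R, 0 < d &
     forall x y, `|x - a| < d -> `|y - b| < d ->
     `|u x y - u a b - (al * (x - a) - be * (y - b))| <= e * (`|x - a| + `|y - b|) /\
     `|v x y - v a b - (be * (x - a) + al * (y - b))| <= e * (`|x - a| + `|y - b|)) ->
  forall x0 x1 y0 y1, x0 <= x1 -> y0 <= y1 ->
  I[(fun x => u x y0 - u x y1), x0, x1] = I[(fun y => v x1 y - v x0 y), y0, y1].
Proof.
move=> cu cv cr x0 x1 y0 y1 x01 y01; apply/eqP; rewrite -subr_eq0; apply/eqP.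
have cuB y y' : continuous (fun x => u x y - u x y').
  by move=> x; apply: continuousB; exact: cu.
have cvB x x' : continuous (fun y => v x y - v x' y).
  by move=> y; apply: continuousB; exact: cv.
have contB (f : R -> R) (c : R) : continuous f -> continuous (fun x : R => f x - c).
  by move=> cf x; apply: continuousB; [exact: cf|exact: cst_continuous].
move: x0 x1 y0 y1 x01 y01.
apply: (rectangle_bisection (D := fun x0 x1 y0 y1 =>
  I[(fun x => u x y0 - u x y1), x0, x1] - I[(fun y => v x1 y - v x0 y), y0, y1])).
- move=> x0 x1 x2 y0 y1 x01 x12 y01; rewrite (int_add _ x01 x12)//.
  by rewrite !int_sub//; ring.
- move=> x0 x1 y0 y1 y2 x01 y01 y12; rewrite (int_add _ y01 y12)//.
  by rewrite !int_sub//; ring.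
move=> a b e e0; have [al [be H]] := cr a b.
have [|d d0 {}H] := H (e / 4); first by rewrite divr_gt0.
exists d => // x0 x1 y0 y1 /andP[xa ax] /andP[yb by_] xd yd.
set S := (x1 - x0) + (y1 - y0).
have nx x : x0 <= x <= x1 -> `|x - a| <= x1 - x0.
  by move=> /andP[? ?]; rewrite ler_norml; apply/andP; split; lra.
have ny y : y0 <= y <= y1 -> `|y - b| <= y1 - y0.
  by move=> /andP[? ?]; rewrite ler_norml; apply/andP; split; lra.
have e4 : 0 <= e / 4 by rewrite divr_ge0// ltW.
have est x y : x0 <= x <= x1 -> y0 <= y <= y1 ->
    `|u x y - u a b - (al * (x - a) - be * (y - b))| <= e / 4 * S /\
    `|v x y - v a b - (be * (x - a) + al * (y - b))| <= e / 4 * S.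
  move=> xI yI; have [//||h1 h2] := H x y.
  - exact: le_lt_trans (nx _ xI) xd.
  - exact: le_lt_trans (ny _ yI) yd.
  have hS : e / 4 * (`|x - a| + `|y - b|) <= e / 4 * S.
    by rewrite ler_wpM2l// lerD// ?nx ?ny.
  by split; [exact: le_trans h1 hS|exact: le_trans h2 hS].
have x01 : x0 <= x1 by exact: le_trans xa ax.
have y01 : y0 <= y1 by exact: le_trans yb by_.
(* after subtracting the linear part both integrands are constant *)
have -> : I[(fun x => u x y0 - u x y1), x0, x1] - I[(fun y => v x1 y - v x0 y), y0, y1] =
  I[(fun x => (u x y0 - u x y1) - be * (y1 - y0)), x0, x1] -
  I[(fun y => (v x1 y - v x0 y) - be * (x1 - x0)), y0, y1].
  have Ic c p q : p <= q -> I[(fun=> c), p, q] = c * (q - p).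
    move=> pq; rewrite Rintegral_cst//= lebesgue_measure_itv/= lte_fin.
    by case: ltgtP pq => //= ->; rewrite subrr.
  rewrite (int_sub (f := fun x => u x y0 - u x y1) (g := fun=> be * (y1 - y0)))//;
    last by move=> x; exact: cst_continuous.
  rewrite (int_sub (f := fun y => v x1 y - v x0 y) (g := fun=> be * (x1 - x0)))//;
    last by move=> x; exact: cst_continuous.
  by rewrite !Ic//; ring.
have B1 : `|I[(fun x => (u x y0 - u x y1) - be * (y1 - y0)), x0, x1]| <= e / 2 * S * (x1 - x0).
  apply: int_bound => // [|x xI]; first exact: (contB _ _ (cuB y0 y1)).
  have [|h1 _] := est x y0 xI; first by rewrite y01 lexx.
  have [|h2 _] := est x y1 xI; first by rewrite y01 lexx.
  have -> : u x y0 - u x y1 - be * (y1 - y0) =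
    (u x y0 - u a b - (al * (x - a) - be * (y0 - b))) -
    (u x y1 - u a b - (al * (x - a) - be * (y1 - b))) by ring.
  rewrite (le_trans (ler_normB _ _))//.
  have -> : e / 2 * S = e / 4 * S + e / 4 * S by field.
  by rewrite lerD.
have B2 : `|I[(fun y => (v x1 y - v x0 y) - be * (x1 - x0)), y0, y1]| <= e / 2 * S * (y1 - y0).
  apply: int_bound => // [|y yI]; first exact: (contB _ _ (cvB x1 x0)).
  have [|_ h1] := est x1 y _ yI; first by rewrite x01 lexx.
  have [|_ h2] := est x0 y _ yI; first by rewrite x01 lexx.
  have -> : v x1 y - v x0 y - be * (x1 - x0) =
    (v x1 y - v a b - (be * (x1 - a) + al * (y - b))) -
    (v x0 y - v a b - (be * (x0 - a) + al * (y - b))) by ring.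
  rewrite (le_trans (ler_normB _ _))//.
  have -> : e / 2 * S = e / 4 * S + e / 4 * S by field.
  by rewrite lerD.
rewrite (le_trans (ler_normB _ _))// (le_trans (lerD B1 B2))// -mulrDr -/S.
have S0 : 0 <= S by rewrite addr_ge0 ?subr_ge0.
have := mulr_ge0 (ltW e0) (sqr_ge0 S); lra.
Qed.


Definition cdiff (f : R[i] -> R[i]) := forall a, exists d, forall e : R, 0 < e ->
  exists2 r : R, 0 < r & forall h, normc h < r ->
    normc (f (a + h) - f a - d * h) <= e * normc h.

Lemma cdiff_cont (f : R[i] -> R[i]) : cdiff f -> forall a (e : R), 0 < e ->
  exists2 r : R, 0 < r & forall h, normc h < r -> normc (f (a + h) - f a) <= e.
Proof.
move=> cf a e e0; have [d H] := cf a; have [r r0 {}H] := H 1 ltr01.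
have d1 : 0 < normc d + 1 by rewrite ltr_wpDl ?normc_ge0.
exists (Num.min r (e / (normc d + 1))); first by rewrite lt_min r0 divr_gt0.
move=> h; rewrite lt_min => /andP[hr he].
have -> : f (a + h) - f a = (f (a + h) - f a - d * h) + d * h by ring.
rewrite (le_trans (normcD _ _))// (le_trans (lerD (H _ hr) (lexx _)))//.
by rewrite normcM -mulrDl addrC -ler_pdivlMl// mulrC ltW.
Qed.

Lemma cdiff_comp_cexp (f : R[i] -> R[i]) : cdiff f -> cdiff (f \o cexp).
Proof.
move=> cf a; set b := cexp a; have [d H] := cf b.
exists (d * b) => e e0 /=.
pose B := normc b + 1.
have B0 : 0 < B by rewrite ltr_wpDl ?normc_ge0.
have d0 : 0 < normc d + 1 by rewrite ltr_wpDl ?normc_ge0.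
pose M : R := 2 * expR 1.
have M0 : 0 < M by rewrite mulr_gt0 ?expR_gt0.
have M1 : 0 < M + 1 by rewrite ltr_wpDl ?ltW.
have E0 : 0 < e / (2 * (M + 1) * B) by rewrite divr_gt0// !mulr_gt0.
have [r r0 {}H] := H _ E0.
pose r' := Num.min 1 (Num.min (r / ((M + 1) * B)) (e / (2 * M * B * (normc d + 1)))).
exists r'; first by rewrite !lt_min ltr01 !divr_gt0 ?mulr_gt0.
move=> h; rewrite !lt_min => /and3P[h1 hr he].
have nh := normc_ge0 h.
rewrite cexpD -/b; set k := b * cexp h - b.
have q2 : normc (cexp h - 1 - h) <= M * normc h ^+ 2.
  have := cexp_trunc_le 2 h.
  rewrite /cexp_trunc 2!big_ord_recl big_ord0/= !expr0 expr1 addr0 mulr1.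
  rewrite invr1 !mul1r opprD addrA => /le_trans; apply.
  rewrite exprMn (_ : 2`!%:R = 2 :> R)//.
  have -> : M * normc h ^+ 2 = 2 ^+ 2 * normc h ^+ 2 / 2 * expR 1.
    by rewrite /M; field.
  rewrite ler_wpM2l ?divr_ge0 ?mulr_ge0 ?sqr_ge0//.
  by rewrite ler_expR ltW.
have k2 : normc (k - b * h) <= M * B * normc h ^+ 2.
  have -> : k - b * h = b * (cexp h - 1 - h) by rewrite /k; ring.
  rewrite normcM (mulrC M) -mulrA ler_pM ?normc_ge0//.
  by rewrite lerDl.
have k1 : normc k <= (M + 1) * B * normc h.
  have -> : k = (k - b * h) + b * h by ring.
  rewrite (le_trans (normcD _ _))// (le_trans (lerD k2 (lexx _)))//.
  rewrite normcM (_ : (M + 1) * B * _ = M * B * normc h + B * normc h); last by ring.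
  apply: lerD; last by rewrite ler_wpM2r// lerDl.
  have hh : normc h ^+ 2 <= normc h by rewrite expr2 ler_piMl// ltW.
  by rewrite ler_wpM2l// mulr_ge0// ltW.
have kr : normc k < r.
  by rewrite (le_lt_trans k1)// mulrC -ltr_pdivlMr ?mulr_gt0.
have -> : f (b * cexp h) - f b - d * b * h =
   (f (b + k) - f b - d * k) + d * (k - b * h).
  by rewrite /k (addrC b) subrK; ring.
rewrite (le_trans (normcD _ _))// (le_trans (lerD (H _ kr) (lexx _)))//.
rewrite normcM.
have -> : e * normc h = e / (2 * (M + 1) * B) * ((M + 1) * B * normc h) + e / 2 * normc h.
  by field; rewrite !gt_eqF.
apply: lerD; first by rewrite ler_wpM2l// ltW.
rewrite (le_trans (ler_wpM2l (normc_ge0 _) k2))//.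
have -> : M * B * normc h ^+ 2 = M * B * normc h * normc h by ring.
rewrite mulrA ler_wpM2r// (le_trans (y := (normc d + 1) * (M * B * normc h)))//.
  by rewrite ler_wpM2r ?lerDl// !mulr_ge0// ltW.
clear -he M0 B0 d0; move: M M0 he => M M0.
rewrite ltr_pdivlMr ?mulr_gt0// => he.
by rewrite ler_pdivlMr//; lra.
Qed.

Definition cis (t : R) : R[i] := cexp (0 +i* t).

Definition has_circle_mean (u : R -> R) (c : R) :=
  mu.-integrable `[0, 2 * pi] (fun t => (u t)%:E) /\
  (\int[mu]_(t in `[0%R, (2 * pi)%R]) (u t)%:E = (2 * pi * c)%:E)%E.

(** Real and imaginary parts are exchanged by multiplication by [i], so one of
    the two is enough. *)
Let circle_mean_Im (f : R[i] -> R[i]) : cdiff f ->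
  has_circle_mean (fun t => complex.Im (f (cis t))) (complex.Im (f 0)).
Proof.
move=> cf; have cg := cdiff_comp_cexp cf.
pose u x y := complex.Re (f (cexp (x +i* y))).
pose v x y := complex.Im (f (cexp (x +i* y))).
have cdiffE (x y x' y' : R) : (x +i* y) + ((x' - x) +i* (y' - y)) = x' +i* y'.
  by apply: complex_eq; rewrite ?ReD ?ImD/=; ring.
have cu y : continuous (u ^~ y).
  move=> x; apply/cvgrPdist_le => e e0.
  have [r r0 H] := cdiff_cont cg (x +i* y) e0.
  near=> t.
  rewrite distrC -ReN -ReD (le_trans (Re_le_normc _))//.
  have := H ((t - x) +i* (y - y)); rewrite /comp cdiffE; apply.
  rewrite (le_lt_trans (normc_le_ReIm _))//= subrr normr0 addr0 distrC.
  near: t; exact: cvgr_dist_lt.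
have cv x : continuous (v x).
  move=> y; apply/cvgrPdist_le => e e0.
  have [r r0 H] := cdiff_cont cg (x +i* y) e0.
  near=> t.
  rewrite distrC -ImN -ImD (le_trans (Im_le_normc _))//.
  have := H ((x - x) +i* (t - y)); rewrite /comp cdiffE; apply.
  rewrite (le_lt_trans (normc_le_ReIm _))//= subrr normr0 add0r distrC.
  near: t; exact: cvgr_dist_lt.
have cr a b : exists al be, forall e : R, 0 < e -> exists2 d : R, 0 < d &
     forall x y, `|x - a| < d -> `|y - b| < d ->
     `|u x y - u a b - (al * (x - a) - be * (y - b))| <= e * (`|x - a| + `|y - b|) /\
     `|v x y - v a b - (be * (x - a) + al * (y - b))| <= e * (`|x - a| + `|y - b|).
  have [d H] := cg (a +i* b).
  exists (complex.Re d), (complex.Im d) => e e0.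
  have [r r0 {}H] := H e e0; exists (r / 2); first by rewrite divr_gt0.
  move=> x y xr yr; have := H ((x - a) +i* (y - b)); rewrite /comp cdiffE => {}H.
  have hh : normc ((x - a) +i* (y - b)) <= `|x - a| + `|y - b|.
    exact: normc_le_ReIm.
  have {}H := H (le_lt_trans hh _).
  have {}H : normc (f (cexp (x +i* y)) - f (cexp (a +i* b)) - d * ((x - a) +i* (y - b)))
      <= e * (`|x - a| + `|y - b|).
    by rewrite (le_trans (H _))//; [lra|rewrite ler_wpM2l// ltW].
  split.
    rewrite (le_trans _ H)// (le_trans _ (Re_le_normc _))//.
    by rewrite !ReD !ReN Re_mul.
  rewrite (le_trans _ H)// (le_trans _ (Im_le_normc _))//.
  by rewrite !ImD !ImN Im_mul/= (addrC (_ * (x - a))).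
have pi2 : 0 <= 2 * pi :> R by rewrite mulr_ge0 ?pi_ge0.
have per x : u x 0 = u x (2 * pi).
  rewrite /u; congr (complex.Re (f _)).
  have e2 : 2 * pi = pi *+ 2 :> R by rewrite mulr_natl.
  apply: complex_eq; first by rewrite !Re_cexp/= e2 cos2pi cos0.
  by rewrite !Im_cexp/= e2 sin2pi sin0.
(* the horizontal sides cancel because [u] has period [2 pi] *)
have V x0 x1 : x0 <= x1 -> I[v x1, 0, (2 * pi)] = I[v x0, 0, (2 * pi)].
  move=> x01; apply/eqP; rewrite -subr_eq0; apply/eqP.
  rewrite -(int_sub _ _ (cv x1) (cv x0)) -(goursat_rectangle cu cv cr x01 pi2).
  rewrite (_ : (fun x => _) = fun=> 0); first by rewrite Rintegral_cst// mul0r.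
  by apply/funext => x; rewrite per subrr.
have ic : mu.-integrable `[0, 2 * pi] (fun t => (complex.Im (f (cis t)))%:E).
  exact: (int_cont 0 (2 * pi) (cv 0)).
split=> //.
have -> : (\int[mu]_(t in `[0%R, (2 * pi)%R]) (complex.Im (f (cis t)))%:E =
    (I[v 0, 0, (2 * pi)])%:E)%E.
  by rewrite /Rintegral fineK//; apply: integrable_fin_num.
congr EFin.
apply/eqP; rewrite -subr_eq0 -normr_le0; apply/ler_addgt0Pl => e e0.
rewrite addr0.
have p0 : 0 < 2 * pi :> R by rewrite mulr_gt0// pi_gt0.
have [r r0 H] := cdiff_cont cf 0 (divr_gt0 e0 p0).
pose x0 := Num.min 0 (ln r - 1).
have x0r : expR x0 < r.
  by rewrite -[ltRHS]lnK ?posrE// ltr_expR /x0 gt_min ltrBlDr ltrDl ltr01 orbT.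
rewrite (V x0 0) ?ge_min ?lexx//.
have -> : 2 * pi * complex.Im (f 0) = I[(fun=> complex.Im (f 0)), 0, (2 * pi)].
  rewrite Rintegral_cst//= lebesgue_measure_itv/= lte_fin p0/=.
  by rewrite oppr0 addr0 mulrC.
rewrite -int_sub//; last by move=> x; exact: cst_continuous.
have -> : e = e / (2 * pi) * (2 * pi - 0) by rewrite subr0 divfK// gt_eqF.
apply: int_bound => //.
  by move=> x; apply: (@continuousB _ _ _ (v x0)); [exact: cv|exact: cst_continuous].
move=> y _; rewrite -ImN -ImD (le_trans (Im_le_normc _))//.
have := H (cexp (x0 +i* y)); rewrite add0r; apply.
by rewrite normc_cexp.
Unshelve. all: end_near.
Qed.

(** Logarithmic polar coordinates: [exp] maps the sides of the rectangles
    [x0, x1] x [0, 2 pi] to circles, so that by Goursat the mean over a circle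
    does not depend on the radius; it tends to the value at the centre. *)
Lemma circle_mean (f : R[i] -> R[i]) : cdiff f ->
  has_circle_mean (fun t => complex.Re (f (cis t))) (complex.Re (f 0)) /\
  has_circle_mean (fun t => complex.Im (f (cis t))) (complex.Im (f 0)).
Proof.
move=> cf; split; last exact: circle_mean_Im.
have := @circle_mean_Im (fun z => (0 +i* 1) * f z) _.
have E z : complex.Im ((0 +i* 1) * f z) = complex.Re (f z).
  by rewrite Im_mul/= mul0r add0r mul1r.
rewrite E (_ : (fun t => _) = fun t => complex.Re (f (cis t))); last first.
  by apply/funext => t; rewrite E.
apply.
move=> a; have [d H] := cf a; exists ((0 +i* 1) * d) => e e0.
have [r r0 {}H] := H e e0; exists r => // h hr.
rewrite -mulrA -!mulrBr normcM (_ : normc (0 +i* 1) = 1) ?mul1r ?H//.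
by rewrite /= expr0n add0r expr1n sqrtr1.
Qed.

End goursat.

(** * Maps that preserve Lebesgue measure *)

Section measure_preserving.
Local Open Scope ereal_scope.

(** Stated with integrals of nonnegative functions rather than measures of
    preimages, the form in which invariance is used and inherited by products. *)
Definition mpres d (T : measurableType d) (R : realType)
    (m : set T -> \bar R) (phi : T -> T) : Prop :=
  measurable_fun setT phi /\ forall f : T -> \bar R, measurable_fun setT f ->
    (forall x, 0 <= f x) -> \int[m]_x f (phi x) = \int[m]_x f x.

Lemma mpres_comp d (T : measurableType d) (R : realType)
    (m : {measure set T -> \bar R}) (phi psi : T -> T) :
  mpres m phi -> mpres m psi -> mpres m (phi \o psi).
Proof.
move=> [mphi iphi] [mpsi ipsi]; split; first exact: measurableT_comp.
move=> f mf f0 /=; rewrite (ipsi (f \o phi))//= ?iphi//.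
by apply: measurableT_comp.
Qed.

Context {R : realType}.
Notation MR := (measurableTypeR R).
Notation mu := (@lebesgue_measure R).

Lemma measurable_shift (a : R) : measurable_fun [set: MR] (fun x : MR => (x + a)%R : MR).
Proof. by apply: measurable_funD => //; exact: measurable_cst. Qed.

Lemma mpres_shift (a : R) : mpres mu (fun x : MR => (x + a)%R : MR).
Proof.
have mS := measurable_shift a; split=> // f mf f0.
have nuE A : measurable A -> mu A = pushforward mu (fun x : MR => (x + a)%R : MR) A.
  pose M : {measure set MR -> \bar R} :=
    measure_function_pushforward__canonical__measure_function_Measure mu mS.
  apply: (lebesgue_measure_unique (mu := M)) => _ [[x y] _ <-] /=.
  rewrite /pushforward.
  have -> : (fun x0 : MR => (x0 + a)%R : MR) @^-1` `]x, y]%classic =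
      `](x - a)%R, (y - a)%R]%classic.
    by apply/seteqP; split => z /=; rewrite !in_itv/= ltrBlDr lerBrDr.
  rewrite !lebesgue_measure_itv/= !lte_fin ltrD2r.
  by case: ifP => // _; congr (_%:E); ring.
transitivity (\int[pushforward mu (fun x : MR => (x + a)%R : MR)]_x f x).
  by rewrite ge0_integral_pushforward.
apply: eq_measure_integral => A mA _; exact/esym/nuE.
Qed.

Lemma mpres_shear1 (g : MR -> MR) : measurable_fun setT g ->
  mpres (mu \x mu) (fun z : MR * MR => ((z.1 + g z.2)%R : MR, z.2)).
Proof.
move=> mg.
have mphi : measurable_fun setT (fun z : MR * MR => ((z.1 + g z.2)%R : MR, z.2)).
  apply/measurable_fun_pairP; split; last exact: measurable_snd.
  by apply: measurable_funD => //; apply: measurableT_comp.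
split=> // f mf f0.
rewrite !(fubini_tonelli2 (m1 := mu) (m2 := mu))//; last exact: measurableT_comp.
apply: eq_integral => y _; rewrite /fubini_G/=.
have [_ H] := mpres_shift (g y); rewrite (H (fun x => f (x, y)))//.
by apply: measurableT_comp => //; exact: measurable_pair2.
Qed.

Lemma mpres_shear2 (g : MR -> MR) : measurable_fun setT g ->
  mpres (mu \x mu) (fun z : MR * MR => (z.1, (z.2 + g z.1)%R : MR)).
Proof.
move=> mg.
have mphi : measurable_fun setT (fun z : MR * MR => (z.1, (z.2 + g z.1)%R : MR)).
  apply/measurable_fun_pairP; split; first exact: measurable_fst.
  by apply: measurable_funD => //; apply: measurableT_comp.
split=> // f mf f0.
rewrite !(fubini_tonelli1 (m1 := mu) (m2 := mu))//; last exact: measurableT_comp.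
apply: eq_integral => x _; rewrite /fubini_F/=.
have [_ H] := mpres_shift (g x); rewrite (H (fun y => f (x, y)))//.
by apply: measurableT_comp => //; exact: measurable_pair1.
Qed.

Lemma mpres_area (phi : MR * MR -> MR * MR) : mpres (mu \x mu) phi ->
  mpres (@area R) phi.
Proof.
move=> [mphi H]; split=> // f mf f0.
by rewrite !ge0_integral_mscale//= ?H//; exact: measurableT_comp.
Qed.

Lemma mpres_area_shift (a b : R) :
  mpres (@area R) (fun z : MR * MR => ((z.1 + a)%R : MR, (z.2 + b)%R : MR)).
Proof.
apply: mpres_area.
have := mpres_comp (mpres_shear1 (g := fun=> a) (@measurable_cst _ _ _ _ _ _))
  (mpres_shear2 (g := fun=> b) (@measurable_cst _ _ _ _ _ _)).
exact.
Qed.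

Definition rotate (c s : R) (z : MR * MR) : MR * MR :=
  ((c * z.1 - s * z.2)%R : MR, (s * z.1 + c * z.2)%R : MR).

(** A rotation other than the half turn is a product of three shears. *)
Let mpres_rotate_shears (c s : R) : (c ^+ 2 + s ^+ 2 = 1)%R -> (1 + c != 0)%R ->
  mpres (mu \x mu) (rotate c s).
Proof.
move=> cs c1; pose t : R := (s / (1 + c))%R.
have mm (r : R) : measurable_fun [set: MR] (fun x : MR => (r * x)%R : MR).
  by apply: measurable_funM => //; exact: measurable_cst.
have := mpres_comp (mpres_shear1 (mm (- t)%R))
  (mpres_comp (mpres_shear2 (mm s)) (mpres_shear1 (mm (- t)%R))).
congr mpres; apply/funext => -[x y] /=; rewrite /rotate/=.
have ts : (t * s = 1 - c)%R.
  rewrite /t mulrAC -expr2 (_ : s ^+ 2 = (1 - c) * (1 + c))%R ?mulfK//.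
  have -> : (s ^+ 2 = 1 - c ^+ 2)%R by rewrite -cs; ring.
  by ring.
have tc : (t * (1 + c) = s)%R by rewrite /t divfK.
congr pair.
  transitivity (x * (1 - t * s) - y * (t * (1 + (1 - t * s))))%R; first by ring.
  rewrite ts (_ : 1 - (1 - c) = c)%R; last by ring.
  by rewrite tc; ring.
transitivity (s * x + y * (1 - t * s))%R; first by ring.
by rewrite ts; ring.
Qed.

Lemma mpres_area_rotate (c s : R) : (c ^+ 2 + s ^+ 2 = 1)%R ->
  mpres (@area R) (rotate c s).
Proof.
move=> cs; apply: mpres_area.
have [c1|c1] := eqVneq (1 + c)%R 0%R; last exact: mpres_rotate_shears.
have ec : c = (-1)%R by apply/eqP; rewrite -subr_eq0 opprK addrC c1.
have es : s = 0%R.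
  apply/eqP; rewrite -sqrf_eq0; apply/eqP.
  have -> : (s ^+ 2 = 1 - c ^+ 2)%R by rewrite -cs; ring.
  by rewrite ec; ring.
(* a half turn is the square of a quarter turn *)
have H : mpres (mu \x mu) (rotate 0 1).
  by apply: mpres_rotate_shears; rewrite ?expr0n ?expr1n ?add0r ?addr0 ?oner_eq0.
have := mpres_comp H H; congr mpres; apply/funext => -[x y].
by rewrite /rotate/= ec es; congr pair; ring.
Qed.

Definition tuple_map_ord (T : Type) n (phi : 'I_n -> T -> T) (x : n.-tuple T) :
  n.-tuple T := [tuple phi j (tnth x j) | j < n].

Lemma measurable_tuple_map_ord d (T : measurableType d) n (phi : 'I_n -> T -> T) :
  (forall j, measurable_fun setT (phi j)) ->
  measurable_fun setT (tuple_map_ord phi).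
Proof.
move=> mphi; apply/measurable_fun_tnthP => j.
rewrite (_ : _ \o _ = fun x => phi j (tnth x j)).
  by apply: measurableT_comp => //; exact: measurable_tnth.
by apply/funext => x /=; rewrite tnth_mktuple.
Qed.

(** Fubini, one coordinate at a time. *)
Lemma mpres_tuple d (T : measurableType d) (m : {sigma_finite_measure set T -> \bar R})
    n (phi : 'I_n -> T -> T) :
  (forall j, mpres m (phi j)) -> mpres (tuple_measure m n) (tuple_map_ord phi).
Proof.
elim: n phi => [|n IH] phi H.
  split; first by apply: measurable_tuple_map_ord => -[].
  by move=> f mf f0; apply: eq_integral => x _; rewrite [tuple_map_ord _ _]tuple0 [x]tuple0.
have mphi j : measurable_fun setT (phi j) by case: (H j).
split; first exact: measurable_tuple_map_ord.
have [mPhi' HPhi'] := IH (fun j => phi (lift ord0 j)) (fun j => H (lift ord0 j)).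
move=> f mf f0 /=; rewrite [LHS]ge0_integral_pushforward//=; last 2 first.
- exact: measurable_cons_pair.
- by apply: measurableT_comp => //; exact: measurable_tuple_map_ord.
rewrite [RHS]ge0_integral_pushforward//=; last exact: measurable_cons_pair.
rewrite preimage_setT.
have mfc : measurable_fun setT (f \o @cons_pair T n).
  by apply: measurableT_comp => //; exact: measurable_cons_pair.
have E x t : tuple_map_ord phi (cons_pair (x, t)) =
    cons_pair (phi ord0 x, tuple_map_ord (fun j => phi (lift ord0 j)) t).
  apply: eq_from_tnth => j; rewrite tnth_mktuple.
  case: (unliftP ord0 j) => [k ->|->]; last by rewrite !(tnth0, tnthS)/= ?tnth0.
  by rewrite !tnthS tnth_mktuple.
rewrite !(fubini_tonelli1 (m1 := m) (m2 := tuple_measure m n))//; last first.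
  apply: (measurableT_comp (f := f \o tuple_map_ord phi) (g := @cons_pair T n)).
    by apply: measurableT_comp => //; exact: measurable_tuple_map_ord.
  exact: measurable_cons_pair.
rewrite /fubini_F/=.
transitivity (\int[m]_x \int[tuple_measure m n]_t (f (cons_pair (phi ord0 x, t)))).
  apply: eq_integral => x _.
  rewrite -[RHS](HPhi' (fun t => f (cons_pair (phi ord0 x, t))))//.
    by apply: eq_integral => t _; rewrite /= E.
  apply: (measurableT_comp (f := f \o @cons_pair T n) (g := fun t => (phi ord0 x, t))) => //.
  exact: measurable_pair1.
have [_ H0] := H ord0.
rewrite (H0 (fun x => \int[tuple_measure m n]_t (f (cons_pair (x, t)))))//.
  by apply: (@measurable_fun_fubini_tonelli_F _ _ _ _ _ (tuple_measure m n) (f \o @cons_pair T n)) => //= x.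
by move=> x; exact: integral_ge0.
Qed.

End measure_preserving.

(** * Measurability in complex coordinates *)

Section measurability.
Context {R : realType} {n : nat}.
Notation MR := (measurableTypeR R).
Notation X := (n.-tuple (MR * MR)%type).
Notation Cn := 'rV[R[i]]_n.

(** [C^n] carries no sigma-algebra here: measurability is that of the function
    of the real coordinates. *)
Definition rmeas (f : Cn -> R) := measurable_fun [set: X] (fun x => f (cvec x)).

Definition cmeas (f : Cn -> R[i]) :=
  rmeas (fun z => complex.Re (f z)) /\ rmeas (fun z => complex.Im (f z)).

Lemma rmeas_cst c : rmeas (fun=> c). Proof. exact: measurable_cst. Qed.

Lemma rmeasD f g : rmeas f -> rmeas g -> rmeas (fun z => f z + g z).
Proof. exact: measurable_funD. Qed.

Lemma rmeasB f g : rmeas f -> rmeas g -> rmeas (fun z => f z - g z).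
Proof. exact: measurable_funB. Qed.

Lemma rmeasM f g : rmeas f -> rmeas g -> rmeas (fun z => f z * g z).
Proof. exact: measurable_funM. Qed.

Lemma rmeasX f m : rmeas f -> rmeas (fun z => f z ^+ m).
Proof. exact: measurable_funX. Qed.

Lemma rmeas_comp (h : R -> R) f : measurable_fun [set: MR] (h : MR -> MR) ->
  rmeas f -> rmeas (fun z => h (f z)).
Proof. by move=> mh mf; exact: measurableT_comp. Qed.

Lemma rmeas_sum (I : Type) (s : seq I) (F : I -> Cn -> R) :
  (forall i, rmeas (F i)) -> rmeas (fun z => \sum_(i <- s) F i z).
Proof.
move=> mF; elim: s => [|i s IH].
  by under [X in rmeas X]funext do rewrite big_nil; exact: rmeas_cst.
by under [X in rmeas X]funext do rewrite big_cons; exact: (rmeasD (mF i) IH).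
Qed.

Lemma rmeas_expR f : rmeas f -> rmeas (fun z => expR (f z)).
Proof. exact: rmeas_comp. Qed.

Lemma rmeas_powR f p : rmeas f -> rmeas (fun z => f z `^ p).
Proof. by apply: (rmeas_comp (h := fun x => x `^ p)); exact: measurable_powR. Qed.

Lemma rmeas_sqrt f : rmeas f -> rmeas (fun z => Num.sqrt (f z)).
Proof.
apply: (rmeas_comp (h := fun x => Num.sqrt x)).
by apply: continuous_measurable_fun; exact: sqrt_continuous.
Qed.

Lemma cmeas_cst c : cmeas (fun=> c).
Proof. by split; exact: rmeas_cst. Qed.

Lemma cmeasD f g : cmeas f -> cmeas g -> cmeas (fun z => f z + g z).
Proof.
move=> [rf jf] [rg jg]; split.
  by under [X in rmeas X]funext do rewrite ReD; exact: (rmeasD rf rg).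
by under [X in rmeas X]funext do rewrite ImD; exact: (rmeasD jf jg).
Qed.

Lemma cmeasM f g : cmeas f -> cmeas g -> cmeas (fun z => f z * g z).
Proof.
move=> [rf jf] [rg jg]; split.
  by under [X in rmeas X]funext do rewrite Re_mul;
    exact: (rmeasB (rmeasM rf rg) (rmeasM jf jg)).
by under [X in rmeas X]funext do rewrite Im_mul;
    exact: (rmeasD (rmeasM rf jg) (rmeasM jf rg)).
Qed.

Lemma cmeasN f : cmeas f -> cmeas (fun z => - f z).
Proof.
by move=> mf; under [X in cmeas X]funext do rewrite -mulN1r;
  apply: cmeasM => //; exact: cmeas_cst.
Qed.

Lemma cmeasB f g : cmeas f -> cmeas g -> cmeas (fun z => f z - g z).
Proof. by move=> mf mg; apply: cmeasD => //; exact: cmeasN. Qed.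

Lemma cmeasX f m : cmeas f -> cmeas (fun z => f z ^+ m).
Proof.
move=> mf; elim: m => [|m IH].
  by under [X in cmeas X]funext do rewrite expr0; exact: cmeas_cst.
by under [X in cmeas X]funext do rewrite exprS; exact: cmeasM.
Qed.

Lemma cmeas_sum (I : Type) (s : seq I) (F : I -> Cn -> R[i]) :
  (forall i, cmeas (F i)) -> cmeas (fun z => \sum_(i <- s) F i z).
Proof.
move=> mF; elim: s => [|i s IH].
  by under [X in cmeas X]funext do rewrite big_nil; exact: cmeas_cst.
by under [X in cmeas X]funext do rewrite big_cons; exact: cmeasD.
Qed.

Lemma cmeas_conj f : cmeas f -> cmeas (fun z => (f z)^*).
Proof.
move=> [rf jf]; split.
  by under [X in rmeas X]funext do rewrite Re_conj.
under [X in rmeas X]funext do rewrite Im_conj -mulN1r.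
exact: (rmeasM (rmeas_cst _) jf).
Qed.

Lemma cmeas_real f : rmeas f -> cmeas (fun z => (f z)%:C).
Proof. by move=> mf; split=> //; exact: rmeas_cst. Qed.

Lemma rmeas_normc f : cmeas f -> rmeas (fun z => normc (f z)).
Proof.
move=> [rf jf].
under [X in rmeas X]funext => z.
  rewrite -[normc _]ger0_norm ?normc_ge0// -sqrtr_sqr normc_sqr; over.
exact: (rmeas_sqrt (rmeasD (rmeasX 2 rf) (rmeasX 2 jf))).
Qed.

Lemma cmeas_cexp f : cmeas f -> cmeas (fun z => cexp (f z)).
Proof.
move=> [rf jf]; split.
  under [X in rmeas X]funext do rewrite Re_cexp.
  apply: (rmeasM (rmeas_expR rf) (rmeas_comp _ jf)).
  by apply: continuous_measurable_fun; exact: continuous_cos.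
under [X in rmeas X]funext do rewrite Im_cexp.
apply: (rmeasM (rmeas_expR rf) (rmeas_comp _ jf)).
by apply: continuous_measurable_fun; exact: continuous_sin.
Qed.

Lemma cmeas_coord j : cmeas (fun z : Cn => z 0 j).
Proof.
split; rewrite /rmeas.
  under [X in measurable_fun _ X]funext do rewrite mxE/=.
  apply: (measurableT_comp (f := @fst MR MR)) => //.
  exact: measurable_tnth.
under [X in measurable_fun _ X]funext do rewrite mxE/=.
apply: (measurableT_comp (f := @snd MR MR)) => //.
exact: measurable_tnth.
Qed.

Lemma cmeas_dotcr w : cmeas (fun z => dotc z w).
Proof.
by apply: cmeas_sum => j; apply: cmeasM; [apply: cmeas_conj; exact: cmeas_coord
  |exact: cmeas_cst].
Qed.

Lemma cmeas_dotcl w : cmeas (fun z => dotc w z).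
Proof.
by apply: cmeas_sum => j; apply: cmeasM; [exact: cmeas_cst|exact: cmeas_coord].
Qed.

Lemma rmeas_enorm : rmeas enorm.
Proof.
apply: rmeas_sqrt; apply: rmeas_sum => j; apply: rmeasX; apply: rmeas_normc.
exact: cmeas_coord.
Qed.

Lemma rmeas_enormB w : rmeas (fun z => enorm (z - w)).
Proof.
apply: rmeas_sqrt; apply: rmeas_sum => j; apply: rmeasX; apply: rmeas_normc.
under [X in cmeas X]funext do rewrite mxE.
by apply: cmeasD; [exact: cmeas_coord|exact: cmeas_cst].
Qed.

Lemma rmeas_cvg (f : nat -> Cn -> R) g : (forall k, rmeas (f k)) ->
  (forall z, f ^~ z @ \oo --> g z) -> rmeas g.
Proof.
move=> mf fg.
by apply: (measurable_fun_cvg (h := fun k (x : X) => f k (cvec x))) => // x _; exact: fg.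
Qed.

Lemma floor_approx k (t : R) : `|(Num.floor (k.+1%:R * t))%:~R / k.+1%:R - t| <= k.+1%:R^-1.
Proof.
have k0 : 0 < k.+1%:R :> R by rewrite ltr0n.
rewrite -[X in _ - X](mulKf (x := k.+1%:R)) ?gt_eqF// (mulrC k.+1%:R^-1) -mulrBl.
rewrite normrM (gtr0_norm (x := k.+1%:R^-1)) ?invr_gt0// ler_piMl ?invr_ge0 ?ltW//.
have := floor_le (k.+1%:R * t); have := floorD1_gt (k.+1%:R * t).
rewrite intrD1; move=> h1 h2.
by rewrite ltr_norml; apply/andP; split; lra.
Qed.

Definition econt (f : Cn -> R) := forall z (e : R), 0 < e ->
  exists2 r : R, 0 < r & forall h, enorm h < r -> `|f (z + h) - f z| <= e.

(** A continuous function is the limit of its compositions with the rounding of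
    the coordinates to multiples of [1/(k+1)], which take countably many values. *)
Lemma econt_meas f : econt f -> rmeas f.
Proof.
move=> cf.
pose cell (k : nat) (t : n.-tuple (int * int)) : X :=
  [tuple ((tnth t j).1%:~R / k.+1%:R : MR, (tnth t j).2%:~R / k.+1%:R : MR) | j < n].
pose code (k : nat) (x : X) : n.-tuple (int * int) :=
  [tuple (Num.floor (k.+1%:R * (tnth x j).1), Num.floor (k.+1%:R * (tnth x j).2)) | j < n].
have mcode k t : measurable (code k @^-1` [set t]).
  rewrite (_ : _ @^-1` _ = \bigcap_(j in [set: 'I_n])
     ((fun x : X => (k.+1%:R * (tnth x j).1 : MR)) @^-1`
        `[(tnth t j).1%:~R, (tnth t j).1%:~R + 1[%classic `&`
      (fun x : X => (k.+1%:R * (tnth x j).2 : MR)) @^-1`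
        `[(tnth t j).2%:~R, (tnth t j).2%:~R + 1[%classic)); last first.
    apply/seteqP; split => x /=.
      move=> <- j _ /=; rewrite !tnth_mktuple/= !in_itv/=.
      by have := floor_itv (k.+1%:R * (tnth x j).1); have := floor_itv (k.+1%:R * (tnth x j).2); rewrite !intrD1.
    move=> H; apply: eq_from_tnth => j; rewrite tnth_mktuple.
    have [/=] := H j I; rewrite !in_itv/= => h1 h2.
    by rewrite [RHS]surjective_pairing; congr pair; apply/eqP; rewrite floor_eq intrD1.
  apply: fin_bigcap_measurable => // j _; apply: measurableI.
    rewrite -[X in measurable X]setTI.
    apply: (measurable_funM (f := cst k.+1%:R)) => //.
    apply: (measurableT_comp (f := @fst MR MR)) => //; exact: measurable_tnth.
  rewrite -[X in measurable X]setTI.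
  apply: (measurable_funM (f := cst k.+1%:R)) => //.
  apply: (measurableT_comp (f := @snd MR MR)) => //; exact: measurable_tnth.
apply: (measurable_fun_cvg (h := fun k (x : X) => f (cvec (cell k (code k x))))).
  move=> k _ B mB; rewrite setTI.
  rewrite (_ : _ @^-1` _ = \bigcup_(m in [set: nat])
     (if unpickle m is Some t then
        if `[< B (f (cvec (cell k t))) >] then code k @^-1` [set t] else set0
      else set0)).
    apply: bigcupT_measurable => m; case: unpickle => // t.
    by case: ifP.
  apply/seteqP; split => x /=.
    by move=> Bx; exists (pickle (code k x)) => //; rewrite pickleK asboolT.
  by move=> [m _]; case: unpickle => // t; case: asboolP => // Bt /= ->.
move=> x _; apply/cvgrPdist_le => e e0.
have [r r0 H] := cf (cvec x) e e0.
near=> k.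
rewrite distrC.
have -> : cvec (cell k (code k x)) = cvec x + (cvec (cell k (code k x)) - cvec x).
  by rewrite addrC subrK.
apply: H; rewrite (le_lt_trans (enorm_le_sum _))//.
have : \sum_(j < n) normc ((cvec (cell k (code k x)) - cvec x) 0 j) <=
    \sum_(j < n) (2 * k.+1%:R^-1).
  apply: ler_sum => j _; rewrite !mxE !tnth_mktuple.
  rewrite (le_trans (normc_le_ReIm _))//= mulr2n mulrDl mul1r lerD//; exact: floor_approx.
move=> /le_lt_trans; apply.
rewrite sumr_const card_ord -mulr_natr.
near: k.
have hr : 0 < r / (2 * n.+1%:R) by rewrite divr_gt0// mulr_gt0.
near=> k.
have : k.+1%:R^-1 < r / (2 * n.+1%:R).
  near: k; exact: near_infty_natSinv_lt (PosNum hr).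
rewrite ltr_pdivlMr ?mulr_gt0//; apply: le_lt_trans.
rewrite [leLHS](_ : _ = k.+1%:R^-1 * (2 * n%:R)); last by ring.
by rewrite ler_wpM2l ?invr_ge0// ler_wpM2l// ler_nat.
Unshelve. all: end_near. Qed.

Lemma econt_cmeas (f : Cn -> R[i]) :
  (forall z (e : R), 0 < e ->
    exists2 r : R, 0 < r & forall h, enorm h < r -> normc (f (z + h) - f z) <= e) ->
  cmeas f.
Proof.
move=> cf; split; apply: econt_meas => z e e0; have [r r0 H] := cf z e e0;
  exists r => // h hr; rewrite (le_trans _ (H h hr))//.
  by rewrite -ReN -ReD Re_le_normc.
by rewrite -ImN -ImD Im_le_normc.
Qed.

End measurability.

(** * Integrals over C^n *)

Section integration.
Context {R : realType}.
Notation MR := (measurableTypeR R).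

Section fixed_dimension.
Context {n : nat}.
Notation X := (n.-tuple (MR * MR)%type).
Notation Cn := 'rV[R[i]]_n.
Implicit Types (F G : Cn -> \bar R) (f g : Cn -> R).
Local Open Scope ereal_scope.

Definition emeas F := measurable_fun [set: X] (fun x => F (cvec x)).

Definition nint F : \bar R := \int[dv n]_x F (cvec x).

Lemma rmeas_emeas f : rmeas f -> emeas (fun z => (f z)%:E).
Proof. by move=> mf; apply/measurable_EFinP. Qed.

Lemma nint_ge0 F : (forall z, 0 <= F z) -> 0 <= nint F.
Proof. by move=> F0; exact: integral_ge0. Qed.

Lemma le_nint F G : emeas F -> emeas G -> (forall z, 0 <= F z) ->
  (forall z, F z <= G z) -> nint F <= nint G.
Proof. by move=> mF mG F0 FG; apply: ge0_le_integral. Qed.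

Lemma nintD F G : emeas F -> emeas G -> (forall z, 0 <= F z) -> (forall z, 0 <= G z) ->
  nint (fun z => F z + G z) = nint F + nint G.
Proof. by move=> mF mG F0 G0; rewrite /nint ge0_integralD. Qed.

Lemma nintZ (k : \bar R) F : emeas F -> (forall z, 0 <= F z) -> 0 <= k ->
  nint (fun z => k * F z) = k * nint F.
Proof. by move=> mF F0 k0; rewrite /nint ge0_integralZl. Qed.

Lemma eq_nint F G : F =1 G -> nint F = nint G.
Proof. by move=> FG; apply: eq_integral => x _; exact: FG. Qed.

Definition tshift (w : Cn) : X -> X :=
  tuple_map_ord (fun j (a : MR * MR) =>
    ((a.1 + complex.Re (w 0 j))%R : MR, (a.2 + complex.Im (w 0 j))%R : MR)).

Lemma cvec_tshift w x : cvec (tshift w x) = (cvec x + w)%R.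
Proof.
apply/rowP => j; rewrite !mxE tnth_mktuple/=.
by apply: complex_eq; rewrite ?ReD ?ImD.
Qed.

Lemma mpres_tshift w : mpres (dv n) (tshift w).
Proof. by apply: mpres_tuple => j; exact: mpres_area_shift. Qed.

Lemma emeas_shift w F : emeas F -> emeas (fun z => F (z + w)%R).
Proof.
move=> mF; rewrite /emeas; under [X in measurable_fun _ X]funext do rewrite -cvec_tshift.
by have [mt _] := mpres_tshift w; exact: (measurableT_comp mF mt).
Qed.

Lemma nint_shift w F : emeas F -> (forall z, 0 <= F z) ->
  nint (fun z => F (z + w)%R) = nint F.
Proof.
move=> mF F0; rewrite /nint; under eq_integral do rewrite -cvec_tshift.
by have [_ /(_ (fun x => F (cvec x)))] := mpres_tshift w; apply.
Qed.

Definition trot (t : R) : X -> X := tuple_map_ord (fun=> rotate (cos t) (sin t)).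

Lemma cvec_trot t x : cvec (trot t x) = (cis t *: cvec x)%R.
Proof.
apply/rowP => j; rewrite !mxE tnth_mktuple/=.
apply: complex_eq; rewrite /cis.
  by rewrite [RHS]Re_mul Re_cexp Im_cexp/= expR0 !mul1r.
by rewrite [RHS]Im_mul Re_cexp Im_cexp/= expR0 !mul1r addrC.
Qed.

Lemma mpres_trot t : mpres (dv n) (trot t).
Proof. by apply: mpres_tuple => j; apply: mpres_area_rotate; rewrite cos2Dsin2. Qed.

Definition emeas2 (F : Cn -> Cn -> \bar R) :=
  measurable_fun [set: X * X] (fun xy => F (cvec xy.1) (cvec xy.2)).

Lemma emeas_nint (F : Cn -> Cn -> \bar R) : emeas2 F -> (forall z w, 0 <= F z w) ->
  emeas (fun z => nint (F z)).
Proof.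
move=> mF F0; rewrite /emeas /nint.
by apply: (@measurable_fun_fubini_tonelli_F _ _ _ _ _ (dv n)
  (fun xy => F (cvec xy.1) (cvec xy.2))).
Qed.

Lemma nint_swap (F : Cn -> Cn -> \bar R) : emeas2 F -> (forall z w, 0 <= F z w) ->
  nint (fun z => nint (F z)) = nint (fun w => nint (F ^~ w)).
Proof.
move=> mF F0; rewrite /nint.
have := @fubini_tonelli _ _ _ _ _ (dv n) (dv n) (fun xy => F (cvec xy.1) (cvec xy.2)) mF.
by rewrite /fubini_F /fubini_G/=; apply => x.
Qed.

Definition tsub (xy : X * X) : X :=
  [tuple (((tnth xy.1 j).1 - (tnth xy.2 j).1)%R : MR,
          ((tnth xy.1 j).2 - (tnth xy.2 j).2)%R : MR) | j < n].

Lemma cvec_tsub x y : cvec (tsub (x, y)) = (cvec x - cvec y)%R.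
Proof.
apply/rowP => j; rewrite !mxE tnth_mktuple/=.
by apply: complex_eq; rewrite ?ReD ?ImD ?ReN ?ImN.
Qed.

Lemma emeas2_sub F : emeas F -> emeas2 (fun z w => F (z - w)%R).
Proof.
move=> mF; rewrite /emeas2; under [X in measurable_fun _ X]funext => xy.
  rewrite -cvec_tsub -surjective_pairing; over.
apply: (measurableT_comp mF); apply/measurable_fun_tnthP => j.
have m1 : measurable_fun [set: X * X] (fun xy : X * X => tnth xy.1 j).
  apply: (measurableT_comp (f := fun x : X => tnth x j)) => //.
  exact: measurable_tnth.
have m2 : measurable_fun [set: X * X] (fun xy : X * X => tnth xy.2 j).
  apply: (measurableT_comp (f := fun x : X => tnth x j)) => //.
  exact: measurable_tnth.
rewrite (_ : _ \o _ = fun xy : X * X =>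
    (((tnth xy.1 j).1 - (tnth xy.2 j).1)%R : MR,
          ((tnth xy.1 j).2 - (tnth xy.2 j).2)%R : MR)); last first.
  by apply/funext => xy /=; rewrite tnth_mktuple.
apply/measurable_fun_pairP; split.
  apply: (measurable_funB (f := fun xy : X * X => (tnth xy.1 j).1)
    (g := fun xy : X * X => (tnth xy.2 j).1)).
    by apply: (measurableT_comp (f := @fst MR MR)) => //.
  by apply: (measurableT_comp (f := @fst MR MR)) => //.
apply: (measurable_funB (f := fun xy : X * X => (tnth xy.1 j).2)
    (g := fun xy : X * X => (tnth xy.2 j).2)).
  by apply: (measurableT_comp (f := @snd MR MR)) => //.
by apply: (measurableT_comp (f := @snd MR MR)) => //.
Qed.

Lemma emeas2_fst F : emeas F -> emeas2 (fun z _ => F z).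
Proof. by move=> mF; apply: (measurableT_comp mF). Qed.

Lemma emeas2_snd F : emeas F -> emeas2 (fun _ w => F w).
Proof. by move=> mF; apply: (measurableT_comp mF). Qed.

Lemma emeas2M (F G : Cn -> Cn -> \bar R) : emeas2 F -> emeas2 G ->
  emeas2 (fun z w => F z w * G z w).
Proof. exact: emeasurable_funM. Qed.

Lemma emeas2_swap (F : Cn -> Cn -> \bar R) : emeas2 F -> emeas2 (fun z w => F w z).
Proof. by move=> mF; exact: (measurableT_comp mF (@measurable_swap _ _ _ _)). Qed.

Lemma nint_swap_conv F G : emeas F -> emeas G ->
  (forall z, 0 <= F z) -> (forall z, 0 <= G z) ->
  nint (fun w => nint (fun z => F z * G (w - z)%R)) = nint F * nint G.
Proof.
move=> mF mG F0 G0.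
rewrite -(nint_swap (F := fun z w => F z * G (w - z)%R)); last 2 first.
- apply: emeas2M; first exact: emeas2_fst.
  exact: emeas2_swap (emeas2_sub mG).
- by move=> z w; rewrite mule_ge0.
rewrite muleC -nintZ//; last exact: nint_ge0.
apply: eq_nint => z; rewrite nintZ//; last exact: emeas_shift.
by rewrite nint_shift// muleC.
Qed.

End fixed_dimension.

Section decay.
Local Open Scope ereal_scope.

Let powR_neg_cvg0 (g : R) : (0 < g)%R ->
  ((1 + x) `^ (- g) @[x --> +oo] --> (0 : R))%R.
Proof.
move=> g0; apply/cvgrPdist_lt => e e0; near=> x.
have x0 : (0 < x)%R by near: x; exact: nbhs_pinfty_gt.
have x1 : (0 < 1 + x)%R by rewrite addr_gt0.
rewrite sub0r normrN ger0_norm ?powR_ge0// powRN.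
rewrite invf_plt ?posrE ?powR_gt0//.
have -> : (e^-1 = (e^-1 `^ g^-1) `^ g)%R.
  by rewrite -powRrM mulVf ?gt_eqF// powRr1// invr_ge0 ltW.
rewrite gt0_ltr_powR ?nnegrE ?powR_ge0 ?(ltW x1)//.
have h : (e^-1 `^ g^-1 < x)%R by near: x; exact: nbhs_pinfty_gt.
by rewrite (lt_trans h)// ltrDr.
Unshelve. all: end_near. Qed.

Let continuous_line_decay (a : R) : continuous (fun x : R => (1 + `|x|) `^ a : R)%R.
Proof.
have p (x : R) : (0 < 1 + `|x|)%R by rewrite ltr_pwDl.
rewrite (_ : (fun x => _) = (fun x => expR (a * ln (1 + `|x|))))%R; last first.
  by apply/funext => x; rewrite /powR gt_eqF.
move=> x; apply: (continuous_comp (f := fun x => a * ln (1 + `|x|)) (g := expR))%R;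
  last exact: continuous_expR.
apply: continuousM; first exact: cst_continuous.
apply: (@continuous_comp R R R (fun x : R => 1 + `|x|)%R (@ln R) x); last exact: continuous_ln.
by apply: continuousD; [exact: cst_continuous|exact: norm_continuous].
Qed.

Let line_decay (a : R) : (1 < a)%R ->
  \int[@lebesgue_measure R]_x ((1 + `|x|) `^ (- a))%:E < +oo.
Proof.
move=> a1; have g0 : (0 < a - 1)%R by rewrite subr_gt0.
rewrite (@ge0_symfun_integralT _ (fun x => ((1 + `|x|) `^ (- a))%R)); last 3 first.
- by move=> x; exact: powR_ge0.
- exact: continuous_line_decay.
- by move=> x /=; rewrite normrN.
rewrite lte_mul_pinfty// (_ : [set x : R | (0 <= x)%R] = [set` (Interval (BLeft (0 : R)%R) (BInfty R false))]); last first.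
  by rewrite set_itvE.
pose F (x : R) := (- (a - 1)^-1 * (1 + x) `^ (- (a - 1)))%R.
have dF (x : R) : (0 <= x)%R -> is_derive x (1 : R)%R F ((1 + x) `^ (- a))%R.
  move=> x0; have x1 : (0 < 1 + x)%R by rewrite ltr_pwDl.
  have d1 : is_derive x (1 : R)%R (fun x => 1 + x)%R (1 : R)%R.
    have := @is_deriveD _ _ _ _ _ x (1 : R)%R _ _ (is_derive_cst (1 : R)%R x 1%R) (is_derive_id x 1%R).
    by rewrite add0r.
  have d2 := is_derive1_comp (f := fun y : R => (y `^ (- (a - 1)))%R) (is_derive1_powR _ x1) d1.
  have := @is_deriveZ _ _ _ _ (- (a - 1)^-1)%R _ _ _ d2.
  rewrite mulr1 /GRing.scale/= mulrA mulrNN mulVf ?gt_eqF// mul1r.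
  by rewrite (_ : - (a - 1) - 1 = - a)%R//; ring.
rewrite (@ge0_continuous_FTC2y _ _ F _ 0%R).
- by rewrite -EFinB ltry.
- by move=> x _; exact: powR_ge0.
- by apply: continuous_subspaceT => x; exact: continuous_line_decay.
- rewrite -[X in _ --> X](mulr0 (- (a - 1)^-1)%R).
  by apply: cvgMr; exact: powR_neg_cvg0.
- by move=> x x0; apply: (@ex_derive _ _ _ _ _ _ _ (dF x (ltW x0))).
- apply: cvg_at_right_filter.
  apply: differentiable_continuous; apply/derivable1_diffP.
  exact: (@ex_derive _ _ _ _ _ _ _ (dF 0%R (lexx _))).
- move=> x; rewrite in_itv/= andbT => x0.
  rewrite derive1E (@derive_val _ _ _ _ _ _ _ (dF x (ltW x0))).
  by rewrite ger0_norm// ltW.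
Qed.

(** The same product trick separates the real and imaginary parts. *)
Let plane_decay (a : R) : (2 < a)%R ->
  \int[@area R]_z ((1 + Num.sqrt (z.1 ^+ 2 + z.2 ^+ 2)) `^ (- a))%:E < +oo.
Proof.
move=> a2; have a1 : (1 < a / 2)%R by rewrite ltr_pdivlMr// mul1r.
have ml : measurable_fun [set: MR] (fun x : MR => ((1 + `|x|) `^ (- (a / 2)))%R).
  by apply: continuous_measurable_fun; exact: continuous_line_decay.
have ms : measurable_fun [set: MR * MR]
    (fun z : MR * MR => ((1 + Num.sqrt (z.1 ^+ 2 + z.2 ^+ 2)) `^ (- a))%R).
  apply: (measurableT_comp (f := fun x => x `^ (- a))%R); first exact: measurable_powR.
  apply: measurable_funD => //.
  apply: (measurableT_comp (f := @Num.sqrt R)).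
    by apply: continuous_measurable_fun; exact: sqrt_continuous.
  by apply: measurable_funD; apply: measurable_funX.
rewrite ge0_integral_mscale//=; last by apply/measurable_EFinP.
rewrite lte_mul_pinfty// ?lee_fin ?invpi_ge0//.
apply: (@le_lt_trans _ _ (\int[@lebesgue_measure R \x @lebesgue_measure R]_z
   ((1 + `|z.1|) `^ (- (a / 2)) * (1 + `|z.2|) `^ (- (a / 2)))%:E)).
  apply: ge0_le_integral => //.
  - by apply/measurable_EFinP.
  - apply/measurable_EFinP; apply: measurable_funM.
      by apply: (measurableT_comp ml).
    by apply: (measurableT_comp ml).
  move=> z _.
  have P : (0 < 1 + Num.sqrt (z.1 ^+ 2 + z.2 ^+ 2))%R by rewrite ltr_pwDl// sqrtr_ge0.
  have Q : (0 < (1 + `|z.1|) * (1 + `|z.2|))%R by rewrite mulr_gt0// ltr_pwDl.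
  rewrite lee_fin -powRM ?addr_ge0// !powRN lef_pV2 ?posrE ?powR_gt0//.
  have s1 : (`|z.1| <= Num.sqrt (z.1 ^+ 2 + z.2 ^+ 2))%R.
    by rewrite -sqrtr_sqr ler_wsqrtr// lerDl sqr_ge0.
  have s2 : (`|z.2| <= Num.sqrt (z.1 ^+ 2 + z.2 ^+ 2))%R.
    by rewrite -sqrtr_sqr ler_wsqrtr// lerDr sqr_ge0.
  have -> : ((1 + Num.sqrt (z.1 ^+ 2 + z.2 ^+ 2)) `^ a =
      ((1 + Num.sqrt (z.1 ^+ 2 + z.2 ^+ 2)) ^+ 2) `^ (a / 2))%R.
    by rewrite -(powR_mulrn 2 (ltW P)) -powRrM mulrC divfK.
  rewrite ge0_ler_powR ?nnegrE ?mulr_ge0 ?addr_ge0 ?sqr_ge0//; first by lra.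
  by rewrite expr2 ler_pM ?addr_ge0// lerD2l.
rewrite (@fubini_tonelli_prod _ _ _ _ R lebesgue_measure lebesgue_measure
  (fun x => (1 + `|x|) `^ (- (a / 2)))%R (fun x => (1 + `|x|) `^ (- (a / 2)))%R)//.
  by rewrite lte_mul_pinfty ?ge0_fin_numE ?integral_ge0 ?line_decay//
   => *; rewrite lee_fin powR_ge0.
Qed.

Lemma integral_tuple_prod_pow d (T : measurableType d)
    (m : {sigma_finite_measure set T -> \bar R}) (n : nat) (g : T -> R) (c : R) :
  measurable_fun setT g -> (forall x, (0 <= g x)%R) ->
  \int[m]_x (g x)%:E = c%:E ->
  \int[tuple_measure m n]_x (\prod_j g (tnth x j))%:E = (c ^+ n)%:E.
Proof.
move=> mg g0 g1; elim: n => [|n IH] /=.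
  rewrite integral_dirac// ?diracT ?mul1e ?big_ord0//.
  by apply/measurable_EFinP; exact: measurable_prod_tnth.
rewrite ge0_integral_pushforward//=; last 3 first.
- exact: measurable_cons_pair.
- by apply/measurable_EFinP; exact: measurable_prod_tnth.
- by move=> x _; rewrite lee_fin prodr_ge0.
rewrite preimage_setT.
under eq_integral => x _.
  rewrite big_ord_recl [tnth _ ord0]tnth0/=.
  under eq_bigr do rewrite tnthS.
  over.
rewrite (@fubini_tonelli_prod _ _ _ _ R m _ g (fun y => \prod_j g (tnth y j))%R)//.
- by rewrite g1 IH exprS EFinM.
- exact: measurable_prod_tnth.
- by move=> x; exact: prodr_ge0.
Qed.

(** [1 + |z|] dominates [1 + |z_j|] for each of the [n] coordinates, and hence its
    power [b] dominates the product of their powers [b / n], where [b / n > 2]: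
    the integral is at most a power of a finite integral over the plane. *)
Lemma nint_decay n (b : R) : (2 * n%:R < b)%R ->
  nint (fun z : 'rV[R[i]]_n => ((1 + enorm z) `^ (- b))%:E) < +oo.
Proof.
move=> nb.
(* in dimension 0 any exponent above 2 will do *)
pose a : R := if n == 0%N then 3%R else (b / n%:R)%R.
have a2 : (2 < a)%R.
  rewrite /a; case: eqP => [_|/eqP n0]; first by rewrite ltr_nat.
  by rewrite ltr_pdivlMr// ltr0n lt0n.
have b0 : (0 <= b)%R by rewrite ltW// (le_lt_trans _ nb)// mulr_ge0.
pose g (z : MR * MR) := ((1 + Num.sqrt (z.1 ^+ 2 + z.2 ^+ 2)) `^ (- a))%R.
have mg : measurable_fun setT g.
  apply: (measurableT_comp (f := fun x => x `^ (- a))%R); first exact: measurable_powR.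
  apply: measurable_funD => //.
  apply: (measurableT_comp (f := @Num.sqrt R)).
    by apply: continuous_measurable_fun; exact: sqrt_continuous.
  by apply: measurable_funD; apply: measurable_funX.
have g0 z : (0 <= g z)%R by exact: powR_ge0.
have gy := plane_decay a2.
have ge0 : 0 <= \int[@area R]_z (g z)%:E by apply: integral_ge0 => z _; rewrite lee_fin.
have fin : \int[@area R]_z (g z)%:E = (fine (\int[@area R]_z (g z)%:E))%:E.
  by rewrite fineK// ge0_fin_numE.
have E := integral_tuple_prod_pow n mg g0 fin.
apply: (@le_lt_trans _ _ (\int[dv n]_x (\prod_j g (tnth x j))%:E)); last first.
  by rewrite E ltry.
apply: ge0_le_integral => //.
- by move=> x _; rewrite lee_fin powR_ge0.
- exact: (rmeas_emeas (rmeas_powR (- b) (rmeasD (rmeas_cst 1%R) rmeas_enorm))).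
- by apply/measurable_EFinP; exact: measurable_prod_tnth.
move=> x _; rewrite lee_fin.
apply: (@le_trans _ _ (\prod_(j < n) ((1 + enorm (cvec x)) `^ (- a)))%R); last first.
  apply: ler_prod => j _; rewrite powR_ge0/= /g !powRN.
  have P : (0 < 1 + enorm (cvec x))%R by rewrite ltr_pwDl// enorm_ge0.
  have Q : (0 < 1 + Num.sqrt ((tnth x j).1 ^+ 2 + (tnth x j).2 ^+ 2))%R.
    by rewrite ltr_pwDl// sqrtr_ge0.
  rewrite lef_pV2 ?posrE ?powR_gt0//.
  rewrite ge0_ler_powR ?nnegrE ?addr_ge0 ?sqrtr_ge0 ?enorm_ge0//.
    by rewrite ltW// (lt_trans _ a2).
  by rewrite lerD2l; have := normc_le_enorm (cvec x) j; rewrite mxE.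
rewrite prodr_const card_ord -powR_mulrn ?powR_ge0// -powRrM.
rewrite /a; case: eqP => [n0|/eqP n0].
  have -> : (n%:R = 0 :> R)%R by rewrite n0.
  rewrite mulr0 powRr0 powRN; have := enorm_ge0 (cvec x); move: (enorm _) => t t0.
  rewrite invf_le1 ?powR_gt0 ?ltr_pwDl//.
  have h1 : (1 `^ b <= (1 + t) `^ b)%R by rewrite ge0_ler_powR ?nnegrE ?addr_ge0// lerDl.
  by rewrite powR1 in h1.
by rewrite mulNr divfK// pnatr_eq0.
Qed.

End decay.

End integration.

(** * Complex integrals and the Gaussian mean value property *)

Section complex_integral.
Context {R : realType} {n : nat}.
Notation MR := (measurableTypeR R).
Notation X := (n.-tuple (MR * MR)%type).
Notation Cn := 'rV[R[i]]_n.
Implicit Types (f g : Cn -> R[i]).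

Definition cintegrable f :=
  cmeas f /\ (nint (fun z => (normc (f z))%:E) < +oo)%E.

Lemma cintegrable_Re f : cintegrable f ->
  (dv n).-integrable [set: X] (fun x => (complex.Re (f (cvec x)))%:E).
Proof.
move=> [[mr mi] fy]; apply/integrableP; split; first exact: (rmeas_emeas mr).
apply: le_lt_trans fy; apply: ge0_le_integral => //.
- by apply: measurableT_comp => //; exact: (rmeas_emeas mr).
- exact: (rmeas_emeas (rmeas_normc (conj mr mi))).
- by move=> x _ /=; rewrite lee_fin Re_le_normc.
Qed.

Lemma cintegrable_Im f : cintegrable f ->
  (dv n).-integrable [set: X] (fun x => (complex.Im (f (cvec x)))%:E).
Proof.
move=> [[mr mi] fy]; apply/integrableP; split; first exact: (rmeas_emeas mi).
apply: le_lt_trans fy; apply: ge0_le_integral => //.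
- by apply: measurableT_comp => //; exact: (rmeas_emeas mi).
- exact: (rmeas_emeas (rmeas_normc (conj mr mi))).
- by move=> x _ /=; rewrite lee_fin Im_le_normc.
Qed.

Lemma cintegrable_le f (g : Cn -> R) : cmeas f -> rmeas g ->
  (nint (fun z => (g z)%:E) < +oo)%E -> (forall z, normc (f z) <= g z) ->
  cintegrable f.
Proof.
move=> mf mg gy fg; split=> //; apply: le_lt_trans gy; apply: le_nint.
- by apply: rmeas_emeas; exact: rmeas_normc.
- exact: rmeas_emeas.
- by move=> z; rewrite lee_fin normc_ge0.
- by move=> z; rewrite lee_fin.
Qed.

Lemma emeas_normc f : cmeas f -> emeas (fun z => (normc (f z))%:E).
Proof. by move=> mf; apply: rmeas_emeas; exact: rmeas_normc. Qed.

Lemma normcE_ge0 f z : (0 <= (normc (f z))%:E)%E.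
Proof. by rewrite lee_fin normc_ge0. Qed.

Lemma cintegrableD f g : cintegrable f -> cintegrable g ->
  cintegrable (fun z => f z + g z).
Proof.
move=> [mf fy] [mg gy].
apply: (cintegrable_le (g := fun z => normc (f z) + normc (g z))).
- exact: cmeasD.
- by apply: rmeasD; exact: rmeas_normc.
- under eq_nint do rewrite EFinD.
  rewrite (nintD (emeas_normc mf) (emeas_normc mg) (normcE_ge0 f) (normcE_ge0 g)).
  exact: lte_add_pinfty.
- by move=> z; exact: normcD.
Qed.

Lemma cintegrableZ (c : R[i]) f : cintegrable f -> cintegrable (fun z => c * f z).
Proof.
move=> [mf fy].
apply: (cintegrable_le (g := fun z => normc c * normc (f z))).
- by apply: cmeasM => //; exact: cmeas_cst.
- by apply: rmeasM; [exact: rmeas_cst|exact: rmeas_normc].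
- under eq_nint do rewrite EFinM.
  rewrite nintZ; [|exact: emeas_normc|exact: normcE_ge0|by rewrite lee_fin normc_ge0].
  by rewrite lte_mul_pinfty// lee_fin normc_ge0.
- by move=> z; rewrite normcM.
Qed.

Lemma cintegrable0 : cintegrable (fun=> 0).
Proof.
split; first exact: cmeas_cst.
by rewrite /nint; under eq_integral do rewrite normc0; rewrite integral0.
Qed.

Lemma cintegrable_sum (I : Type) (s : seq I) (F : I -> Cn -> R[i]) :
  (forall i, cintegrable (F i)) -> cintegrable (fun z => \sum_(i <- s) F i z).
Proof.
move=> mF; elim: s => [|i s IH].
  by under [X in cintegrable X]funext do rewrite big_nil; exact: cintegrable0.
by under [X in cintegrable X]funext do rewrite big_cons; exact: (cintegrableD (mF i) IH).
Qed.

Lemma cintegrableB f g : cintegrable f -> cintegrable g ->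
  cintegrable (fun z => f z - g z).
Proof.
move=> cf cg; under [X in cintegrable X]funext do rewrite -mulN1r.
exact: (cintegrableD cf (cintegrableZ (-1) cg)).
Qed.

Lemma cintegralD f g : cintegrable f -> cintegrable g ->
  cintegral (fun z => f z + g z) = cintegral f + cintegral g.
Proof.
move=> cf cg; apply: complex_eq; rewrite ?ReD ?ImD /=.
  rewrite -(RintegralD measurableT (cintegrable_Re cf) (cintegrable_Re cg)).
  by apply: eq_Rintegral => x _; rewrite ReD.
rewrite -(RintegralD measurableT (cintegrable_Im cf) (cintegrable_Im cg)).
by apply: eq_Rintegral => x _; rewrite ImD.
Qed.

Lemma cintegralZ (c : R[i]) f : cintegrable f ->
  cintegral (fun z => c * f z) = c * cintegral f.
Proof.
move=> cf; have r := cintegrable_Re cf; have i := cintegrable_Im cf.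
have Z (k : R) (h : X -> R) : (dv n).-integrable [set: X] (fun x => (h x)%:E) ->
   (dv n).-integrable [set: X] (fun x => (k * h x)%:E).
  by move=> hh; under [X in _.-integrable _ X]funext do rewrite EFinM; exact: integrableZl.
apply: complex_eq; rewrite ?Re_mul ?Im_mul /=.
  rewrite -!(RintegralZl _ measurableT)// -(RintegralB measurableT (Z _ _ r) (Z _ _ i)).
  by apply: eq_Rintegral => x _; rewrite Re_mul.
rewrite -!(RintegralZl _ measurableT)// -(RintegralD measurableT (Z _ _ i) (Z _ _ r)).
by apply: eq_Rintegral => x _; rewrite Im_mul.
Qed.

Lemma eq_cintegral f g : f =1 g -> cintegral f = cintegral g.
Proof. by move=> /funext ->. Qed.

Lemma cintegral0 : cintegral (fun _ : Cn => 0 : R[i]) = 0.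
Proof. by apply: complex_eq => /=; rewrite /Rintegral integral0. Qed.

Lemma cintegral_sum (I : Type) (s : seq I) (F : I -> Cn -> R[i]) :
  (forall i, cintegrable (F i)) ->
  cintegral (fun z => \sum_(i <- s) F i z) = \sum_(i <- s) cintegral (F i).
Proof.
move=> mF; elim: s => [|i s IH].
  by rewrite big_nil -[RHS]cintegral0; apply: eq_cintegral => z; rewrite big_nil.
rewrite big_cons -IH -(cintegralD (mF i) (cintegrable_sum s mF)).
by apply: eq_cintegral => z; rewrite big_cons.
Qed.

Lemma cintegralB f g : cintegrable f -> cintegrable g ->
  cintegral (fun z => f z - g z) = cintegral f - cintegral g.
Proof.
move=> cf cg; rewrite -mulN1r -(cintegralZ (-1) cg).
rewrite -(cintegralD cf (cintegrableZ (-1) cg)).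
by apply: eq_cintegral => z; rewrite mulN1r.
Qed.

(** The constant 1 would need a rotation of the value; with 2, real and imaginary
    parts can be treated separately. *)
Lemma normc_cintegral f : cintegrable f ->
  ((normc (cintegral f))%:E <= 2%:E * nint (fun z => (normc (f z))%:E))%E.
Proof.
move=> cf; have [mf fy] := cf.
have ge0 : (0 <= nint (fun z => (normc (f z))%:E))%E by apply: nint_ge0; exact: normcE_ge0.
have E : nint (fun z => (normc (f z))%:E) = (fine (nint (fun z => (normc (f z))%:E)))%:E.
  by rewrite fineK// ge0_fin_numE.
have H (h : R[i] -> R) : (forall z, `|h z| <= normc z) ->
    (dv n).-integrable [set: X] (fun x => (h (f (cvec x)))%:E) ->
    `|\int[dv n]_x h (f (cvec x))| <= fine (nint (fun z => (normc (f z))%:E)).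
  move=> hn ih; rewrite (le_trans (le_normr_Rintegral measurableT ih))// -lee_fin -E.
  have [mh hy] := integrableP _ _ _ ih.
  have -> : (\int[dv n]_t `|h (f (cvec t))|)%:E = (\int[dv n]_t `|(h (f (cvec t)))%:E|)%E.
    rewrite /Rintegral fineK//; apply: integrable_fin_num => //.
    exact: (integrable_abse ih).
  apply: ge0_le_integral => //.
  - by apply: measurableT_comp.
  - exact: emeas_normc.
  - by move=> x _ /=; rewrite lee_fin hn.
rewrite E -EFinM lee_fin (le_trans (normc_le_ReIm _))// mulr2n mulrDl mul1r lerD//.
  by apply: H; [exact: Re_le_normc|exact: cintegrable_Re].
by apply: H; [exact: Im_le_normc|exact: cintegrable_Im].
Qed.

Lemma mpres_integral d (T : measurableType d) (m : {measure set T -> \bar R})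
    (phi : T -> T) (h : T -> \bar R) :
  mpres m phi -> measurable_fun setT h ->
  (\int[m]_x h (phi x) = \int[m]_x h x)%E.
Proof.
move=> [mphi H] mh; rewrite [LHS]integralE [RHS]integralE; congr (_ - _)%E.
  rewrite -(H (h^\+)%E)//; last exact: measurable_funepos.
  by apply: eq_integral => x _; rewrite (funepos_comp h phi).
rewrite -(H (h^\-)%E)//; last exact: measurable_funeneg.
by apply: eq_integral => x _; rewrite (funeneg_comp h phi).
Qed.

Lemma cintegral_shift w f : cmeas f -> cintegral (fun z => f (z + w)) = cintegral f.
Proof.
move=> [mr mi]; apply: complex_eq => /=; rewrite /Rintegral; congr fine;
  under eq_integral do rewrite -cvec_tshift.
  rewrite (mpres_integral (h := fun x => (complex.Re (f (cvec x)))%:E) (mpres_tshift w))//.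
  exact: (rmeas_emeas mr).
rewrite (mpres_integral (h := fun x => (complex.Im (f (cvec x)))%:E) (mpres_tshift w))//.
exact: (rmeas_emeas mi).
Qed.

Lemma rmeas_shift w (f : Cn -> R) : rmeas f -> rmeas (fun z => f (z + w)).
Proof.
move=> mf; apply/measurable_EFinP; exact: (emeas_shift w (rmeas_emeas mf)).
Qed.

Lemma cmeas_shift w f : cmeas f -> cmeas (fun z => f (z + w)).
Proof. by move=> [mr mi]; split; [exact: (rmeas_shift w mr)|exact: (rmeas_shift w mi)]. Qed.

Definition gauss (z : Cn) : R := expR (- enorm z ^+ 2).

Lemma rmeas_gauss : rmeas gauss.
Proof.
apply: rmeas_expR; under [X in rmeas X]funext do rewrite -mulN1r.
exact: (rmeasM (rmeas_cst _) (rmeasX 2 rmeas_enorm)).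
Qed.

Lemma nint_gauss : nint (fun z => (gauss z)%:E) = 1%E.
Proof. exact: dv_normalized. Qed.

Lemma enorm_cis t (z : Cn) : enorm (cis t *: z) = enorm z.
Proof. by rewrite enormZ normc_cexp/= expR0 mul1r. Qed.

Let measurable_trot : measurable_fun [set: MR * X] (fun tx => trot tx.1 tx.2).
Proof.
apply/measurable_fun_tnthP => j.
rewrite (_ : _ \o _ = fun tx : MR * X =>
  ((cos tx.1 * (tnth tx.2 j).1 - sin tx.1 * (tnth tx.2 j).2 : MR)%R,
   (sin tx.1 * (tnth tx.2 j).1 + cos tx.1 * (tnth tx.2 j).2 : MR)%R)); last first.
  by apply/funext => tx /=; rewrite tnth_mktuple.
have m1 : measurable_fun [set: MR * X] (fun tx => (tnth tx.2 j).1 : MR).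
  apply: (measurableT_comp (f := @fst MR MR)) => //.
  apply: (measurableT_comp (f := fun x : X => tnth x j)) => //.
  exact: measurable_tnth.
have m2 : measurable_fun [set: MR * X] (fun tx => (tnth tx.2 j).2 : MR).
  apply: (measurableT_comp (f := @snd MR MR)) => //.
  apply: (measurableT_comp (f := fun x : X => tnth x j)) => //.
  exact: measurable_tnth.
have mc : measurable_fun [set: MR * X] (fun tx => cos tx.1 : MR).
  apply: (measurableT_comp (f := @cos R)) => //.
  by apply: continuous_measurable_fun; exact: continuous_cos.
have ms : measurable_fun [set: MR * X] (fun tx => sin tx.1 : MR).
  apply: (measurableT_comp (f := @sin R)) => //.
  by apply: continuous_measurable_fun; exact: continuous_sin.
apply/measurable_fun_pairP; split.
  exact: (measurable_funB (measurable_funM mc m1) (measurable_funM ms m2)).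
exact: (measurable_funD (measurable_funM ms m1) (measurable_funM mc m2)).
Qed.

(** The Gaussian is invariant under [z |-> e^{it} z]: integrate over [t] first. *)
Lemma gauss_mean_value (u : Cn -> R) : rmeas u ->
  (nint (fun z => (`|u z| * gauss z)%:E) < +oo)%E ->
  (forall z, has_circle_mean (fun t => u (cis t *: z)) (u 0)) ->
  \int[dv n]_x (u (cvec x) * gauss (cvec x)) = u 0.
Proof.
move=> mu uy circ.
pose D := `[0, 2 * pi]%classic : set MR.
have mD : measurable D by exact: measurable_itv.
have pi2 : (0 : R) < 2 * pi by rewrite mulr_gt0// pi_gt0.
have muD : lebesgue_measure D = (2 * pi)%:E.
  by rewrite lebesgue_measure_itv/= lte_fin pi2 -EFinB subr0.
pose h (tx : MR * X) : R := \1_D tx.1 * (u (cvec (trot tx.1 tx.2)) * gauss (cvec tx.2)).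
have mh : measurable_fun [set: MR * X] h.
  apply: measurable_funM.
    by apply: (measurableT_comp (f := \1_D : MR -> R)).
  apply: measurable_funM.
    exact: (measurableT_comp mu measurable_trot).
  exact: (measurableT_comp rmeas_gauss).
have rot t (f : Cn -> R) : rmeas f ->
   (\int[dv n]_x (f (cvec (trot t x)) * gauss (cvec x))%:E =
    \int[dv n]_x (f (cvec x) * gauss (cvec x))%:E)%E.
  move=> mf.
  rewrite -(mpres_integral (h := fun x => (f (cvec x) * gauss (cvec x))%:E)
    (mpres_trot t)); last exact: (rmeas_emeas (rmeasM mf rmeas_gauss)).
  by apply: eq_integral => x _; rewrite /gauss cvec_trot enorm_cis.
have ind (F : MR -> \bar R) :
    (\int[@lebesgue_measure R]_t ((\1_D t)%:E * F t) = \int[@lebesgue_measure R]_(t in D) F t)%E.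
  rewrite [RHS]integral_mkcond; apply: eq_integral => t _.
  by rewrite patchE indicE; case: ifP => _; rewrite ?mul1e ?mul0e.
have indc (c : \bar R) : (\int[@lebesgue_measure R]_t ((\1_D t)%:E * c) = c * (2 * pi)%:E)%E.
  by rewrite (ind (fun=> c)) integral_cst//; congr (c * _)%E; exact: muD.
have mabs : rmeas (fun z => `|u z|) by apply: (measurableT_comp _ mu).
pose A := nint (fun z => (`|u z| * gauss z)%:E).
have A0 : (0 <= A)%E by apply: nint_ge0 => z; rewrite lee_fin mulr_ge0 ?expR_ge0.
have ih : (@lebesgue_measure R \x dv n)%E.-integrable [set: MR * X] (EFin \o h).
  apply/integrable12ltyP; first exact/measurable_EFinP.
  rewrite (_ : (\int[_]_x _ = \int[@lebesgue_measure R]_t ((\1_D t)%:E * A))%E).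
    by rewrite indc lte_mul_pinfty ?ge0_fin_numE// ltry.
  apply: eq_integral => t _.
  rewrite /A /nint -(rot t (fun z => `|u z|))// -ge0_integralZl//=.
  - apply: eq_integral => x _.
    by rewrite -EFinM /h !normrM (ger0_norm (expR_ge0 _)) (ger0_norm (x := \1_D t)).
  - apply/measurable_EFinP; apply: measurable_funM; last exact: rmeas_gauss.
    by have [mt _] := @mpres_trot R n t; exact: (measurableT_comp mabs mt).
  - by move=> x _; rewrite lee_fin mulr_ge0 ?expR_ge0.
have iu : (dv n).-integrable [set: X] (fun x => (u (cvec x) * gauss (cvec x))%:E).
  apply/integrableP; split; first exact: (rmeas_emeas (rmeasM mu rmeas_gauss)).
  under eq_integral => x _ do rewrite /= normrM (ger0_norm (expR_ge0 _)).
  exact: uy.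
have ig : (dv n).-integrable [set: X] (fun x => (gauss (cvec x))%:E).
  apply/integrableP; split; first exact: (rmeas_emeas rmeas_gauss).
  under eq_integral => x _ do rewrite /= (ger0_norm (expR_ge0 _)).
  by rewrite [ltLHS]nint_gauss ltry.
have := Fubini ih => /=.
have -> : (\int[@lebesgue_measure R]_t \int[dv n]_x (h (t, x))%:E =
    (\int[dv n]_x (u (cvec x) * gauss (cvec x))) %:E * (2 * pi)%:E)%E.
  rewrite -indc; apply: eq_integral => t _.
  rewrite /Rintegral fineK; last exact: integrable_fin_num.
  rewrite -(rot t u mu) -integralZl//.
  have := integrableP _ _ _ iu => -[miu iuy].
  apply/integrableP; split.
    apply/measurable_EFinP; apply: measurable_funM; last exact: rmeas_gauss.
    by have [mt _] := @mpres_trot R n t; exact: (measurableT_comp mu mt).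
  under eq_integral => x _ do rewrite /= normrM (ger0_norm (expR_ge0 _)).
  by rewrite (rot t (fun z => `|u z|)).
have -> : (\int[dv n]_x \int[@lebesgue_measure R]_t (h (t, x))%:E =
    (2 * pi * u 0)%:E * \int[dv n]_x (gauss (cvec x))%:E)%E.
  rewrite -integralZl//; apply: eq_integral => x _.
  transitivity (\int[@lebesgue_measure R]_(t in D)
     ((u (cis t *: cvec x))%:E * (gauss (cvec x))%:E))%E.
    by rewrite -ind; apply: eq_integral => t _; rewrite /h /= cvec_trot !EFinM.
  have [icx ecx] := circ (cvec x).
  by rewrite integralZr//; congr (_ * _)%E; exact: ecx.
have eg : (\int[dv n]_x (gauss (cvec x))%:E = 1)%E := nint_gauss.
rewrite eg mule1 -EFinM mulrC => /eqP; rewrite eqe => /eqP.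
exact: (mulfI (lt0r_neq0 pi2)).
Qed.

End complex_integral.

(** * Entire functions *)

Section entire_functions.
Context {R : realType}.

Lemma complex_gt0 (e : R[i]) : 0 < e -> e = (complex.Re e)%:C /\ 0 < complex.Re e.
Proof.
rewrite ltcE/= => /andP[/eqP e1 e2]; split=> //.
by apply: complex_eq.
Qed.

Lemma realc_gt0 (r : R) : 0 < r -> 0 < r%:C :> R[i].
Proof. by move=> r0; rewrite ltcE/= eqxx. Qed.

Lemma lec_real (r s : R) : (r%:C <= s%:C :> R[i]) = (r <= s).
Proof. by rewrite lecE/= eqxx. Qed.

Lemma ltc_real (r s : R) : (r%:C < s%:C :> R[i]) = (r < s).
Proof. by rewrite ltcE/= eqxx. Qed.

Lemma natcE m : m%:R = (m%:R : R)%:C :> R[i].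
Proof. by rewrite rmorph_nat. Qed.

Section fixed_dimension.
Context {n : nat}.
Notation Cn := 'rV[R[i]]_n.
Implicit Types (f g : Cn -> R[i]) (z h : Cn).

Let V : normedModType R[i] := 'rV[R[i]]_n.

Let mxnorm_le_enorm h : mx_norm h <= (enorm h)%:C.
Proof.
have e0 : 0 <= (enorm h)%:C :> R[i] by rewrite lecE/= eqxx enorm_ge0.
rewrite mx_normE -[leRHS]/((NngNum e0)%:num) num_le; apply/bigmax_leP; split => [|ij _].
  by rewrite -num_le.
by rewrite -num_le/= normr_normc lecE/= eqxx ord1 normc_le_enorm.
Qed.

Let mxnorm_ge h j : `|h 0 j| <= mx_norm h.
Proof.
rewrite mx_normE -[leLHS]nngE num_le.
exact: (le_bigmax _ (fun ij => `|h ij.1 ij.2|%:nng) (0, j)).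
Qed.

Let enorm_le_mxnorm h : (enorm h)%:C <= n%:R * mx_norm h.
Proof.
apply: (@le_trans _ _ (\sum_j normc (h 0 j))%:C).
  by rewrite lec_real enorm_le_sum.
rewrite rmorph_sum/= -[X in X%:R]card_ord mulr_natl -sumr_const ler_sum// => j _.
by rewrite -normr_normc mxnorm_ge.
Qed.

(** Complex differentiability in terms of the Euclidean norm and real epsilons. *)
Definition edifferentiable f z := exists L : 'I_n -> R[i], forall e : R, 0 < e ->
  exists2 r : R, 0 < r & forall h, enorm h < r ->
    normc (f (z + h) - f z - \sum_j L j * h 0 j) <= e * enorm h.

Lemma entire_edifferentiable f : entire f -> forall z, edifferentiable f z.
Proof.
move=> ef z; have df : differentiable (f : V -> R[i]^o) (z : V) := ef z.
exists (fun j => 'd (f : V -> R[i]^o) (z : V) (delta_mx 0 j : V)) => e e0.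
have dh h : 'd (f : V -> R[i]^o) (z : V) (h : V) =
    \sum_j 'd (f : V -> R[i]^o) (z : V) (delta_mx 0 j : V) * h 0 j.
  rewrite {1}(row_sum_delta h) linear_sum; apply: eq_bigr => j _.
  by rewrite linearZ /= mulrC.
have := diff_locally df => /eqaddoP/= /(_ e%:C (realc_gt0 e0)).
move=> /nbhs_norm0P[r /= /complex_gt0[-> r0] Hr].
exists (complex.Re r) => // h hr.
have nh : `|h : V| < (complex.Re r)%:C.
  by rewrite (le_lt_trans (mxnorm_le_enorm h))// ltc_real.
have := Hr h nh => /= H.
rewrite -lec_real -normr_normc.
rewrite (le_trans _ (_ : e%:C * `|h : V| <= _))//; last first.
  rewrite realcM ler_wpM2l//; first by rewrite lecE/= eqxx ltW.
  exact: mxnorm_le_enorm.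
by move: H; rewrite !fctE/= dh (addrC h) opprD addrA.
Qed.

Lemma edifferentiable_entire f : (forall z, edifferentiable f z) -> entire f.
Proof.
move=> H z; have [L {}H] := H z.
have lin : linear (fun h : V => (\sum_j L j * h 0 j : R[i]^o)).
  move=> a u v; rewrite scaler_sumr -big_split/=; apply: eq_bigr => j _.
  by rewrite !mxE mulrDr mulrCA.
pose df : {linear V -> R[i]^o} :=
  HB.pack (fun h : V => (\sum_j L j * h 0 j : R[i]^o)) (GRing.isLinear.Build _ _ _ _ _ lin).
have cdf : continuous (df : V -> R[i]^o).
  have H0 (s : seq 'I_n) :
      continuous (fun h : V => (\sum_(j <- s) L j * h 0 j : R[i]^o)).
    elim: s => [|j s IH].
      rewrite (_ : (fun h : V => _) = cst 0); first by move=> u; exact: cst_continuous.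
      by apply/funext => h; rewrite big_nil.
    rewrite (_ : (fun h : V => _) = fun h : V =>
      (L j * h 0 j : R[i]^o) + (\sum_(j <- s) L j * h 0 j : R[i]^o)); last first.
      by apply/funext => h; rewrite big_cons.
    have cc : continuous (fun h : V => (h 0 j : R[i]^o)) by exact: coord_continuous.
    have cL : continuous (fun _ : V => (L j : R[i]^o)) by move=> u; exact: cst_continuous.
    have cM : continuous (fun h : V => (L j * h 0 j : R[i]^o)).
      by move=> u; exact: (continuousM (cL u) (cc u)).
    by move=> u; exact: (continuousD (cM u) (IH u)).
  exact: H0.
have fe : (f : V -> R[i]^o) \o shift (z : V) = cst (f z) + df +o_ 0 id.
  apply/eqaddoP => eps eps0; have [ee e0] := complex_gt0 eps0.
  rewrite ee; move: (complex.Re eps) e0 => e e0.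
  have [|r r0 Hr] := H (e / n.+1%:R); first by rewrite divr_gt0.
  suff H1 : \forall h \near (0 : V),
      `|(((f : V -> R[i]^o) \o shift (z : V)) - (cst (f z) + df)) h| <= e%:C * `|h|.
    exact: H1.
  apply/nbhs_norm0P; exists (r / n.+1%:R)%:C => /=; first by rewrite realc_gt0// divr_gt0.
  move=> h /= hr.
  have n1 : n%:R * mx_norm h <= n.+1%:R * mx_norm h.
    by rewrite ler_wpM2r ?ler_nat// mx_normE.
  have hr' : enorm h < r.
    rewrite -ltc_real (le_lt_trans (enorm_le_mxnorm h))// (le_lt_trans n1)//.
    have -> : r%:C = n.+1%:R * (r / n.+1%:R)%:C.
      by rewrite natcE -realcM mulrC divfK.
    by rewrite ltr_pM2l.
  have := Hr _ hr'; rewrite -lec_real -normr_normc => /le_trans Hh.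
  rewrite !fctE/= (addrC h) opprD addrA Hh// realcM.
  have -> : e%:C = (e / n.+1%:R)%:C * n.+1%:R :> R[i].
    by rewrite natcE -realcM divfK.
  rewrite -mulrA ler_wpM2l//; first by rewrite lecE/= eqxx divr_ge0// ltW.
  exact: le_trans (enorm_le_mxnorm h) n1.
have dE := diff_unique cdf fe.
by apply/diff_locallyP; rewrite dE.
Qed.

Lemma entire_cont f : entire f -> forall z (e : R), 0 < e ->
    exists2 r : R, 0 < r & forall h, enorm h < r -> normc (f (z + h) - f z) <= e.
Proof.
move=> /entire_edifferentiable ef z e e0; have [L H] := ef z.
have [r r0 {}H] := H 1 ltr01.
pose B := \sum_j normc (L j) + 1.
have B0 : 0 < B by rewrite ltr_wpDl// sumr_ge0// => j _; exact: normc_ge0.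
exists (Num.min r (e / B)); first by rewrite lt_min r0 divr_gt0.
move=> h; rewrite lt_min => /andP[hr he].
have -> : f (z + h) - f z = (f (z + h) - f z - \sum_j L j * h 0 j) + \sum_j L j * h 0 j.
  by rewrite subrK.
rewrite (le_trans (normcD _ _))// (le_trans (lerD (H _ hr) (normc_sum _ _ _)))//.
rewrite (le_trans (y := B * enorm h))//; last by rewrite mulrC -ler_pdivlMr// ltW.
rewrite mul1r /B mulrDl mul1r addrC lerD2r mulr_suml ler_sum// => j _.
by rewrite normcM ler_wpM2l ?normc_ge0// normc_le_enorm.
Qed.

Lemma entire_cmeas f : entire f -> cmeas f.
Proof. by move=> ef; apply: econt_cmeas; exact: entire_cont. Qed.

Lemma entire_cdiff f z v : entire f -> cdiff (fun a => f (z + a *: v)).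
Proof.
move=> /entire_edifferentiable ef a; have [L H] := ef (z + a *: v).
pose W := enorm v + 1; have W0 : 0 < W by rewrite ltr_wpDl ?enorm_ge0.
exists (\sum_j L j * v 0 j) => e e0.
have [r r0 {}H] := H _ (divr_gt0 e0 W0).
exists (r / W); first by rewrite divr_gt0.
move=> h hr.
have hV : enorm (h *: v) <= normc h * W.
  by rewrite enormZ ler_wpM2l ?normc_ge0// lerDl.
have := H (h *: v) _; rewrite (le_lt_trans hV) -?ltr_pdivlMr// => /(_ isT).
rewrite -(addrA z) -scalerDl => Hh.
have -> : (\sum_j L j * v 0 j) * h = \sum_j L j * (h *: v) 0 j.
  by rewrite mulr_suml; apply: eq_bigr => j _; rewrite mxE mulrAC mulrA.
rewrite (le_trans Hh)// (le_trans (ler_wpM2l _ hV))//; first by rewrite divr_ge0// ltW.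
by rewrite mulrA mulrAC mulfVK ?gt_eqF.
Qed.

Lemma entire_dotc (phi : R[i] -> R[i]) (w : Cn) : cdiff phi ->
  entire (fun z => phi (dotc w z)).
Proof.
move=> cphi; apply: edifferentiable_entire => z; have [d H] := cphi (dotc w z).
exists (fun j => d * (w 0 j)^*) => e e0.
pose W := enorm w + 1; have W0 : 0 < W by rewrite ltr_wpDl ?enorm_ge0.
have [r r0 {}H] := H _ (divr_gt0 e0 W0).
exists (r / W); first by rewrite divr_gt0.
move=> h hr.
have hV : normc (dotc w h) <= enorm h * W.
  rewrite (le_trans (normc_dotc _ _))// mulrC ler_wpM2l ?enorm_ge0//.
  by rewrite lerDl.
have := H (dotc w h) _; rewrite (le_lt_trans hV) -?ltr_pdivlMr// => /(_ isT) Hh.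
rewrite dotcDr (_ : \sum_j _ = d * dotc w h); last first.
  by rewrite mulr_sumr; apply: eq_bigr => j _; rewrite mulrA.
rewrite (le_trans Hh)// (le_trans (ler_wpM2l _ hV))//; first by rewrite divr_ge0// ltW.
by rewrite mulrA mulrAC mulfVK ?gt_eqF.
Qed.

Lemma cdiff_cexp : cdiff (@cexp R).
Proof.
have : cdiff (id : R[i] -> R[i]).
  move=> a; exists 1 => e e0; exists 1 => // h _.
  rewrite (_ : _ - _ = 0); last by ring.
  by rewrite normc0 mulr_ge0 ?normc_ge0// ltW.
by move=> /cdiff_comp_cexp.
Qed.

Lemma entire_rkernel w : entire (rkernel w : Cn -> R[i]).
Proof. exact: (entire_dotc w cdiff_cexp). Qed.

Lemma entire_cst c : entire (fun _ : Cn => c).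
Proof. by move=> z; exact: differentiable_cst. Qed.

Lemma entireM f g : entire f -> entire g -> entire (fun z => f z * g z).
Proof. by move=> ef eg z; apply: differentiableM. Qed.

Lemma entireD f g : entire f -> entire g -> entire (fun z => f z + g z).
Proof. by move=> ef eg z; apply: differentiableD. Qed.

Lemma entireZ c f : entire f -> entire (fun z => c * f z).
Proof. by move=> ef; apply: entireM => //; exact: entire_cst. Qed.

Lemma entireB f g : entire f -> entire g -> entire (fun z => f z - g z).
Proof. by move=> ef eg z; apply: differentiableB. Qed.

Lemma entire_coord j : entire (fun z : Cn => z 0 j).
Proof.
apply: edifferentiable_entire => z; exists (fun k => (k == j)%:R) => e e0.
exists 1 => // h _; rewrite (bigD1 j)//= eqxx mul1r big1 ?addr0; last first.
  by move=> k /negbTE ->; rewrite mul0r.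
rewrite mxE (_ : _ - _ = 0); last by ring.
by rewrite normc0 mulr_ge0 ?enorm_ge0// ltW.
Qed.

Lemma entire_sum (I : Type) (s : seq I) (F : I -> Cn -> R[i]) :
  (forall i, entire (F i)) -> entire (fun z => \sum_(i <- s) F i z).
Proof.
move=> mF; elim: s => [|i s IH].
  by under [X in entire X]funext do rewrite big_nil; exact: entire_cst.
by under [X in entire X]funext do rewrite big_cons; exact: (entireD (mF i) IH).
Qed.

Lemma entire_prod (I : Type) (s : seq I) (F : I -> Cn -> R[i]) :
  (forall i, entire (F i)) -> entire (fun z => \prod_(i <- s) F i z).
Proof.
move=> mF; elim: s => [|i s IH].
  by under [X in entire X]funext do rewrite big_nil; exact: entire_cst.
by under [X in entire X]funext do rewrite big_cons; exact: (entireM (mF i) IH).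
Qed.

Lemma entire_shift f w : entire f -> entire (fun z => f (z + w)).
Proof.
move=> /entire_edifferentiable ef; apply: edifferentiable_entire => z.
have [L H] := ef (z + w); exists L => e e0; have [r r0 {}H] := H e e0.
by exists r => // h hr; rewrite (addrAC z) H.
Qed.

End fixed_dimension.

Lemma enorm_rV1 (y : 'rV[R[i]]_1) : enorm y = normc (y 0 0).
Proof. by rewrite /enorm big_ord1 sqrtr_sqr ger0_norm ?normc_ge0. Qed.

Lemma entire_line n (f : 'rV[R[i]]_n -> R[i]) z v : entire f ->
  entire (fun y : 'rV[R[i]]_1 => f (z + y 0 0 *: v)).
Proof.
move=> ef; apply: edifferentiable_entire => y.
have [d H] := entire_cdiff z v ef (y 0 0).
exists (fun=> d) => e e0; have [r r0 {}H] := H e e0; exists r => // h.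
by rewrite enorm_rV1 big_ord1 mxE; exact: H.
Qed.

End entire_functions.

(** * The Gaussian transform and the reproducing formula *)

Section gaussian_transform.
Context {R : realType}.

(** Truncation errors are compared with [2^-N]: the loss of the factorial is paid
    for by the exponential. *)
Lemma cexp_trunc_geo N (a : R[i]) :
  normc (cexp a - cexp_trunc N a) <= 2^-1 ^+ N * expR (5 * normc a).
Proof.
rewrite (le_trans (cexp_trunc_le N a))//.
have -> : 5 * normc a = 4 * normc a + normc a by ring.
rewrite expRD mulrA ler_wpM2r ?expR_ge0//.
have -> : 2 * normc a = 2^-1 * (4 * normc a) by field.
rewrite exprMn -mulrA ler_wpM2l ?exprn_ge0 ?invr_ge0//.
by apply: exp_term_le; rewrite mulr_ge0 ?normc_ge0.
Qed.

Lemma expR_quad_le (a b t : R) : 0 < b -> a * t - b * t ^+ 2 <= a ^+ 2 / (4 * b).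
Proof.
move=> b0; have := sqr_ge0 (a - 2 * b * t); rewrite ler_pdivlMr ?mulr_gt0//.
by move=> h; lra.
Qed.

Section fixed_dimension.
Context {n : nat}.
Notation Cn := 'rV[R[i]]_n.
Implicit Types (f g : Cn -> R[i]) (z w h : Cn).

Lemma rmeas_expR_quad (a b : R) :
  rmeas (fun z : Cn => expR (a * enorm z - b * enorm z ^+ 2)).
Proof.
apply: rmeas_expR; exact: (rmeasB (rmeasM (rmeas_cst a) rmeas_enorm)
  (rmeasM (rmeas_cst b) (rmeasX 2 rmeas_enorm))).
Qed.

Lemma nint_expR_quad (a b : R) : 0 < b ->
  (nint (fun z : Cn => (expR (a * enorm z - b * enorm z ^+ 2))%:E) < +oo)%E.
Proof.
move=> b0; pose m := (2 * n).+1.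
pose C : R := m`!%:R * expR (1 + (a + 1) ^+ 2 / (4 * b)).
have md : 2 * n%:R < m%:R :> R by rewrite /m -natrM ltr_nat.
apply: (@le_lt_trans _ _ (nint (fun z : Cn => C%:E * ((1 + enorm z) `^ (- m%:R))%:E)%E)).
  apply: le_nint.
  - exact: (rmeas_emeas (rmeas_expR_quad a b)).
  - exact: (rmeas_emeas (rmeasM (rmeas_cst C)
      (rmeas_powR (- m%:R) (rmeasD (rmeas_cst 1) rmeas_enorm)))).
  - by move=> z; rewrite lee_fin expR_ge0.
  move=> z; rewrite -EFinM lee_fin.
  have := enorm_ge0 z; move: (enorm z) => t t0.
  have t1 : 0 < 1 + t by rewrite ltr_pwDl.
  rewrite powRN ler_pdivlMr ?powR_gt0//.
  rewrite powR_mulrn; last exact: ltW.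
  rewrite (le_trans (y := expR (a * t - b * t ^+ 2) * (m`!%:R * expR (1 + t))))//.
    rewrite ler_wpM2l ?expR_ge0// mulrC -ler_pdivrMr ?ltr0n ?fact_gt0//.
    by apply: exp_term_le; exact: ltW.
  rewrite mulrCA -expRD ler_wpM2l// ler_expR.
  by have := expR_quad_le (a + 1) t b0; lra.
rewrite nintZ.
- rewrite lte_mul_pinfty// ?lee_fin ?mulr_ge0 ?expR_ge0//.
  exact: nint_decay.
- exact: (rmeas_emeas (rmeas_powR (- m%:R) (rmeasD (rmeas_cst 1) rmeas_enorm))).
- by move=> z; rewrite lee_fin powR_ge0.
- by rewrite lee_fin mulr_ge0// expR_ge0.
Qed.

Definition wint f (a : R) : \bar R :=
  nint (fun z => (normc (f z) * expR (a * enorm z) * gauss z)%:E).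

(** Absolute convergence of all integrals of [f] against a function of exponential
    type and the Gaussian; this holds on [F^p], also after cutoffs. *)
Definition tame f := cmeas f /\ forall a, (wint f a < +oo)%E.

Lemma gauss_ge0 z : 0 <= gauss z. Proof. exact: expR_ge0. Qed.

Lemma wint_integrand_ge0 f a z :
  (0 <= (normc (f z) * expR (a * enorm z) * gauss z)%:E)%E.
Proof. by rewrite lee_fin !mulr_ge0 ?normc_ge0 ?expR_ge0. Qed.

Lemma wint_ge0 f a : (0 <= wint f a)%E.
Proof. by apply: nint_ge0; exact: wint_integrand_ge0. Qed.

Lemma rmeas_expenorm (a : R) : rmeas (fun z : Cn => expR (a * enorm z)).
Proof. exact: (rmeas_expR (rmeasM (rmeas_cst a) rmeas_enorm)). Qed.

Lemma rmeas_wint f a : cmeas f ->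
  rmeas (fun z => normc (f z) * expR (a * enorm z) * gauss z).
Proof.
by move=> mf; exact: (rmeasM (rmeasM (rmeas_normc mf) (rmeas_expenorm a)) rmeas_gauss).
Qed.

Lemma wint_fine f a : tame f -> wint f a = (fine (wint f a))%:E.
Proof. by move=> [_ /(_ a) h]; rewrite fineK// ge0_fin_numE// wint_ge0. Qed.

Lemma tame_growth f (C c : R) : cmeas f -> 0 <= C -> c < 1 ->
  (forall z, normc (f z) <= C * expR (c * enorm z ^+ 2)) -> tame f.
Proof.
move=> mf C0 c1 fC; split=> // a.
apply: (@le_lt_trans _ _ (nint (fun z : Cn =>
    C%:E * (expR (a * enorm z - (1 - c) * enorm z ^+ 2))%:E)%E)).
  have mq : rmeas (fun z : Cn => expR (a * enorm z - (1 - c) * enorm z ^+ 2)).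
    exact: rmeas_expR_quad.
  apply: le_nint.
  - exact: (rmeas_emeas (rmeas_wint a mf)).
  - exact: (rmeas_emeas (rmeasM (rmeas_cst C) mq)).
  - exact: wint_integrand_ge0.
  move=> z; rewrite -EFinM lee_fin.
  have -> : a * enorm z - (1 - c) * enorm z ^+ 2 =
    c * enorm z ^+ 2 + a * enorm z + - enorm z ^+ 2 by ring.
  rewrite /gauss !expRD.
  rewrite [leRHS](_ : _ = C * expR (c * enorm z ^+ 2) * expR (a * enorm z) *
    expR (- enorm z ^+ 2)); last by ring.
  apply: ler_wpM2r; first exact: expR_ge0.
  by apply: ler_wpM2r; [exact: expR_ge0|exact: fC].
rewrite nintZ.
- rewrite lte_mul_pinfty// ?lee_fin//.
  by apply: nint_expR_quad; rewrite subr_gt0.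
- exact: (rmeas_emeas (rmeas_expR_quad a (1 - c))).
- by move=> z; rewrite lee_fin expR_ge0.
- by rewrite lee_fin.
Qed.

Lemma tame_cintegrable f g (C a : R) : tame f -> cmeas g -> 0 <= C ->
  (forall z, normc (g z) <= C * expR (a * enorm z)) ->
  cintegrable (fun z => f z * g z * (gauss z)%:C).
Proof.
move=> tf mg C0 gC; have [mf fy] := tf.
apply: (cintegrable_le (g := fun z => C * (normc (f z) * expR (a * enorm z) * gauss z))).
- exact: (cmeasM (cmeasM mf mg) (cmeas_real rmeas_gauss)).
- exact: (rmeasM (rmeas_cst C) (rmeas_wint a mf)).
- under eq_nint do rewrite EFinM.
  rewrite nintZ ?lee_fin//; last 2 first.
  - exact: (rmeas_emeas (rmeas_wint a mf)).
  - exact: wint_integrand_ge0.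
  by rewrite lte_mul_pinfty// ?lee_fin//; exact: fy.
- move=> z; rewrite !normcM normc_real (ger0_norm (gauss_ge0 z)) mulrA.
  rewrite ler_wpM2r ?gauss_ge0// mulrCA mulrA -mulrA ler_wpM2l ?normc_ge0//.
Qed.

Lemma tame_cintegral_le f g (C a : R) : tame f -> cmeas g -> 0 <= C ->
  (forall z, normc (g z) <= C * expR (a * enorm z)) ->
  normc (cintegral (fun z => f z * g z * (gauss z)%:C)) <= 2 * C * fine (wint f a).
Proof.
move=> tf mg C0 gC; have ci := tame_cintegrable tf mg C0 gC.
have [mf fy] := tf.
rewrite -lee_fin (le_trans (normc_cintegral ci))// -mulrA EFinM lee_pmul2l//.
rewrite EFinM -wint_fine// -nintZ ?lee_fin//; last 2 first.
- exact: (rmeas_emeas (rmeas_wint a mf)).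
- exact: wint_integrand_ge0.
apply: le_nint.
- by apply: emeas_normc; case: ci.
- exact: (rmeas_emeas (rmeasM (rmeas_cst C) (rmeas_wint a mf))).
- by move=> z; rewrite lee_fin normc_ge0.
- move=> z; rewrite -EFinM lee_fin !normcM normc_real (ger0_norm (gauss_ge0 z)) mulrA.
  rewrite ler_wpM2r ?gauss_ge0// mulrCA mulrA -mulrA ler_wpM2l ?normc_ge0//.
Qed.

Lemma cmeas_rkernel w : cmeas (fun z => rkernel z w).
Proof. by apply: cmeas_cexp; exact: cmeas_dotcr. Qed.

Lemma normc_rkernel z w : normc (rkernel z w) = expR (complex.Re (dotc z w)).
Proof. by rewrite normc_cexp. Qed.

Lemma rkernel_le z w : normc (rkernel z w) <= 1 * expR (enorm w * enorm z).
Proof. by rewrite mul1r normc_rkernel ler_expR mulrC Re_dotc_le. Qed.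

Lemma tame_mul f g (C a : R) : tame f -> cmeas g -> 0 <= C ->
  (forall z, normc (g z) <= C * expR (a * enorm z)) -> tame (fun z => f z * g z).
Proof.
move=> tf mg C0 gC; have [mf fy] := tf; split; first exact: cmeasM.
move=> b; have me : cmeas (fun z => g z * (expR (b * enorm z))%:C).
  exact: (cmeasM mg (cmeas_real (rmeas_expenorm b))).
have := @tame_cintegrable f (fun z => g z * (expR (b * enorm z))%:C) C (a + b) tf me C0.
case => [z|_].
  rewrite normcM normc_real (ger0_norm (expR_ge0 _)) mulrDl expRD mulrA.
  by rewrite ler_wpM2r ?expR_ge0.
congr (_ < _)%E; apply: eq_nint => z.
by rewrite !normcM !normc_real !(ger0_norm (expR_ge0 _)) mulrA.
Qed.

Lemma tame_shift f w : tame f -> tame (fun z => f (z + w)).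
Proof.
move=> [mf fy]; split; first exact: cmeas_shift.
move=> a.
have mS := rmeas_wint (`|a| + 2 * enorm w) mf.
apply: (@le_lt_trans _ _ (nint (fun z => (expR (`|a| * enorm w + enorm w ^+ 2))%:E *
   (normc (f (z + w)) * expR ((`|a| + 2 * enorm w) * enorm (z + w)) * gauss (z + w))%:E)%E)).
  apply: le_nint.
  - exact: (rmeas_emeas (rmeas_wint a (cmeas_shift w mf))).
  - exact: (rmeas_emeas (rmeasM (rmeas_cst _) (rmeas_shift w mS))).
  - move=> z; exact: (wint_integrand_ge0 (fun z => f (z + w))).
  move=> z; rewrite -EFinM lee_fin.
  rewrite [leRHS](_ : _ = normc (f (z + w)) * (expR (`|a| * enorm w + enorm w ^+ 2) *
    (expR ((`|a| + 2 * enorm w) * enorm (z + w)) * gauss (z + w)))); last by ring.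
  rewrite -mulrA ler_wpM2l ?normc_ge0// /gauss -!expRD ler_expR.
  have e1 : enorm z <= enorm (z + w) + enorm w.
    by rewrite -{1}(addrK w z) enormB.
  have e2 : enorm (z + w) <= enorm z + enorm w := enormD z w.
  have a1 : a * enorm z <= `|a| * enorm (z + w) + `|a| * enorm w.
    rewrite -mulrDr (le_trans (y := `|a| * enorm z))//.
      by rewrite ler_wpM2r ?enorm_ge0// ler_norm.
    by rewrite ler_wpM2l.
  have := enorm_ge0 z; have := enorm_ge0 w; have := enorm_ge0 (z + w).
  move: a1 e1 e2; move: (enorm z) (enorm w) (enorm (z + w)) => x y s a1 e1 e2 s0 y0 x0.
  nra.
rewrite nintZ ?lee_fin ?expR_ge0//.
- rewrite (nint_shift w (rmeas_emeas mS) (wint_integrand_ge0 f _)).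
  by rewrite lte_mul_pinfty// ?lee_fin ?expR_ge0//; exact: fy.
- exact: (rmeas_emeas (rmeas_shift w mS)).
- by move=> z; exact: (wint_integrand_ge0 f _ (z + w)).
Qed.

(** Average the mean value property on circles over the Gaussian, which is
    invariant under [z |-> e^{it} z]. *)
Lemma entire_mean_value f : entire f -> tame f ->
  cintegral (fun z => f z * (gauss z)%:C) = f 0.
Proof.
move=> ef [mf fy].
have circ z : has_circle_mean (fun t => complex.Re (f (cis t *: z))) (complex.Re (f 0)) /\
    has_circle_mean (fun t => complex.Im (f (cis t *: z))) (complex.Im (f 0)).
  have := circle_mean (entire_cdiff 0 z ef).
  rewrite scale0r addr0.
  by under [fun t => complex.Re _]funext do rewrite add0r;
     under [fun t => complex.Im _]funext do rewrite add0r.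
have ub (u : R[i] -> R) : (forall c, `|u c| <= normc c) -> rmeas (fun z => u (f z)) ->
    (nint (fun z => (`|u (f z)| * gauss z)%:E) < +oo)%E.
  move=> ule mu; apply: le_lt_trans (fy 0); apply: le_nint.
  - apply: rmeas_emeas; apply: rmeasM rmeas_gauss.
    by apply: (measurableT_comp _ mu).
  - exact: (rmeas_emeas (rmeas_wint 0 mf)).
  - by move=> z; rewrite lee_fin mulr_ge0 ?gauss_ge0.
  - by move=> z; rewrite lee_fin mul0r expR0 mulr1 ler_wpM2r ?gauss_ge0.
have [mr mi] := mf.
apply: complex_eq => /=.
  have := gauss_mean_value mr (ub _ (@Re_le_normc R) mr) (fun z => (circ z).1).
  by move=> <-; apply: eq_Rintegral => x _; rewrite mulrC Re_realM mulrC.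
have := gauss_mean_value mi (ub _ (@Im_le_normc R) mi) (fun z => (circ z).2).
by move=> <-; apply: eq_Rintegral => x _; rewrite mulrC Im_realM mulrC.
Qed.

(** The orthogonal projection of [L^2(e^{-|z|^2} dv)] onto [F^2], as an integral
    operator on all tame functions. *)
Definition transform f w := cintegral (fun z => f z * rkernel z w * (gauss z)%:C).

(** The mean value property of [u |-> f (u + w) exp (- <w, u>)], translated. *)
Lemma reproducing f w : entire f -> tame f -> transform f w = f w.
Proof.
move=> ef tf; pose g u := f (u + w) * cexp (dotc (- w) u).
have eg : entire g by apply: entireM; [exact: entire_shift|exact: entire_rkernel].
have tg : tame g.
  apply: (tame_mul (C := 1) (a := enorm w)) => //; first exact: tame_shift.
    by apply: cmeas_cexp; exact: cmeas_dotcl.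
  move=> z; rewrite mul1r normc_cexp ler_expR.
  by rewrite -(enormN w) Re_dotc_le.
have := entire_mean_value eg tg; rewrite /g add0r dotc0r cexp0 mulr1 => <-.
have [mf fy] := tf.
rewrite /transform -[LHS](cintegral_shift w); last first.
  exact: (cmeasM (cmeasM mf (cmeas_rkernel w)) (cmeas_real rmeas_gauss)).
apply: eq_cintegral => z; rewrite -!(mulrA (f _)); congr (_ * _).
rewrite /rkernel /gauss -!cexp_real -!cexpD; congr cexp.
rewrite enormD_sq dotcDl dotcNl dotcc.
have -> : dotc w z = (2 * complex.Re (dotc z w))%:C - dotc z w.
  rewrite -dotcC; case: (dotc z w) => x y; apply: complex_eq.
    by rewrite ReD Re_conj ReN/=; ring.
  by rewrite ImD Im_conj ImN/=; ring.
apply: complex_eq; rewrite !(ReD, ReN, ImD, ImN)/=; ring.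
Qed.


Lemma transform_tail f w N : tame f ->
  normc (transform f w -
    cintegral (fun z => f z * cexp_trunc N (dotc z w) * (gauss z)%:C)) <=
  2 * 2^-1 ^+ N * fine (wint f (5 * enorm w)).
Proof.
move=> tf; have mt : cmeas (fun z => cexp_trunc N (dotc z w)).
  apply: cmeas_sum => m; apply: cmeasM; first exact: cmeas_cst.
  by apply: cmeasX; exact: cmeas_dotcr.
have g0 : 0 <= 2^-1 ^+ N :> R by rewrite exprn_ge0.
have cK := tame_cintegrable tf (cmeas_rkernel w) ler01 (fun z => rkernel_le z w).
have rle z : normc (rkernel z w - cexp_trunc N (dotc z w)) <=
    2^-1 ^+ N * expR (5 * enorm w * enorm z).
  rewrite (le_trans (cexp_trunc_geo _ _))// ler_wpM2l// ler_expR -mulrA ler_wpM2l//.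
  by rewrite mulrC normc_dotc.
have mr : cmeas (fun z => rkernel z w - cexp_trunc N (dotc z w)).
  exact: (cmeasB (cmeas_rkernel w) mt).
have cr := tame_cintegrable tf mr g0 rle.
rewrite (_ : _ - _ = cintegral (fun z =>
    f z * (rkernel z w - cexp_trunc N (dotc z w)) * (gauss z)%:C)).
  exact: tame_cintegral_le.
have ct : cintegrable (fun z => f z * cexp_trunc N (dotc z w) * (gauss z)%:C).
  have := cintegrableB cK cr; congr cintegrable; apply/funext => z; ring.
by rewrite -cintegralB//; apply: eq_cintegral => z; ring.
Qed.

Lemma tame_conj_coord f j : tame f -> tame (fun z => f z * (z 0 j)^*).
Proof.
move=> tf; apply: (tame_mul (C := 1) (a := 1)) => //.
  by apply: cmeas_conj; exact: cmeas_coord.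
move=> z; rewrite mul1r mul1r normc_conj (le_trans (normc_le_enorm z j))//.
by rewrite (le_trans _ (expR_ge1Dx _))// lerDr.
Qed.

Lemma transform_taylor f w h : tame f -> enorm h <= 1 ->
  normc (transform f (w + h) - transform f w -
    \sum_j transform (fun z => f z * (z 0 j)^*) w * h 0 j) <=
  8 * fine (wint f (enorm w + 2)) * enorm h ^+ 2.
Proof.
move=> tf h1; have K v := tame_cintegrable tf (cmeas_rkernel v) ler01 (fun z => rkernel_le z v).
have cj j := tame_cintegrable (tame_conj_coord j tf) (cmeas_rkernel w) ler01
  (fun z => rkernel_le z w).
pose g z := rkernel z w * (cexp (dotc z h) - 1 - dotc z h).
have gE : transform f (w + h) - transform f w -
    \sum_j transform (fun z => f z * (z 0 j)^*) w * h 0 j =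
    cintegral (fun z => f z * g z * (gauss z)%:C).
  have cjh j : cintegrable (fun z => h 0 j * (f z * (z 0 j)^* * rkernel z w * (gauss z)%:C)).
    exact: cintegrableZ.
  under eq_bigr => j _.
    rewrite mulrC /transform -cintegralZ//; over.
  rewrite -cintegral_sum// /transform -!cintegralB//; last 2 first.
  - exact: cintegrableB.
  - exact: cintegrable_sum.
  apply: eq_cintegral => z; rewrite /g /rkernel dotcDr cexpD.
  have -> : \sum_j h 0 j * (f z * (z 0 j)^* * cexp (dotc z w) * (gauss z)%:C) =
     f z * cexp (dotc z w) * (gauss z)%:C * dotc z h.
    by rewrite /dotc mulr_sumr; apply: eq_bigr => j _; ring.
  by ring.
rewrite gE.
have h0 := enorm_ge0 h.
have -> : 8 * fine (wint f (enorm w + 2)) * enorm h ^+ 2 =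
  2 * (4 * enorm h ^+ 2) * fine (wint f (enorm w + 2)) by ring.
apply: tame_cintegral_le => //.
- apply: cmeasM; first exact: cmeas_rkernel.
  apply: cmeasB; last exact: cmeas_dotcr.
  by apply: cmeasB; [apply: cmeas_cexp; exact: cmeas_dotcr|exact: cmeas_cst].
- by rewrite mulr_ge0// sqr_ge0.
move=> z; rewrite /g normcM.
have z0 := enorm_ge0 z.
have q : normc (cexp (dotc z h) - 1 - dotc z h) <=
    2 * (enorm z * enorm h) ^+ 2 * expR (enorm z).
  have := cexp_trunc_le 2 (dotc z h).
  rewrite /cexp_trunc 2!big_ord_recl big_ord0/= !expr0 expr1 addr0 mulr1.
  rewrite invr1 !mul1r opprD addrA => /le_trans; apply.
  have d1 : normc (dotc z h) <= enorm z * enorm h := normc_dotc z h.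
  have d0 := normc_ge0 (dotc z h).
  apply: ler_pM; rewrite ?expR_ge0// ?divr_ge0 ?exprn_ge0 ?mulr_ge0//.
    rewrite (_ : 2`!%:R = 2 :> R)// exprMn.
    rewrite [leLHS](_ : _ = 2 * normc (dotc z h) ^+ 2); last by field.
    by rewrite ler_wpM2l// ler_pXn2r// nnegrE ?mulr_ge0.
  by rewrite ler_expR (le_trans d1)// ler_piMr.
have e2 : enorm z ^+ 2 <= 2 * expR (enorm z).
  have := exp_term_le 2 z0; rewrite (_ : 2`! = 2%N)// => e2.
  by rewrite mulrC -ler_pdivrMr.
rewrite (le_trans (ler_pM (normc_ge0 _) (normc_ge0 _) (rkernel_le z w) q))//.
have -> : expR ((enorm w + 2) * enorm z) =
    expR (enorm w * enorm z) * (expR (enorm z) * expR (enorm z)).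
  by rewrite -!expRD; congr expR; ring.
rewrite mul1r exprMn.
rewrite [leLHS](_ : _ = expR (enorm w * enorm z) * expR (enorm z) * (2 * enorm h ^+ 2) *
   enorm z ^+ 2); last by ring.
rewrite [leRHS](_ : _ = expR (enorm w * enorm z) * expR (enorm z) * (2 * enorm h ^+ 2) *
   (2 * expR (enorm z))); last by ring.
by rewrite ler_wpM2l// !mulr_ge0 ?expR_ge0// sqr_ge0.
Qed.

(** Differentiation under the integral sign, quantified by the previous lemma. *)
Lemma entire_transform f : tame f -> entire (transform f).
Proof.
move=> tf; apply: edifferentiable_entire => w.
exists (fun j => transform (fun z => f z * (z 0 j)^*) w) => e e0.
set B := 8 * fine (wint f (enorm w + 2)).
have B0 : 0 <= B by rewrite mulr_ge0// fine_ge0// wint_ge0.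
have B1 : 0 < B + 1 by rewrite ltr_wpDl.
exists (Num.min 1 (e / (B + 1))); first by rewrite lt_min ltr01 divr_gt0.
move=> h; rewrite lt_min => /andP[h1 he].
rewrite (le_trans (transform_taylor w tf (ltW h1)))// -/B expr2 mulrA.
rewrite ler_wpM2r ?enorm_ge0// (le_trans (y := (B + 1) * enorm h))//.
  by rewrite ler_wpM2r ?enorm_ge0// lerDl.
by rewrite mulrC -ler_pdivlMr// ltW.
Qed.

End fixed_dimension.
End gaussian_transform.

(** * Null sequences and a quantitative identity theorem *)

Section null_sequences.
Context {R : realType}.
Implicit Types u v : nat -> R.

(** For nonnegative sequences, convergence to 0. *)
Definition null_seq u := forall e : R, 0 < e -> exists K, forall k, (K <= k)%N -> u k <= e.

Lemma null_seqD u v : null_seq u -> null_seq v -> null_seq (fun k => u k + v k).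
Proof.
move=> hu hv e e0; have e2 : 0 < e / 2 by rewrite divr_gt0.
have [K1 H1] := hu _ e2; have [K2 H2] := hv _ e2.
exists (maxn K1 K2) => k; rewrite geq_max => /andP[k1 k2].
by rewrite [leRHS](splitr e) lerD ?H1 ?H2.
Qed.

Lemma null_seqZ c u : 0 <= c -> null_seq u -> null_seq (fun k => c * u k).
Proof.
move=> c0 hu e e0; have c1 : 0 < c + 1 by rewrite ltr_wpDl.
have [K H] := hu _ (divr_gt0 e0 c1).
exists K => k /H h; rewrite (le_trans (ler_wpM2l c0 h))//.
by rewrite mulrCA -[leRHS]mulr1 ler_pM2l// ler_pdivrMr// mul1r lerDl.
Qed.

Lemma le_null_seq u v : (forall k, u k <= v k) -> null_seq v -> null_seq u.
Proof.
by move=> uv hv e e0; have [K H] := hv _ e0; exists K => k /H; exact: le_trans.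
Qed.

Lemma null_seq0 : null_seq (fun=> 0).
Proof. by move=> e e0; exists 0%N => k _; exact: ltW. Qed.

Lemma null_seq_sum (I : Type) (s : seq I) (F : I -> nat -> R) :
  (forall i, null_seq (F i)) -> null_seq (fun k => \sum_(i <- s) F i k).
Proof.
move=> h; elim: s => [|i s IH].
  by under [X in null_seq X]funext do rewrite big_nil; exact: null_seq0.
by under [X in null_seq X]funext do rewrite big_cons; exact: (null_seqD (h i) IH).
Qed.

Lemma null_seq_approx u :
  (forall e, 0 < e -> exists2 v, null_seq v & forall k, u k <= v k + e) -> null_seq u.
Proof.
move=> h e e0; have e2 : 0 < e / 2 by rewrite divr_gt0.
have [v hv uv] := h _ e2; have [K H] := hv _ e2.
by exists K => k kK; rewrite (le_trans (uv k))// [leRHS](splitr e) lerD2r H.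
Qed.

Lemma half_pow_null (c : R) : 0 <= c -> null_seq (fun k => c * 2^-1 ^+ k).
Proof.
move=> c0 e e0; pose K := (Num.truncn (c / e)).+1.
exists K => k Kk; rewrite exprVn ler_pdivrMr ?exprn_gt0// mulrC -ler_pdivrMr//.
rewrite (le_trans (ltW (truncnS_gt _)))// -natrX ler_nat.
by rewrite (leq_trans Kk)// ltnW// ltn_expl.
Qed.

Lemma null_seq_cvg u : (forall k, 0 <= u k) -> null_seq u -> u @ \oo --> 0.
Proof.
move=> u0 hu; apply/cvgrPdist_le => e e0; have [K H] := hu e e0.
by exists K => // k /= Kk; rewrite sub0r normrN ger0_norm// H.
Qed.

Lemma cmeas_limit n (f : nat -> 'rV[R[i]]_n -> R[i]) g : (forall k, cmeas (f k)) ->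
  (forall z, null_seq (fun k => normc (f k z - g z))) -> cmeas g.
Proof.
move=> mf fg.
have lim (h : R[i] -> R) z : (forall a b, h (a - b) = h a - h b) ->
    (forall a, `|h a| <= normc a) -> (fun k => h (f k z)) @ \oo --> h (g z).
  move=> hB hn; apply/cvgrPdist_le => e e0; have [K HK] := fg z e e0.
  by exists K => // k /= Kk; rewrite distrC -hB (le_trans (hn _))// HK.
split.
  apply: (rmeas_cvg (f := fun k y => complex.Re (f k y))) => [k|y]; first by case: (mf k).
  by apply: lim; [move=> a b; rewrite ReD ReN|exact: Re_le_normc].
apply: (rmeas_cvg (f := fun k y => complex.Im (f k y))) => [k|y]; first by case: (mf k).
by apply: lim; [move=> a b; rewrite ImD ImN|exact: Im_le_normc].
Qed.

End null_sequences.

Section smallness_off_the_real_line.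
Context {R : realType}.
Notation C1 := 'rV[R[i]]_1.

Let Q (a : R) : R :=
  fine (nint (fun z : C1 => (expR (a * enorm z - 3 / 4 * enorm z ^+ 2))%:E)).

Let Q_ge0 a : 0 <= Q a.
Proof. by rewrite fine_ge0// nint_ge0// => z; rewrite lee_fin expR_ge0. Qed.

Let wint_quarter (f : C1 -> R[i]) (C b a : R) : cmeas f -> 0 <= C ->
  (forall z, normc (f z) <= C * expR (b * enorm z + enorm z ^+ 2 / 4)) ->
  tame f /\ fine (wint f a) <= C * Q (a + b).
Proof.
move=> mf C0 fC.
have mq c : rmeas (fun z : C1 => expR (c * enorm z - 3 / 4 * enorm z ^+ 2)).
  exact: rmeas_expR_quad.
have W c : (wint f c <= (C * Q (c + b))%:E)%E.
  rewrite EFinM /Q fineK; last first.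
    rewrite ge0_fin_numE; first by apply: nint_expR_quad; rewrite divr_gt0.
    by apply: nint_ge0 => z; rewrite lee_fin expR_ge0.
  rewrite -nintZ ?lee_fin//; last exact: (rmeas_emeas (mq _)).
  apply: le_nint.
  - exact: (rmeas_emeas (rmeas_wint c mf)).
  - exact: (rmeas_emeas (rmeasM (rmeas_cst C) (mq _))).
  - exact: wint_integrand_ge0.
  move=> z; rewrite -EFinM lee_fin.
  rewrite (_ : (c + b) * enorm z - 3 / 4 * enorm z ^+ 2 =
    (b * enorm z + enorm z ^+ 2 / 4) + c * enorm z + - enorm z ^+ 2); last by field.
  rewrite !expRD /gauss.
  rewrite [leRHS](_ : _ = C * (expR (b * enorm z) * expR (enorm z ^+ 2 / 4)) *
     expR (c * enorm z) * expR (- enorm z ^+ 2)); last by ring.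
  rewrite -(expRD (b * _)); apply: ler_wpM2r; first exact: expR_ge0.
  by apply: ler_wpM2r; [exact: expR_ge0|exact: fC].
have tf : tame f by split=> // c; rewrite (le_lt_trans (W c))// ltry.
by split=> //; rewrite -lee_fin -wint_fine.
Qed.

(** The identity theorem for [chi] vanishing on the real line, in quantitative
    form: all derivatives tend to 0 on the real line, by difference quotients,
    and [chi] is recovered from its Taylor series at 0. *)
Lemma null_seq_off_real (M : R) (chi : nat -> C1 -> R[i]) : 0 <= M ->
  (forall k, cmeas (chi k)) ->
  (forall k y, normc (chi k y) <= M * expR (enorm y ^+ 2 / 4)) ->
  (forall k y, transform (chi k) y = chi k y) ->
  (forall x : R, null_seq (fun k => normc (chi k (const_mx x%:C)))) ->
  forall y, null_seq (fun k => normc (chi k y)).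
Proof.
move=> M0 mchi chiM rep real0.
pose F m k (z : C1) := chi k z * ((z 0 0)^*) ^+ m.
have FS m k : (fun z => F m k z * (z 0 0)^*) = F m.+1 k.
  by apply/funext => z; rewrite /F exprSr mulrA.
have mF m k : cmeas (F m k).
  by apply: cmeasM => //; apply: cmeasX; apply: cmeas_conj; exact: cmeas_coord.
have Fle m k z : normc (F m k z) <= M * m`!%:R * expR (1 * enorm z + enorm z ^+ 2 / 4).
  rewrite normcM normcX normc_conj expRD mul1r.
  rewrite [leRHS](_ : _ = M * expR (enorm z ^+ 2 / 4) * (m`!%:R * expR (enorm z))); last by ring.
  apply: ler_pM; rewrite ?normc_ge0 ?exprn_ge0 ?normc_ge0//.
  rewrite mulrC -ler_pdivrMr ?ltr0n ?fact_gt0// -enorm_rV1.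
  exact: (exp_term_le m (enorm_ge0 z)).
have Mm m : 0 <= M * m`!%:R by rewrite mulr_ge0.
have tF m k : tame (F m k) by have [] := wint_quarter 0 (mF m k) (Mm m) (Fle m k).
have D0 m (x : R) : null_seq (fun k => normc (transform (F m k) (const_mx x%:C))).
  elim: m x => [|m IH] x.
    apply: le_null_seq (real0 x) => k; rewrite -rep.
    by rewrite /F; under [X in transform X _]funext do rewrite expr0 mulr1.
  pose B := 8 * (M * m`!%:R * Q (enorm (const_mx x%:C : C1) + 2 + 1)).
  have B0 : 0 <= B by rewrite mulr_ge0// mulr_ge0 ?Q_ge0.
  apply: null_seq_approx => e e0.
  have B1 : 0 < B + 1 by rewrite ltr_wpDl.
  pose t : R := Num.min 1 (e / (B + 1)).
  have t0 : 0 < t by rewrite lt_min ltr01 divr_gt0.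
  have tn : normc (t%:C) = t by rewrite normc_real ger0_norm// ltW.
  have t1 : enorm (const_mx t%:C : C1) = t by rewrite enorm_rV1 mxE tn.
  have tB : t * B <= e.
    rewrite (le_trans (y := e / (B + 1) * B))//.
      by rewrite ler_wpM2r// ge_min lexx orbT.
    by rewrite mulrAC ler_pdivrMr// ler_pM2l// lerDl.
  exists (fun k => t^-1 * (normc (transform (F m k) (const_mx (x + t)%:C)) +
                    normc (transform (F m k) (const_mx x%:C)))).
    by apply: null_seqZ; [rewrite invr_ge0 ltW|apply: null_seqD; exact: IH].
  move=> k.
  have := transform_taylor (const_mx x%:C) (tF m k) (h := const_mx t%:C).
  rewrite t1 ge_min lexx => /(_ isT).
  rewrite big_ord1 FS mxE.
  have -> : const_mx x%:C + const_mx t%:C = const_mx (x + t)%:C :> C1.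
    by apply/matrixP => i j; rewrite !mxE realcD.
  set a := transform _ _; set b := transform (F m k) _; set c := transform _ _ => H.
  have [_ Wk] := wint_quarter (enorm (const_mx x%:C : C1) + 2) (mF m k) (Mm m) (Fle m k).
  have H2 : normc (a - b - c * t%:C) <= B * t ^+ 2.
    rewrite (le_trans H)// ler_wpM2r ?sqr_ge0// ler_wpM2l//.
  have H3 : normc c * t <= normc a + normc b + B * t ^+ 2.
    rewrite -{1}tn -normcM.
    rewrite (_ : c * t%:C = (a - b) - (a - b - c * t%:C)); last by ring.
    by rewrite (le_trans (normcB _ _))// lerD// normcB.
  rewrite -(ler_pM2r t0) (le_trans H3)// mulrDl.
  rewrite (mulrC t^-1) -(mulrA _ t^-1 t) mulVf ?gt_eqF// mulr1 lerD2l expr2 mulrA.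
  by rewrite (mulrC B) ler_wpM2r// ltW.
move=> y; apply: null_seq_approx => e e0.
pose B := 2 * (M * 0`!%:R * Q (5 * enorm y + 1)).
have B0 : 0 <= B by rewrite mulr_ge0// mulr_ge0 ?Q_ge0.
have [N HN] := half_pow_null B0 e0.
have {}HN := HN N (leqnn N).
exists (fun k => \sum_(m < N) (normc (y 0 0) ^+ m / m`!%:R) *
    normc (transform (F m k) (const_mx (0 : R)%:C))).
  apply: null_seq_sum => m; apply: null_seqZ; last exact: D0.
  by rewrite divr_ge0 ?exprn_ge0 ?normc_ge0.
move=> k; have F0 : F 0%N k = chi k by apply/funext => z; rewrite /F expr0 mulr1.
have := transform_tail y N (tF 0%N k); rewrite F0 rep.
have [_] := wint_quarter (5 * enorm y) (mF 0%N k) (Mm 0%N) (Fle 0%N k).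
rewrite F0 => Wk tail.
set S := cintegral _ in tail.
have SE : S = \sum_(m < N) (m`!%:R^-1)%:C * y 0 0 ^+ m * transform (F m k) (const_mx (0 : R)%:C).
  have ci m : cintegrable (fun z => (m`!%:R^-1)%:C * y 0 0 ^+ m *
      (F m k z * rkernel z (const_mx (0 : R)%:C) * (gauss z)%:C)).
    apply: cintegrableZ.
    exact: (tame_cintegrable (tF m k) (cmeas_rkernel _) ler01 (fun z => rkernel_le z _)).
  rewrite /S; under [RHS]eq_bigr => m _.
    rewrite /transform -cintegralZ; last first.
      exact: (tame_cintegrable (tF m k) (cmeas_rkernel _) ler01 (fun z => rkernel_le z _)).
    over.
  rewrite -(cintegral_sum _ (fun m : 'I_N => ci m)); apply: eq_cintegral => z.
  rewrite /cexp_trunc mulr_sumr mulr_suml; apply: eq_bigr => m _.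
  rewrite /rkernel (_ : const_mx _ = 0); last by apply/matrixP => i j; rewrite !mxE.
  rewrite dotc0r cexp0 mulr1 /dotc big_ord1 exprMn /F; ring.
rewrite (_ : chi k y = S + (chi k y - S)); last by ring.
rewrite (le_trans (normcD _ _))// lerD//.
  rewrite SE (le_trans (normc_sum _ _ _))// ler_sum// => m _.
  rewrite !normcM normcX normc_real ger0_norm ?invr_ge0//.
  by rewrite (mulrC (m`!%:R^-1)).
rewrite (le_trans tail)// (le_trans _ HN)// /B -!mulrA ler_wpM2l// mulrC !mulrA.
by rewrite ler_wpM2r ?exprn_ge0 ?invr_ge0.
Qed.

End smallness_off_the_real_line.

(** * The norm of F^p *)

Section fock_energy.
Context {R : realType} {n : nat}.
Notation Cn := 'rV[R[i]]_n.
Implicit Types (f g : Cn -> R[i]) (z w : Cn) (p : R).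

(** The weight [e^{-|z|^2/2}] of the norm of [F^p] is built in. *)
Definition wmod f z : R := normc (f z) * expR (- (enorm z ^+ 2 / 2)).

Lemma wmod_ge0 f z : 0 <= wmod f z.
Proof. by rewrite mulr_ge0 ?normc_ge0 ?expR_ge0. Qed.

Lemma rmeas_gauss_half : rmeas (fun z : Cn => expR (- (enorm z ^+ 2 / 2))).
Proof.
apply: rmeas_expR.
under [X in rmeas X]funext do rewrite -mulN1r.
exact: (rmeasM (rmeas_cst _) (rmeasM (rmeasX 2 rmeas_enorm) (rmeas_cst _))).
Qed.

Lemma rmeas_wmod f : cmeas f -> rmeas (wmod f).
Proof. by move=> mf; exact: (rmeasM (rmeas_normc mf) rmeas_gauss_half). Qed.

Lemma wmodZ c f z : wmod (fun z => c * f z) z = normc c * wmod f z.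
Proof. by rewrite /wmod normcM mulrA. Qed.

Lemma wmodD f g z : wmod (fun z => f z + g z) z <= wmod f z + wmod g z.
Proof. by rewrite /wmod -mulrDl ler_wpM2r ?expR_ge0// normcD. Qed.

Lemma wmodB f g z : wmod (fun z => f z - g z) z <= wmod f z + wmod g z.
Proof. by rewrite /wmod -mulrDl ler_wpM2r ?expR_ge0// normcB. Qed.

(** The [p]-th power of the norm of [F^p]. *)
Definition energy p f : \bar R := nint (fun z => (wmod f z `^ p)%:E).

Lemma wmod_powE_ge0 p f z : (0 <= (wmod f z `^ p)%:E)%E.
Proof. by rewrite lee_fin powR_ge0. Qed.

Lemma energy_ge0 p f : (0 <= energy p f)%E.
Proof. by apply: nint_ge0; exact: wmod_powE_ge0. Qed.

Lemma emeas_energy p f : cmeas f -> emeas (fun z => (wmod f z `^ p)%:E).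
Proof. by move=> mf; exact: (rmeas_emeas (rmeas_powR p (rmeas_wmod mf))). Qed.

Lemma le_powR p (a b : R) : 0 <= p -> 0 <= a -> a <= b -> a `^ p <= b `^ p.
Proof. by move=> p0 a0 ab; rewrite ge0_ler_powR// nnegrE// (le_trans a0). Qed.

Lemma powRD_le p (a b : R) : 0 <= p -> 0 <= a -> 0 <= b ->
  (a + b) `^ p <= 2 `^ p * (a `^ p + b `^ p).
Proof.
move=> p0; wlog ab : a b / a <= b.
  move=> H a0 b0; have [/H|/ltW /H h] := leP a b; first exact.
  by rewrite addrC (addrC (a `^ p)) h.
move=> a0 b0; rewrite (@le_trans _ _ ((2 * b) `^ p))//.
  by rewrite ge0_ler_powR ?nnegrE ?addr_ge0 ?mulr_ge0// mulr_natl mulr2n lerD2r.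
by rewrite powRM// ler_wpM2l ?powR_ge0// lerDr powR_ge0.
Qed.

Lemma powRD4_le p (a b c d : R) : 0 <= p -> 0 <= a -> 0 <= b -> 0 <= c -> 0 <= d ->
  (a + b + c + d) `^ p <= 4 `^ p * (a `^ p + b `^ p + c `^ p + d `^ p).
Proof.
move=> p0 a0 b0 c0 d0; rewrite -(addrA (a + b)).
rewrite (le_trans (powRD_le p0 (addr_ge0 a0 b0) (addr_ge0 c0 d0)))//.
have -> : 4 `^ p = 2 `^ p * 2 `^ p by rewrite -powRM// -natrM.
rewrite -(mulrA (2 `^ p)) ler_wpM2l ?powR_ge0// -(addrA (a `^ p + b `^ p)) mulrDr.
by rewrite lerD// powRD_le.
Qed.

Lemma le_energy p f g : 0 <= p -> cmeas f -> cmeas g ->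
  (forall z, wmod f z <= wmod g z) -> (energy p f <= energy p g)%E.
Proof.
move=> p0 mf mg fg; apply: le_nint.
- exact: emeas_energy.
- exact: emeas_energy.
- exact: wmod_powE_ge0.
- by move=> z; rewrite lee_fin ge0_ler_powR ?nnegrE ?wmod_ge0.
Qed.

Lemma energyZ p c f : cmeas f ->
  energy p (fun z => c * f z) = ((normc c `^ p)%:E * energy p f)%E.
Proof.
move=> mf; rewrite /energy -nintZ ?lee_fin ?powR_ge0//; last 2 first.
- exact: emeas_energy.
- exact: wmod_powE_ge0.
by apply: eq_nint => z; rewrite -EFinM wmodZ powRM ?normc_ge0 ?wmod_ge0.
Qed.

Lemma energyD_le p f g h : 0 <= p -> cmeas f -> cmeas g -> cmeas h ->
  (forall z, wmod h z <= wmod f z + wmod g z) ->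
  (energy p h <= (2 `^ p)%:E * (energy p f + energy p g))%E.
Proof.
move=> p0 mf mg mh hfg; rewrite /energy -nintD; [|exact: emeas_energy|exact: emeas_energy
  |exact: wmod_powE_ge0|exact: wmod_powE_ge0].
have ms := rmeasD (rmeas_powR p (rmeas_wmod mf)) (rmeas_powR p (rmeas_wmod mg)).
rewrite -nintZ ?lee_fin ?powR_ge0//; last 2 first.
- exact: (rmeas_emeas ms).
- by move=> z; rewrite lee_fin addr_ge0 ?powR_ge0.
apply: le_nint.
- exact: emeas_energy.
- exact: (rmeas_emeas (rmeasM (rmeas_cst (2 `^ p)) ms)).
- exact: wmod_powE_ge0.
move=> z; rewrite -EFinD -EFinM lee_fin (le_trans _ (powRD_le _ _ _)) ?wmod_ge0//.
by rewrite ge0_ler_powR ?nnegrE ?addr_ge0 ?wmod_ge0.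
Qed.

Lemma fock_normE p f : 0 < p -> fock_norm p%:E f = (energy p f `^ p^-1)%E.
Proof.
move=> p0; rewrite /fock_norm unlock; apply: (congr1 (fun x => (x `^ p^-1)%E)).
apply: eq_integral => x _.
by rewrite /= ger0_norm// mulr_ge0 ?normc_ge0 ?expR_ge0.
Qed.

Lemma fock_norm_le p f (s : R) : 0 < p -> 0 <= s ->
  (fock_norm p%:E f <= s%:E)%E = (energy p f <= (s `^ p)%:E)%E.
Proof.
move=> p0 s0; rewrite fock_normE//; apply/idP/idP => h.
  rewrite -(poweR_EFin s p) -[leLHS](poweRe1 (energy_ge0 p f)).
  rewrite -(mulVf (lt0r_neq0 p0)) poweRrM gt0_ler_poweR ?(ltW p0)//.
    by rewrite in_itv/= poweR_ge0 leey.
  by rewrite in_itv/= lee_fin s0 leey.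
have sE : s%:E = (((s `^ p)%:E) `^ p^-1)%E.
  by rewrite poweR_EFin -powRrM mulfV ?gt_eqF// powRr1.
rewrite sE gt0_ler_poweR ?invr_ge0 ?(ltW p0)//.
  by rewrite in_itv/= energy_ge0 leey.
by rewrite in_itv/= lee_fin powR_ge0 leey.
Qed.

Lemma fockP p f : 0 < p -> fock p%:E f <-> entire f /\ (energy p f < +oo)%E.
Proof.
move=> p0; rewrite /fock/= fock_normE//; split=> -[ef fy]; split=> //.
  by apply: lty_poweRy fy; rewrite invr_eq0 gt_eqF.
exact: poweR_lty.
Qed.

Lemma energy_fin p f : (energy p f < +oo)%E -> energy p f = (fine (energy p f))%:E.
Proof. by move=> h; rewrite fineK// ge0_fin_numE// energy_ge0. Qed.

Lemma energy_finE p f : (energy p f < +oo)%E ->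
  exists2 e : R, 0 <= e & energy p f = e%:E.
Proof.
move=> /energy_fin h; exists (fine (energy p f)) => //.
by rewrite fine_ge0// energy_ge0.
Qed.

Lemma le_1powR p (a : R) : 1 <= p -> 0 <= a -> a <= 1 + a `^ p.
Proof.
move=> p1 a0; have [a1|a1] := leP a 1; first by rewrite (le_trans a1)// lerDl powR_ge0.
rewrite (@le_trans _ _ (a `^ p)) ?lerDr// -{1}(powRr1 a0).
by rewrite ler_powR// ltW.
Qed.

(** [a <= 1 + a^p] trades integrability of the [p]-th power for that of [wmod f]
    against a Gaussian. *)
Lemma energy_tame p f : 1 <= p -> cmeas f -> (energy p f < +oo)%E -> tame f.
Proof.
move=> p1 mf fy; split=> // a.
pose q z := expR (a * enorm z - 2^-1 * enorm z ^+ 2).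
have mq : rmeas q by exact: rmeas_expR_quad.
have mp := rmeas_powR p (rmeas_wmod mf).
pose C := expR (a ^+ 2 / (4 * 2^-1)).
apply: (@le_lt_trans _ _ (nint (fun z => (q z)%:E + C%:E * (wmod f z `^ p)%:E)%E)).
  apply: le_nint.
  - exact: (rmeas_emeas (rmeas_wint a mf)).
  - exact: (rmeas_emeas (rmeasD mq (rmeasM (rmeas_cst C) mp))).
  - exact: wint_integrand_ge0.
  move=> z; rewrite -EFinM -EFinD lee_fin.
  have -> : normc (f z) * expR (a * enorm z) * gauss z = wmod f z * q z.
    rewrite /wmod /q /gauss -!mulrA -!expRD; congr (_ * expR _); by field.
  rewrite (@le_trans _ _ ((1 + wmod f z `^ p) * q z))//.
    by rewrite ler_wpM2r ?expR_ge0// le_1powR ?wmod_ge0.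
  rewrite mulrDl mul1r lerD2l mulrC ler_wpM2r ?powR_ge0// ler_expR.
  by apply: expR_quad_le; rewrite invr_gt0.
have q0 z : (0 <= (q z)%:E)%E by rewrite lee_fin expR_ge0.
have C0 : (0 <= C%:E)%E by rewrite lee_fin expR_ge0.
have mC : emeas (fun z => C%:E * (wmod f z `^ p)%:E)%E.
  exact: (rmeas_emeas (rmeasM (rmeas_cst C) mp)).
rewrite (nintD (rmeas_emeas mq) mC q0); last first.
  by move=> z; rewrite mule_ge0// wmod_powE_ge0.
rewrite nintZ; [|exact: emeas_energy|exact: wmod_powE_ge0|exact: C0].
apply: lte_add_pinfty; first by apply: nint_expR_quad; rewrite invr_gt0.
by rewrite lte_mul_pinfty.
Qed.

Lemma fock_tame p f : 1 <= p -> fock p%:E f -> tame f.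
Proof.
move=> p1 /fockP[|ef fy]; first by rewrite (lt_le_trans _ p1).
by apply: energy_tame fy => //; exact: entire_cmeas.
Qed.

Definition ghalf z : R := expR (- (enorm z ^+ 2 / 2)).

Lemma ghalfN z w : ghalf (z - w) = ghalf (w - z).
Proof. by rewrite /ghalf enormC. Qed.

(** Passing to weighted moduli turns the kernel [e^<z,w>] into the Gaussian
    [e^{-|z-w|^2/2}]. *)
Lemma rkernel_ghalf z w :
  normc (rkernel z w) * gauss z * expR (- (enorm w ^+ 2 / 2)) =
  expR (- (enorm z ^+ 2 / 2)) * ghalf (w - z).
Proof.
rewrite normc_rkernel /gauss /ghalf -!expRD; congr expR.
by rewrite enormB_sq Re_dotcC; field.
Qed.

Lemma wmod_transform_le f w : tame f ->
  ((wmod (transform f) w)%:E <= 2%:E * nint (fun z => (wmod f z * ghalf (w - z))%:E))%E.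
Proof.
move=> tf; have K := tame_cintegrable tf (cmeas_rkernel w) ler01 (fun z => rkernel_le z w).
have := normc_cintegral K; rewrite /wmod mulrC => h.
rewrite EFinM (le_trans (lee_wpmul2l _ h)) ?lee_fin ?expR_ge0//.
rewrite muleCA lee_wpmul2l// -nintZ; last first.
- by rewrite lee_fin expR_ge0.
- exact: normcE_ge0.
- by apply: emeas_normc; case: K.
rewrite (_ : nint _ = nint (fun z => (normc (f z) * expR (- (enorm z ^+ 2 / 2)) *
  ghalf (w - z))%:E))//.
apply: eq_nint => z; rewrite -EFinM; congr EFin.
rewrite -(mulrA (normc (f z)) (expR _) (ghalf _)) -rkernel_ghalf.
rewrite (normcM (f z * rkernel z w)) (normcM (f z)) normc_real.
by rewrite (ger0_norm (gauss_ge0 z)); ring.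
Qed.

End fock_energy.

(** * Young's inequality and the projection onto F^p *)

Section young.
Context {R : realType} {n : nat}.
Notation Cn := 'rV[R[i]]_n.
Implicit Types (f g u : Cn -> R[i]) (z w : Cn).
Variable p : R.
Hypothesis p1 : 1 < p.

Let p_ge1 : 1 <= p. Proof. exact: ltW. Qed.
Let p_gt0 : 0 < p. Proof. exact: lt_trans p1. Qed.
Let p_ge0 : 0 <= p. Proof. exact: ltW. Qed.

Lemma powRD_gt0 (x a b : R) : 0 < x -> x `^ (a + b) = x `^ a * x `^ b.
Proof. by move=> x0; rewrite powRD// (gt_eqF x0) implybT. Qed.

Lemma le_powR_split (l a : R) : 0 < l -> 0 <= a -> a <= l + l `^ (1 - p) * a `^ p.
Proof.
move=> l0 a0; have /(ler_wpM2l (ltW l0)) := le_1powR p_ge1 (divr_ge0 a0 (ltW l0)).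
rewrite mulrCA mulfV ?gt_eqF// mulr1 mulrDr mulr1 => /le_trans; apply.
have li : 0 <= l^-1 by rewrite invr_ge0 ltW.
rewrite lerD2l (powRM _ a0 li) mulrCA [leRHS]mulrC ler_wpM2l ?powR_ge0//.
by rewrite -(powR_inv1 (ltW l0)) -powRrM mulN1r -{1}(powRr1 (ltW l0)) -powRD_gt0.
Qed.

(** The bound is balanced at [l = (y / m)^(1/p)]. *)
Lemma powR_le_optimize (x y m : R) : 0 < m -> 0 <= x -> 0 <= y ->
  (forall l, 0 < l -> x <= l * m + l `^ (1 - p) * y) -> x `^ p <= 2 `^ p * m `^ (p - 1) * y.
Proof.
move=> m0 x0; rewrite le_eqVlt => /predU1P[<-|y0] H.
  suff -> : x = 0 by rewrite powR0 ?gt_eqF// mulr0.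
  apply/eqP; rewrite eq_le x0 andbT; apply/ler_addgt0Pl => e e0; rewrite addr0.
  have := H (e / m) (divr_gt0 e0 m0).
  by rewrite mulr0 addr0 divfK ?gt_eqF.
pose l := (y / m) `^ p^-1.
have l0 : 0 < l by rewrite powR_gt0// divr_gt0.
have yE : y = m * l `^ p.
  by rewrite /l -powRrM mulVf ?gt_eqF// powRr1 ?divr_ge0 ?ltW// mulrCA mulfV ?gt_eqF// mulr1.
have {H} := H l l0.
have -> : l `^ (1 - p) * y = l * m.
  rewrite yE mulrCA -powRD_gt0// subrK (powRr1 (ltW l0)); exact: mulrC.
rewrite -mulr2n -(mulr_natl (l * m)) => xl.
have : x `^ p <= (2 * (l * m)) `^ p.
  by rewrite ge0_ler_powR ?nnegrE ?(le_trans x0 xl).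
have lm0 : 0 <= l * m by rewrite mulr_ge0// ltW.
move=> /le_trans; apply.
rewrite (powRM p _ lm0)// (powRM p (ltW l0) (ltW m0)) -mulrA ler_wpM2l ?powR_ge0//.
rewrite yE mulrA [leRHS]mulrC ler_wpM2l ?powR_ge0//.
by rewrite -{3}(powRr1 (ltW m0)) -powRD_gt0// subrK.
Qed.

(** Young's inequality for convolution with an even integrable kernel, from
    [a <= l + l^(1-p) a^p] by optimizing in [l]. *)
Lemma young (H k x : Cn -> R) (m : R) : rmeas H -> rmeas k -> rmeas x ->
  (forall z, 0 <= H z) -> (forall z, 0 <= k z) -> (forall z, 0 <= x z) ->
  (forall z w, k (z - w) = k (w - z)) ->
  0 < m -> (nint (fun z => (k z)%:E) <= m%:E)%E ->
  (forall w, (x w)%:E <= nint (fun z => (H z * k (w - z))%:E))%E ->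
  (nint (fun w => (x w `^ p)%:E) <=
   (2 `^ p * m `^ p)%:E * nint (fun z => (H z `^ p)%:E))%E.
Proof.
move=> mH mk mx H0 k0 x0 keven m0 km xH.
have mHp := rmeas_powR p mH.
pose Y w := nint (fun z => ((H z `^ p)%:E * (k (w - z))%:E)%E).
have Y0 w : (0 <= Y w)%E.
  by apply: nint_ge0 => z; rewrite mule_ge0 ?lee_fin ?powR_ge0.
have Hp0 z : (0 <= (H z `^ p)%:E)%E by rewrite lee_fin powR_ge0.
have kE0 z : (0 <= (k z)%:E)%E by rewrite lee_fin.
have mkw w : rmeas (fun z => k (w - z)).
  under [X in rmeas X]funext do rewrite keven.
  exact: (rmeas_shift (- w) mk).
have kint w : (nint (fun z => (k (w - z))%:E) <= m%:E)%E.
  under eq_nint do rewrite keven.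
  by rewrite (nint_shift (- w) (rmeas_emeas mk) kE0).
pose c := 2 `^ p * m `^ (p - 1).
have c0 : (0 <= c%:E)%E by rewrite lee_fin mulr_ge0 ?powR_ge0.
have ptw w : ((x w `^ p)%:E <= c%:E * Y w)%E.
  have [Yy|] := eqVneq (Y w) +oo%E.
    rewrite Yy gt0_muley ?leey// lte_fin mulr_gt0 ?powR_gt0//.
  rewrite -ltey => Yfin.
  have YE : Y w = (fine (Y w))%:E by rewrite fineK// ge0_fin_numE.
  rewrite YE -EFinM lee_fin; apply: powR_le_optimize => //; first exact: fine_ge0.
  move=> l l0; rewrite -lee_fin (le_trans (xH w))// EFinD !EFinM -YE.
  rewrite (le_trans (y := (nint (fun z => (l * k (w - z))%:E +
     (l `^ (1 - p))%:E * ((H z `^ p)%:E * (k (w - z))%:E)))%E))//.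
    apply: le_nint.
    - exact: (rmeas_emeas (rmeasM mH (mkw w))).
    - exact: (rmeas_emeas (rmeasD (rmeasM (rmeas_cst l) (mkw w))
        (rmeasM (rmeas_cst (l `^ (1 - p))) (rmeasM mHp (mkw w))))).
    - by move=> z; rewrite lee_fin mulr_ge0.
    move=> z; rewrite -!EFinM -EFinD lee_fin mulrA -mulrDl ler_wpM2r//.
    exact: le_powR_split.
  have e1 : emeas (fun z => (l * k (w - z))%:E).
    exact: (rmeas_emeas (rmeasM (rmeas_cst l) (mkw w))).
  have e2 : emeas (fun z => ((H z `^ p)%:E * (k (w - z))%:E)%E).
    exact: (rmeas_emeas (rmeasM mHp (mkw w))).
  have e3 : emeas (fun z => ((l `^ (1 - p))%:E * ((H z `^ p)%:E * (k (w - z))%:E))%E).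
    exact: (rmeas_emeas (rmeasM (rmeas_cst (l `^ (1 - p))) (rmeasM mHp (mkw w)))).
  rewrite (nintD e1 e3); last 2 first.
  - by move=> z; rewrite lee_fin mulr_ge0// ltW.
  - by move=> z; rewrite !mule_ge0// lee_fin powR_ge0.
  apply: leeD.
    under eq_nint do rewrite EFinM.
    rewrite (nintZ (rmeas_emeas (mkw w)) (fun z => kE0 _)) ?lee_fin ?(ltW l0)//.
    by rewrite lee_wpmul2l// lee_fin ltW.
  rewrite (nintZ e2); last 2 first.
  - by move=> z; rewrite mule_ge0.
  - by rewrite lee_fin powR_ge0.
  by [].
have mY2 : emeas2 (fun w z => ((H z `^ p)%:E * (k (w - z))%:E)%E).
  apply: emeas2M; first exact: (emeas2_snd (rmeas_emeas mHp)).
  exact: (emeas2_sub (rmeas_emeas mk)).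
have mY : emeas Y.
  by apply: (emeas_nint mY2) => z w; rewrite mule_ge0.
apply: (@le_trans _ _ (nint (fun w => c%:E * Y w)%E)).
  apply: le_nint.
  - exact: (rmeas_emeas (rmeas_powR p mx)).
  - by apply: measurable_funeM.
  - by move=> z; rewrite lee_fin powR_ge0.
  - exact: ptw.
rewrite (nintZ mY Y0 c0).
rewrite (nint_swap_conv (rmeas_emeas mHp) (rmeas_emeas mk) Hp0 kE0).
rewrite muleCA muleC lee_wpmul2r//; first exact: nint_ge0.
rewrite (le_trans (lee_wpmul2l c0 km))// -EFinM lee_fin /c -mulrA ler_wpM2l ?powR_ge0//.
by rewrite -{2}(powRr1 (ltW m0)) -powRD_gt0// subrK.
Qed.

Lemma rmeas_ghalf : rmeas (@ghalf R n). Proof. exact: rmeas_gauss_half. Qed.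

Lemma nint_ghalf_lty : (nint (fun z : Cn => (ghalf z)%:E) < +oo)%E.
Proof.
have h2 : 0 < 2^-1 :> R by rewrite invr_gt0.
have := @nint_expR_quad R n 0 2^-1 h2.
rewrite (eq_nint (G := fun z : Cn => (ghalf z)%:E))// => z.
by rewrite /ghalf mul0r add0r mulrC.
Qed.

(** The added 1 makes positivity immediate. *)
Definition ghalf_mass : R := fine (nint (fun z : Cn => (ghalf z)%:E)) + 1.

Lemma ghalf_mass_gt0 : 0 < ghalf_mass.
Proof.
by rewrite ltr_wpDl// fine_ge0// nint_ge0// => z; rewrite lee_fin expR_ge0.
Qed.

Lemma nint_ghalf_le : (nint (fun z : Cn => (ghalf z)%:E) <= ghalf_mass%:E)%E.
Proof.
rewrite /ghalf_mass EFinD fineK ?leeDl// ge0_fin_numE ?nint_ghalf_lty//.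
by rewrite nint_ge0// => z; rewrite lee_fin expR_ge0.
Qed.

Lemma nint_ghalf_shift_le w : (nint (fun z : Cn => (ghalf (w - z))%:E) <= ghalf_mass%:E)%E.
Proof.
under eq_nint do rewrite ghalfN.
rewrite (nint_shift (- w) (rmeas_emeas rmeas_ghalf)) ?nint_ghalf_le//.
by move=> z; rewrite lee_fin expR_ge0.
Qed.

Lemma rmeas_ghalf_shift w : rmeas (fun z : Cn => ghalf (w - z)).
Proof.
under [X in rmeas X]funext do rewrite ghalfN.
exact: (rmeas_shift (- w) rmeas_ghalf).
Qed.

Definition fock_cst : R := 2 * (ghalf_mass + 1).

Lemma fock_cst_ge0 : 0 <= fock_cst.
Proof. by rewrite mulr_ge0// addr_ge0// ltW// ghalf_mass_gt0. Qed.

(** Split [wmod u] by [a <= B + B^(1-p) a^p] under the Gaussian integral: the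
    second part costs at most [B^(1-p) B^p]. *)
Lemma wmod_transform_bound u w (B : R) : cmeas u -> 0 < B ->
  (energy p u <= (B `^ p)%:E)%E -> wmod (transform u) w <= fock_cst * B.
Proof.
move=> mu B0 uB; have uy := le_lt_trans uB (ltry _).
have tu := energy_tame p_ge1 mu uy.
rewrite -lee_fin (le_trans (wmod_transform_le w tu))//.
have mp := rmeas_powR p (rmeas_wmod mu).
rewrite /fock_cst -mulrA EFinM lee_wpmul2l//.
rewrite (le_trans (y := nint (fun z => B%:E * (ghalf (w - z))%:E +
    (B `^ (1 - p))%:E * (wmod u z `^ p)%:E)%E))//.
  apply: le_nint.
  - exact: (rmeas_emeas (rmeasM (rmeas_wmod mu) (rmeas_ghalf_shift w))).
  - exact: (rmeas_emeas (rmeasD (rmeasM (rmeas_cst B) (rmeas_ghalf_shift w))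
      (rmeasM (rmeas_cst (B `^ (1 - p))) mp))).
  - by move=> z; rewrite lee_fin mulr_ge0 ?wmod_ge0 ?expR_ge0.
  move=> z; rewrite -!EFinM -EFinD lee_fin.
  rewrite (le_trans (ler_wpM2r _ (le_powR_split B0 (wmod_ge0 u z)))) ?expR_ge0//.
  rewrite mulrDl lerD2l ler_piMr ?mulr_ge0 ?powR_ge0// -expR0 ler_expR oppr_le0.
  by rewrite divr_ge0 ?sqr_ge0.
have BE : (0 <= B%:E)%E by rewrite lee_fin ltW.
have e1 : emeas (fun z => (B%:E * (ghalf (w - z))%:E)%E).
  exact: (rmeas_emeas (rmeasM (rmeas_cst B) (rmeas_ghalf_shift w))).
have e2 : emeas (fun z => ((B `^ (1 - p))%:E * (wmod u z `^ p)%:E)%E).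
  exact: (rmeas_emeas (rmeasM (rmeas_cst (B `^ (1 - p))) mp)).
have g0 z : (0 <= (ghalf (w - z))%:E)%E by rewrite lee_fin expR_ge0.
rewrite (nintD e1 e2); last 2 first.
- by move=> z; rewrite mule_ge0.
- by move=> z; rewrite mule_ge0 ?wmod_powE_ge0// lee_fin powR_ge0.
rewrite (nintZ (rmeas_emeas (rmeas_ghalf_shift w)) g0 BE).
rewrite nintZ; [|exact: emeas_energy|exact: wmod_powE_ge0|by rewrite lee_fin powR_ge0].
rewrite mulrDl mul1r EFinD mulrC EFinM leeD ?lee_wpmul2l ?nint_ghalf_shift_le//.
rewrite (le_trans (lee_wpmul2l _ uB)) ?lee_fin ?powR_ge0//.
by rewrite -powRD_gt0// subrK (powRr1 (ltW B0)).
Qed.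

Lemma fock_bound f w (B : R) : fock p%:E f -> 0 < B ->
  (energy p f <= (B `^ p)%:E)%E -> wmod f w <= fock_cst * B.
Proof.
move=> ff B0 fB; have [ef _] := (fockP f p_gt0).1 ff.
have <- : transform f = f.
  by apply/funext => z; apply: reproducing => //; exact: fock_tame ff.
by apply: wmod_transform_bound => //; exact: entire_cmeas.
Qed.

(** After weighting, the kernel of the transform is dominated by a Gaussian
    convolution. *)
Lemma energy_transform u : cmeas u -> (energy p u < +oo)%E ->
  (energy p (transform u) <= (4 `^ p * ghalf_mass `^ p)%:E * energy p u)%E.
Proof.
move=> mu uy; have tu := energy_tame p_ge1 mu uy.
have mt := entire_cmeas (entire_transform tu).
pose x w := 2^-1 * wmod (transform u) w.
have mx : rmeas x := rmeasM (rmeas_cst _) (rmeas_wmod mt).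
have x0 w : 0 <= x w by rewrite mulr_ge0 ?wmod_ge0 ?invr_ge0.
have := young (rmeas_wmod mu) rmeas_ghalf mx (wmod_ge0 u) (fun z => expR_ge0 _) x0
  (fun z w => ghalfN z w) ghalf_mass_gt0 nint_ghalf_le.
have h w : ((x w)%:E <= nint (fun z => (wmod u z * ghalf (w - z))%:E))%E.
  rewrite /x EFinM (le_trans (lee_wpmul2l _ (wmod_transform_le w tu)))//.
  by rewrite muleA -EFinM mulVf// mul1e.
move=> /(_ h) {}h.
have -> : energy p (transform u) = ((2 `^ p)%:E * nint (fun w => (x w `^ p)%:E))%E.
  rewrite -nintZ ?lee_fin ?powR_ge0//; last 2 first.
  - exact: (rmeas_emeas (rmeas_powR p mx)).
  - by move=> w; rewrite lee_fin powR_ge0.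
  by apply: eq_nint => w; rewrite -EFinM -(powRM p _ (x0 w))// /x mulrA mulfV// mul1r.
rewrite (le_trans (lee_wpmul2l _ h)) ?lee_fin ?powR_ge0// muleA -EFinM mulrA.
by rewrite (_ : 4 = 2 * 2)%R ?powRM// -natrM.
Qed.

Lemma fock_transform u : cmeas u -> (energy p u < +oo)%E -> fock p%:E (transform u).
Proof.
move=> mu uy; apply/(fockP _ p_gt0); split.
  by apply: entire_transform; exact: energy_tame uy.
rewrite (le_lt_trans (energy_transform mu uy))// lte_mul_pinfty//.
by rewrite lee_fin mulr_ge0 ?powR_ge0.
Qed.

End young.

(** * Bounded operators on F^p and their kernels *)

Section bounded_operators.
Context {R : realType} {n : nat}.
Notation Cn := 'rV[R[i]]_n.
Implicit Types (f g u : Cn -> R[i]) (z w : Cn) (A T : (Cn -> R[i]) -> (Cn -> R[i])).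
Variable p : R.
Hypothesis p1 : 1 < p.

Let p_ge1 : 1 <= p. Proof. exact: ltW. Qed.
Let p_gt0 : 0 < p. Proof. exact: lt_trans p1. Qed.
Let p_ge0 : 0 <= p. Proof. exact: ltW. Qed.

Lemma fock_entire f : fock p%:E f -> entire f. Proof. by case. Qed.

Lemma fock_cmeas f : fock p%:E f -> cmeas f.
Proof. by move=> /fock_entire; exact: entire_cmeas. Qed.

Lemma fock_energy f : fock p%:E f -> (energy p f < +oo)%E.
Proof. by move=> /(fockP f p_gt0)[]. Qed.

Lemma fock0 : fock p%:E (fun _ : Cn => 0).
Proof.
apply/(fockP _ p_gt0); split; first exact: entire_cst.
rewrite /energy (eq_nint (G := fun=> 0%E)) => [|z].
  by rewrite /nint integral0.
by rewrite /wmod normc0 mul0r powR0 ?gt_eqF.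
Qed.

Lemma fockZ c f : fock p%:E f -> fock p%:E (fun z => c * f z).
Proof.
move=> ff; apply/(fockP _ p_gt0); split; first by apply: entireZ; exact: fock_entire.
rewrite energyZ; last exact: fock_cmeas.
by rewrite lte_mul_pinfty ?lee_fin ?powR_ge0// fock_energy.
Qed.

Lemma lty_energyD_le f g h : fock p%:E f -> fock p%:E g -> cmeas h ->
  (forall z, wmod h z <= wmod f z + wmod g z) -> (energy p h < +oo)%E.
Proof.
move=> ff fg mh hfg.
rewrite (le_lt_trans (energyD_le p_ge0 (fock_cmeas ff) (fock_cmeas fg) mh hfg))//.
rewrite (energy_fin (fock_energy ff)) (energy_fin (fock_energy fg)).
by rewrite -EFinD -EFinM ltry.
Qed.

Lemma fockD f g : fock p%:E f -> fock p%:E g -> fock p%:E (fun z => f z + g z).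
Proof.
move=> ff fg; have e := entireD (fock_entire ff) (fock_entire fg).
apply/(fockP _ p_gt0); split=> //.
by apply: (lty_energyD_le ff fg (entire_cmeas e)) => z; exact: wmodD.
Qed.

Lemma fockB f g : fock p%:E f -> fock p%:E g -> fock p%:E (fun z => f z - g z).
Proof.
move=> ff fg; have e := entireB (fock_entire ff) (fock_entire fg).
apply/(fockP _ p_gt0); split=> //.
by apply: (lty_energyD_le ff fg (entire_cmeas e)) => z; exact: wmodB.
Qed.

Lemma fock_sum (I : Type) (s : seq I) (F : I -> Cn -> R[i]) :
  (forall i, fock p%:E (F i)) -> fock p%:E (fun z => \sum_(i <- s) F i z).
Proof.
move=> mF; elim: s => [|i s IH].
  by under [X in fock _ X]funext do rewrite big_nil; exact: fock0.
by under [X in fock _ X]funext do rewrite big_cons; exact: (fockD (mF i) IH).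
Qed.

(** From the unit ball to all of [F^p] by homogeneity. *)
Lemma opnorm_energy A (s : R) : (forall f, fock p%:E f -> fock p%:E (A f)) ->
  (forall c f, fock p%:E f -> A (fun z => c * f z) = fun z => c * A f z) ->
  0 <= s -> (opnorm p%:E A <= s%:E)%E ->
  forall f, fock p%:E f -> (energy p (A f) <= (s `^ p)%:E * energy p f)%E.
Proof.
move=> fA AZ s0 As f ff.
have [a a0 aE] := energy_finE (fock_energy (fA _ ff)).
have [e e0 eE] := energy_finE (fock_energy ff).
have scal t : 0 < t -> t * e <= 1 -> t * a <= s `^ p.
  move=> t0 te; pose c : R := t `^ p^-1.
  have c0 : 0 <= c := powR_ge0 _ _.
  have cp : c `^ p = t by rewrite -powRrM mulVf ?gt_eqF// powRr1// ltW.
  have En g : cmeas g -> energy p (fun z => c%:C * g z) = (t%:E * energy p g)%E.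
    by move=> mg; rewrite energyZ// normc_real ger0_norm// cp.
  have f1 := fockZ c%:C ff.
  have : (fock_norm p%:E (A (fun z => (c%:C * f z)%R)) <= s%:E)%E.
    apply: le_trans As; apply: ereal_sup_ubound; exists (fun z => c%:C * f z) => //.
    split=> //; rewrite fock_norm_le//.
    by rewrite powR1 En ?eE ?lee_fin//; exact: fock_cmeas.
  rewrite fock_norm_le// AZ// En ?aE -?EFinM ?lee_fin//.
  by apply: fock_cmeas; exact: fA.
rewrite aE eE -EFinM lee_fin.
have sp : 0 <= s `^ p := powR_ge0 _ _.
move: e0; rewrite le_eqVlt => /predU1P[e0|e0]; last first.
  have := scal e^-1; rewrite invr_gt0 mulVf ?gt_eqF// => /(_ e0 (lexx _)).
  by rewrite mulrC ler_pdivrMr.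
rewrite -e0 mulr0; have [//|a1] := leP a 0.
have := scal ((s `^ p + 1) / a); rewrite -e0 mulr0 divfK ?gt_eqF//.
have h : 0 < (s `^ p + 1) / a by rewrite divr_gt0// ltr_wpDl.
by move=> /(_ h ler01); rewrite leNgt ltrDl ltr01.
Qed.

Section one_operator.
Variable T : (Cn -> R[i]) -> (Cn -> R[i]).
Hypothesis bT : bounded_op p%:E T.

Lemma bounded_fock f : fock p%:E f -> fock p%:E (T f).
Proof. by case: bT => + _ _; apply. Qed.

Lemma bounded_op0 : T (fun=> 0) = fun=> 0.
Proof.
case: bT => _ + _ => /(_ (-1) _ _ fock0 fock0).
under [X in T X = _]funext do rewrite mulr0 addr0.
by move=> ->; apply/funext => z; rewrite mulN1r addNr.
Qed.

Lemma bounded_opZ c f : fock p%:E f -> T (fun z => c * f z) = fun z => c * T f z.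
Proof.
move=> ff; case: bT => _ + _ => /(_ c _ _ ff fock0).
under [X in T X = _]funext do rewrite addr0.
by move=> ->; apply/funext => z; rewrite bounded_op0 addr0.
Qed.

Lemma bounded_opD f g : fock p%:E f -> fock p%:E g ->
  T (fun z => f z + g z) = fun z => T f z + T g z.
Proof.
move=> ff fg; case: bT => _ + _ => /(_ 1 _ _ ff fg).
under [X in T X = _]funext do rewrite mul1r.
by move=> ->; apply/funext => z; rewrite mul1r.
Qed.

Lemma bounded_opB f g : fock p%:E f -> fock p%:E g ->
  T (fun z => f z - g z) = fun z => T f z - T g z.
Proof.
move=> ff fg; case: bT => _ + _ => /(_ (-1) _ _ fg ff).
under [X in T X = _]funext do rewrite mulN1r addrC.
by move=> ->; apply/funext => z; rewrite mulN1r addrC.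
Qed.

Lemma bounded_op_sum (I : Type) (s : seq I) (c : I -> R[i]) (F : I -> Cn -> R[i]) :
  (forall i, fock p%:E (F i)) ->
  T (fun z => \sum_(i <- s) c i * F i z) = fun z => \sum_(i <- s) c i * T (F i) z.
Proof.
move=> mF; elim: s => [|i s IH].
  under [X in T X = _]funext do rewrite big_nil.
  by rewrite bounded_op0; apply/funext => z; rewrite big_nil.
under [X in T X = _]funext do rewrite big_cons.
rewrite bounded_opD.
- by rewrite bounded_opZ// IH; apply/funext => z; rewrite big_cons.
- exact: fockZ.
- by apply: fock_sum => j; exact: fockZ.
Qed.

Lemma bounded_op_energy : exists2 s : R, 0 < s &
  forall f, fock p%:E f -> (energy p (T f) <= (s `^ p)%:E * energy p f)%E.
Proof.
have [_ _ Ty] := bT.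
have T0 : (0 <= opnorm p%:E T)%E.
  apply: le_trans (ereal_sup_ubound _); last first.
    exists (fun=> 0) => //; split; first exact: fock0.
    rewrite fock_norm_le// /energy (eq_nint (G := fun=> 0%E)) => [|z].
      by rewrite /nint integral0 lee_fin powR_ge0.
    by rewrite /wmod normc0 mul0r powR0 ?gt_eqF.
  by rewrite fock_normE// poweR_ge0.
exists (fine (opnorm p%:E T) + 1); first by rewrite ltr_wpDl// fine_ge0.
apply: opnorm_energy => //; first exact: bounded_fock.
- exact: bounded_opZ.
- by rewrite addr_ge0// fine_ge0.
by rewrite EFinD fineK ?leeDl// ge0_fin_numE.
Qed.

Lemma bounded_op_wmod : exists2 C : R, 0 <= C & forall f (B : R) w, fock p%:E f ->
  0 < B -> (energy p f <= (B `^ p)%:E)%E -> wmod (T f) w <= C * B.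
Proof.
have [s s0 H] := bounded_op_energy.
exists (fock_cst (R := R) (n := n) * s); first by rewrite mulr_ge0 ?fock_cst_ge0// ltW.
move=> f B w ff B0 fB; rewrite -mulrA; apply: (fock_bound p1).
- exact: bounded_fock.
- exact: mulr_gt0.
rewrite (le_trans (H f ff))// (powRM p (ltW s0) (ltW B0)) EFinM lee_wpmul2l//.
by rewrite lee_fin powR_ge0.
Qed.

End one_operator.

(** Apart from the added 1, the norm of [e^{|z|^2/4}]: the weighted moduli of the
    functions below are dominated by translates of [e^{-|z|^2/4}]. *)
Definition gauss_norm : R :=
  (fine (nint (fun z : Cn => (expR (0 * enorm z - p / 4 * enorm z ^+ 2))%:E)) + 1) `^ p^-1.

Let mquarter : rmeas (fun z : Cn => expR (0 * enorm z - p / 4 * enorm z ^+ 2)).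
Proof. exact: rmeas_expR_quad. Qed.

Let quarter_ge0 (z : Cn) : (0 <= (expR (0 * enorm z - p / 4 * enorm z ^+ 2))%:E)%E.
Proof. by rewrite lee_fin expR_ge0. Qed.

Lemma gauss_norm_gt0 : 0 < gauss_norm.
Proof. by rewrite powR_gt0// ltr_wpDl// fine_ge0// nint_ge0. Qed.

Lemma nint_quarter_le :
  (nint (fun z : Cn => (expR (0 * enorm z - p / 4 * enorm z ^+ 2))%:E) <=
   (gauss_norm `^ p)%:E)%E.
Proof.
rewrite /gauss_norm -powRrM mulVf ?gt_eqF// powRr1; last first.
  by rewrite addr_ge0// fine_ge0// nint_ge0.
rewrite EFinD fineK ?leeDl// ge0_fin_numE ?nint_ge0//.
by apply: nint_expR_quad; rewrite divr_gt0.
Qed.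

Lemma energy_gauss_le g (B : R) v : cmeas g -> 0 <= B ->
  (forall z, wmod g z <= B * expR (- (enorm (z - v) ^+ 2 / 4))) ->
  (energy p g <= ((B * gauss_norm) `^ p)%:E)%E.
Proof.
move=> mg B0 H.
have ms := rmeas_shift (- v) mquarter.
apply: (@le_trans _ _ (nint (fun z => (B `^ p)%:E *
    (expR (0 * enorm (z - v) - p / 4 * enorm (z - v) ^+ 2))%:E)%E)).
  apply: le_nint.
  - exact: emeas_energy.
  - exact: (rmeas_emeas (rmeasM (rmeas_cst (B `^ p)) ms)).
  - exact: wmod_powE_ge0.
  move=> z; rewrite -EFinM lee_fin.
  have -> : expR (0 * enorm (z - v) - p / 4 * enorm (z - v) ^+ 2) =
      expR (- (enorm (z - v) ^+ 2 / 4)) `^ p.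
    by rewrite -expRM; congr expR; ring.
  rewrite -(powRM p B0 (expR_ge0 _)); apply: le_powR; [exact: p_ge0|exact: wmod_ge0|exact: H].
rewrite (nintZ (rmeas_emeas ms)) => [|z|]; last 2 first.
- exact: (quarter_ge0 (z - v)).
- by rewrite lee_fin powR_ge0.
rewrite (nint_shift (- v) (rmeas_emeas mquarter) quarter_ge0).
rewrite powRM// ?(ltW gauss_norm_gt0)// EFinM lee_wpmul2l ?nint_quarter_le//.
by rewrite lee_fin powR_ge0.
Qed.

Lemma energy_exp_le g (C a : R) : cmeas g -> 0 <= C ->
  (forall z, normc (g z) <= C * expR (a * enorm z)) ->
  (energy p g <= ((C * expR (a ^+ 2) * gauss_norm) `^ p)%:E)%E.
Proof.
move=> mg C0 H; apply: (energy_gauss_le (v := 0)) => //.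
  by rewrite mulr_ge0 ?expR_ge0.
move=> z; rewrite /wmod subr0 (le_trans (ler_wpM2r (expR_ge0 _) (H z)))//.
rewrite -!mulrA ler_wpM2l// -!expRD ler_expR.
have h4 : 0 < 4^-1 :> R by rewrite invr_gt0.
by have := expR_quad_le a (enorm z) h4; lra.
Qed.

Lemma fock_exp g (C a : R) : entire g -> 0 <= C ->
  (forall z, normc (g z) <= C * expR (a * enorm z)) -> fock p%:E g.
Proof.
move=> eg C0 H; apply/(fockP _ p_gt0); split=> //.
by rewrite (le_lt_trans (energy_exp_le (entire_cmeas eg) C0 H))// ltry.
Qed.

Lemma fock_rkernel z : fock p%:E (rkernel z : Cn -> R[i]).
Proof.
apply: (@fock_exp _ 1 (enorm z) (entire_rkernel z) ler01) => w.
by rewrite mul1r normc_rkernel ler_expR Re_dotc_le.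
Qed.

Lemma wmod_rkernel z w :
  wmod (rkernel z) w = expR (enorm z ^+ 2 / 2) * expR (- (enorm (w - z) ^+ 2 / 2)).
Proof.
rewrite /wmod normc_rkernel -!expRD; congr expR.
by rewrite enormB_sq Re_dotcC; field.
Qed.

Lemma energy_rkernel z :
  (energy p (rkernel z : Cn -> R[i]) <= ((expR (enorm z ^+ 2 / 2) * gauss_norm) `^ p)%:E)%E.
Proof.
apply: (energy_gauss_le (v := z)); rewrite ?expR_ge0//.
  by apply: entire_cmeas; exact: entire_rkernel.
move=> w; rewrite wmod_rkernel ler_wpM2l ?expR_ge0// ler_expR lerN2.
by rewrite ler_wpM2l ?sqr_ge0// lef_pV2 ?posrE// ler_nat.
Qed.

(** [|K_z(w)|^2 e^{-|w|^2} = e^{|z|^2} e^{-|w-z|^2}]. *)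
Lemma fock_norm2_rkernel z : fock_norm 2%:E (rkernel z : Cn -> R[i]) =
  (expR (enorm z ^+ 2 / 2))%:E.
Proof.
rewrite fock_normE// /energy.
have -> : nint (fun w : Cn => (wmod (rkernel z) w `^ 2)%:E) = (expR (enorm z ^+ 2))%:E.
  rewrite (eq_nint (G := fun w => ((expR (enorm z ^+ 2))%:E * (gauss (w - z))%:E)%E)); last first.
    move=> w; rewrite wmod_rkernel -EFinM /gauss powR_mulrn ?mulr_ge0 ?expR_ge0//.
    by rewrite exprMn -!expRM_natl -!expRD; congr (expR _)%:E; field.
  rewrite nintZ ?lee_fin ?expR_ge0//; last 2 first.
  - exact: (rmeas_emeas (rmeas_shift (- z) rmeas_gauss)).
  - by move=> w; rewrite lee_fin expR_ge0.
  rewrite (nint_shift (- z) (rmeas_emeas rmeas_gauss)) ?nint_gauss ?mule1// => w.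
  by rewrite lee_fin expR_ge0.
by rewrite poweR_EFin -expRM.
Qed.

Lemma nkernelE z w : nkernel z w = (expR (- (enorm z ^+ 2 / 2)))%:C * rkernel z w.
Proof.
rewrite /nkernel fock_norm2_rkernel /= mulrC; congr (_ * _).
by rewrite expRN fmorphV.
Qed.

(** The reproducing formula, divided by the norm of the kernel. *)
Lemma normc_pairing f w : fock p%:E f -> normc (pairing f (nkernel w)) = wmod f w.
Proof.
move=> ff; have tf := fock_tame p_ge1 ff.
have K := tame_cintegrable tf (cmeas_rkernel w) ler01 (fun z => rkernel_le z w).
have -> : pairing f (nkernel w) =
    (expR (- (enorm w ^+ 2 / 2)))%:C * transform f w.
  rewrite /pairing /transform -(cintegralZ _ K); apply: eq_cintegral => z.
  rewrite nkernelE rmorphM /= conj_real -/(gauss z) /rkernel -cexp_conj dotcC; ring.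
rewrite reproducing//; last exact: fock_entire.
by rewrite normcM normc_real ger0_norm ?expR_ge0// mulrC.
Qed.

(** [|<T k_z, k_w>|] *)
Definition tkernel T z w : R := wmod (T (rkernel z)) w * expR (- (enorm z ^+ 2 / 2)).

Lemma tkernel_pairing T z w : bounded_op p%:E T ->
  normc (pairing (T (nkernel z)) (nkernel w)) = tkernel T z w.
Proof.
move=> bT; have fK := fock_rkernel z.
rewrite (_ : nkernel z = fun w => (expR (- (enorm z ^+ 2 / 2)))%:C * rkernel z w); last first.
  by apply/funext => v; exact: nkernelE.
rewrite bounded_opZ// normc_pairing; last by apply: fockZ; exact: bounded_fock.
by rewrite wmodZ normc_real ger0_norm ?expR_ge0// mulrC.
Qed.

Lemma tkernel_ge0 T z w : 0 <= tkernel T z w.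
Proof. by rewrite mulr_ge0 ?wmod_ge0 ?expR_ge0. Qed.

Lemma tkernel_bound T : bounded_op p%:E T ->
  exists2 C : R, 0 <= C & forall z w, tkernel T z w <= C.
Proof.
move=> bT; have [C C0 H] := bounded_op_wmod bT.
exists (C * gauss_norm); first by rewrite mulr_ge0// ltW// gauss_norm_gt0.
move=> z w; have := H _ (expR (enorm z ^+ 2 / 2) * gauss_norm) w (fock_rkernel z).
rewrite mulr_gt0 ?expR_gt0 ?gauss_norm_gt0// => /(_ isT (energy_rkernel z)) h.
rewrite /tkernel expRN ler_pdivrMr ?expR_gt0// (le_trans h)//.
by rewrite (mulrC (expR _)) mulrA.
Qed.

End bounded_operators.

(** * Cutoffs and dominated convergence *)

Section cutoffs.
Context {R : realType} {n : nat}.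
Notation Cn := 'rV[R[i]]_n.
Implicit Types (f g u : Cn -> R[i]) (z w : Cn) (b : Cn -> bool).

Definition bmeas b := rmeas (fun z => (b z)%:R : R).

Lemma bmeas_le (h : Cn -> R) (c : R) : rmeas h -> bmeas (fun z => h z <= c).
Proof.
move=> mh; pose k (x : R) : R := (x <= c)%R%:R.
have mk : measurable_fun [set: measurableTypeR R] (k : measurableTypeR R -> measurableTypeR R).
  rewrite (_ : k = \1_(`]-oo, c]%classic)); first exact: measurable_indic.
  apply/funext => x; rewrite indicE; congr (_ : bool)%:R.
  by apply/idP/idP; rewrite inE/= in_itv.
exact: (rmeas_comp mk mh).
Qed.

Lemma bmeasC b : bmeas b -> bmeas (fun z => ~~ b z).
Proof.
move=> mb; have := rmeasB (rmeas_cst 1) mb; congr rmeas; apply/funext => z.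
by case: (b z); rewrite ?subrr ?subr0.
Qed.

Definition restr b u z : R[i] := if b z then u z else 0.

Lemma cmeas_restr b u : bmeas b -> cmeas u -> cmeas (restr b u).
Proof.
move=> mb mu; have := cmeasM (cmeas_real mb) mu; congr cmeas; apply/funext => z.
by rewrite /restr; case: (b z); rewrite ?mul1r ?mul0r.
Qed.

Lemma wmod_restr b u z : wmod (restr b u) z = (b z)%:R * wmod u z.
Proof.
by rewrite /wmod /restr; case: (b z); rewrite ?mul1r ?mul0r// normc0 mul0r.
Qed.

Lemma wmod_restr_le b u z : wmod (restr b u) z <= wmod u z.
Proof.
by rewrite wmod_restr; case: (b z); rewrite ?mul1r ?mul0r// wmod_ge0.
Qed.

Lemma wmod_restr_pow (p : R) b u z : p != 0 ->
  wmod (restr b u) z `^ p = (b z)%:R * wmod u z `^ p.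
Proof.
by move=> p0; rewrite wmod_restr; case: (b z); rewrite ?mul1r ?mul0r// powR0.
Qed.

Lemma nint_null (F : nat -> Cn -> R) (G : Cn -> R) : (forall k, rmeas (F k)) ->
  rmeas G -> (nint (fun z => (G z)%:E) < +oo)%E ->
  (forall k z, 0 <= F k z <= G z) -> (forall z, null_seq (fun k => F k z)) ->
  forall e : R, 0 < e ->
  exists K, forall k, (K <= k)%N -> (nint (fun z => (F k z)%:E) <= e%:E)%E.
Proof.
move=> mF mG Gy FG F0 e e0.
have G0 z : 0 <= G z by have /andP[/le_trans] := FG 0%N z; apply.
have H1 : {ae dv n, forall x, setT x -> (F k (cvec x))%:E @[k --> \oo] --> 0%E}.
  apply/aeW => x _; apply: cvg_EFin; first by near=> k.
  apply: null_seq_cvg => [k|]; last exact: F0.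
  by have /andP[] := FG k (cvec x).
have H2 : (dv n).-integrable setT (fun x => (G (cvec x))%:E).
  apply/integrableP; split; first exact: (rmeas_emeas mG).
  by under eq_integral do rewrite /= ger0_norm//.
have H3 : {ae dv n, forall x k, setT x -> (`|(F k (cvec x))%:E| <= (G (cvec x))%:E)%E}.
  apply/aeW => x k _ /=; rewrite lee_fin.
  by have /andP[? ?] := FG k (cvec x); rewrite ger0_norm.
have [_ _] := @dominated_convergence _ _ R (dv n) setT measurableT
  (fun k x => (F k (cvec x))%:E) (fun=> 0%E) (fun x => (G (cvec x))%:E)
  (fun k => rmeas_emeas (mF k)) (measurable_cst _) H1 H2 H3.
rewrite integral0 => /fine_cvgP[[K1 _ HK1] /cvgrPdist_le/(_ e e0)[K2 _ HK2]].
exists (maxn K1 K2) => k; rewrite geq_max => /andP[k1 k2].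
have := HK2 k k2; rewrite /= sub0r normrN => /(le_trans (ler_norm _)).
by rewrite -lee_fin fineK//; exact: HK1.
Unshelve. all: end_near. Qed.

End cutoffs.

(** * Operators as integrals against their kernel *)

Section truncated_kernel.
Context {R : realType} {n : nat}.
Notation Cn := 'rV[R[i]]_n.
Implicit Types (f g u : Cn -> R[i]) (z w : Cn).

Definition conjv z : Cn := \row_j (z 0 j)^*.

(** Entire functions of exponential type with real Taylor coefficients at 0;
    only multiples of monomials occur below. *)
Definition monomial_like f := [/\ entire f, forall z, (f z)^* = f (conjv z) &
  exists2 C : R, 0 <= C & forall z, normc (f z) <= C * expR (1 * enorm z)].

Definition mono m (s : {ffun 'I_m -> 'I_n}) z : R[i] := \prod_i z 0 (s i).

Lemma dotc_pow m z w : dotc z w ^+ m = \sum_(s : {ffun 'I_m -> 'I_n}) (mono s z)^* * mono s w.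
Proof.
rewrite -[X in _ ^+ X]card_ord -prodr_const.
transitivity (\prod_(i < m) \sum_j (z 0 j)^* * w 0 j); first exact: eq_bigl.
rewrite bigA_distr_bigA; apply: eq_bigr => s _.
by rewrite big_split/= rmorph_prod.
Qed.

Lemma monomial_like_mono m (s : {ffun 'I_m -> 'I_n}) (c : R) :
  monomial_like (fun z => c%:C * mono s z).
Proof.
split.
- by apply: entireZ; apply: entire_prod => i; exact: entire_coord.
- move=> z; rewrite rmorphM/= conj_real /mono rmorph_prod; congr (_ * _).
  by apply: eq_bigr => i _; rewrite mxE.
exists (`|c| * m`!%:R) => [|z]; first by rewrite mulr_ge0.
rewrite normcM normc_real -mulrA ler_wpM2l// /mono normc_prod mul1r.
rewrite (@le_trans _ _ (enorm z ^+ m))//.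
  rewrite -[X in _ ^+ X]card_ord -prodr_const ler_prod// => i _.
  by rewrite normc_ge0 normc_le_enorm.
by rewrite mulrC -ler_pdivrMr ?ltr0n ?fact_gt0// exp_term_le ?enorm_ge0.
Qed.

(** A linear operator commutes with integration in [z] of such a finite sum
    without any continuity; the whole kernel is a limit of these. *)
Lemma cexp_trunc_separated N : exists (I : finType) (a b : I -> Cn -> R[i]),
  [/\ forall z w, cexp_trunc N (dotc z w) = \sum_i (a i z)^* * b i w,
      forall i, monomial_like (a i) & forall i, monomial_like (b i)].
Proof.
exists {m : 'I_N & {ffun 'I_m -> 'I_n}},
  (fun (i : {m : 'I_N & {ffun 'I_m -> 'I_n}}) z =>
     ((tag i)`!%:R^-1)%:C * mono (tagged i) z),
  (fun (i : {m : 'I_N & {ffun 'I_m -> 'I_n}}) z => (1 : R)%:C * mono (tagged i) z).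
split; [|by move=> i; exact: monomial_like_mono..].
move=> z w; rewrite /cexp_trunc.
under eq_bigr do rewrite dotc_pow mulr_sumr.
rewrite sig_big_dep/=; apply: eq_bigr => i _.
by rewrite rmorphM/= conj_real mul1r mulrA.
Qed.

Definition trunc_kernel N z w : R[i] := cexp_trunc N (dotc z w).

Lemma trunc_kernel_close N z w :
  normc (rkernel z w - trunc_kernel N z w) <= 2^-1 ^+ N * expR (5 * enorm z * enorm w).
Proof.
rewrite (le_trans (cexp_trunc_geo _ _))// ler_wpM2l ?exprn_ge0 ?invr_ge0//.
by rewrite ler_expR -mulrA ler_wpM2l// normc_dotc.
Qed.

Section operator.
Variable p : R.
Hypothesis p1 : 1 < p.
Variable T : (Cn -> R[i]) -> (Cn -> R[i]).
Hypothesis bT : bounded_op p%:E T.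

Lemma fock_monomial_like f : monomial_like f -> fock p%:E f.
Proof. by case=> ef _ [C C0 H]; exact: (fock_exp p1 ef C0 H). Qed.

Lemma op_trunc_separated N : exists (I : finType) (a b : I -> Cn -> R[i]),
  [/\ forall i, monomial_like (a i), forall i, fock p%:E (b i),
      forall z w, trunc_kernel N z w = \sum_i (a i z)^* * b i w &
      forall z w, T (trunc_kernel N z) w = \sum_i (a i z)^* * T (b i) w].
Proof.
have [I [a [b [E la lb]]]] := cexp_trunc_separated N; exists I, a, b.
have fb i := fock_monomial_like (lb i).
split=> // z w.
have -> : trunc_kernel N z = fun w => \sum_i (a i z)^* * b i w.
  by apply/funext => v; exact: E.
by rewrite (bounded_op_sum p1 bT).
Qed.

Lemma fock_trunc_kernel N z : fock p%:E (trunc_kernel N z).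
Proof.
have [I [a [b [_ fb E _]]]] := op_trunc_separated N.
have -> : trunc_kernel N z = fun w => \sum_i (a i z)^* * b i w.
  by apply/funext => v; exact: E.
by apply: (fock_sum p1) => i; exact: fockZ.
Qed.

Lemma op_exp_bound : exists2 D : R, 0 <= D & forall g (C a : R) w, entire g -> 0 < C ->
  (forall v, normc (g v) <= C * expR (a * enorm v)) ->
  wmod (T g) w <= D * (C * expR (a ^+ 2)).
Proof.
have [C C0 H] := bounded_op_wmod p1 bT.
exists (C * gauss_norm (n := n) p); first by rewrite mulr_ge0// ltW// gauss_norm_gt0.
move=> g c a w eg c0 gc.
have B0 : 0 < c * expR (a ^+ 2) * gauss_norm (n := n) p.
  by rewrite !mulr_gt0 ?expR_gt0 ?gauss_norm_gt0.
have := H g _ w (fock_exp p1 eg (ltW c0) gc) B0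
  (energy_exp_le p1 (entire_cmeas eg) (ltW c0) gc).
move=> /le_trans; apply; rewrite le_eqVlt; apply/orP; left; apply/eqP; ring.
Qed.

Lemma op_trunc_close : exists2 D : R, 0 <= D & forall N z w,
  wmod (fun v => T (rkernel z) v - T (trunc_kernel N z) v) w <=
  D * (2^-1 ^+ N * expR (25 * enorm z ^+ 2)).
Proof.
have [D D0 H] := op_exp_bound; exists D => // N z w.
have fr := fock_rkernel p1 z; have ft := fock_trunc_kernel N z.
have := H _ _ _ w (entireB (fock_entire fr) (fock_entire ft)) _ (trunc_kernel_close N z).
rewrite exprn_gt0 ?invr_gt0// => /(_ isT).
by rewrite (bounded_opB bT fr ft) exprMn -natrX.
Qed.

Lemma lee_half_pow (x : R) (y : \bar R) (c : R) : 0 <= c ->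
  (forall N, (x%:E <= y + (c * 2^-1 ^+ N)%:E)%E) -> (x%:E <= y)%E.
Proof.
move=> c0 H; apply/lee_addgt0Pr => e e0; have [K HK] := half_pow_null c0 e0.
by apply: le_trans (H K) _; rewrite leeD2l// lee_fin HK.
Qed.

(** [T P u], for the projection [P], as the integral of [u] against the kernel of [T]: approximate the
    reproducing kernel by the truncated ones, for which [T] passes under the
    integral sign by linearity. *)
Lemma kernel_bound_compact u (k : Cn -> R) (rho : R) w : cmeas u ->
  (energy p u < +oo)%E -> rmeas k -> (forall z, 0 <= k z) -> 0 <= rho ->
  (forall z, u z != 0 -> enorm z <= rho) ->
  (forall z, u z != 0 -> tkernel T z w <= k z) ->
  ((wmod (T (transform u)) w)%:E <= 2%:E * nint (fun z => (wmod u z * k z)%:E))%E.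
Proof.
move=> mu uy mk k0 rho0 urho uk.
have tu := energy_tame (ltW p1) mu uy.
have [D D0 HD] := op_exp_bound; have [D' D'0 HD'] := op_trunc_close.
pose W := fine (wint u 0) + 1.
have W0 : 0 < W by rewrite ltr_wpDl// fine_ge0// wint_ge0.
pose B := D' * expR (25 * rho ^+ 2).
have B0 : 0 <= B by rewrite mulr_ge0 ?expR_ge0.
pose c := D * (2 * W * expR ((5 * rho) ^+ 2)) + 2 * B * W.
have c0 : 0 <= c.
  have W2 := ltW W0.
  by rewrite addr_ge0 ?mulr_ge0 ?expR_ge0.
apply: (@lee_half_pow _ _ c) => // N.
have q0 : 0 < 2^-1 ^+ N :> R by rewrite exprn_gt0// invr_gt0.
have [I [a [b [la fb E ET]]]] := op_trunc_separated N.
have ci i : cintegrable (fun z => u z * (a i z)^* * (gauss z)%:C).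
  have [ea _ [C C0 aC]] := la i.
  apply: (tame_cintegrable tu (cmeas_conj (entire_cmeas ea)) C0 (a := 1)) => z.
  by rewrite normc_conj.
pose PN v := cintegral (fun z => u z * trunc_kernel N z v * (gauss z)%:C).
pose ca i := cintegral (fun z => u z * (a i z)^* * (gauss z)%:C).
have PNE : PN = fun v => \sum_i ca i * b i v.
  apply/funext => v; rewrite /PN /ca.
  under [RHS]eq_bigr do rewrite mulrC -cintegralZ//.
  rewrite -cintegral_sum; last by move=> i; exact: cintegrableZ.
  apply: eq_cintegral => z; rewrite E mulr_sumr mulr_suml; apply: eq_bigr => i _; ring.
have fPN : fock p%:E PN by rewrite PNE; apply: (fock_sum p1) => i; exact: fockZ.
have fP := fock_transform p1 mu uy.
have TPN v : T PN v = cintegral (fun z => u z * T (trunc_kernel N z) v * (gauss z)%:C).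
  rewrite PNE (bounded_op_sum p1 bT _ ca fb) /ca.
  under eq_bigr do rewrite mulrC -cintegralZ//.
  rewrite -cintegral_sum; last by move=> i; exact: cintegrableZ.
  apply: eq_cintegral => z; rewrite ET mulr_sumr mulr_suml; apply: eq_bigr => i _; ring.
have wu (v : Cn) : fine (wint u (5 * enorm v)) <= expR (5 * rho * enorm v) * W.
  apply: (@le_trans _ _ (expR (5 * rho * enorm v) * fine (wint u 0))); last first.
    by rewrite ler_wpM2l ?expR_ge0// lerDl.
  rewrite -lee_fin EFinM -(wint_fine (5 * enorm v) tu) -(wint_fine 0 tu).
  have ee : (0 <= (expR (5 * rho * enorm v))%:E)%E by rewrite lee_fin expR_ge0.
  rewrite -(nintZ (rmeas_emeas (rmeas_wint 0 mu)) (wint_integrand_ge0 u 0) ee).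
  apply: le_nint.
  - exact: (rmeas_emeas (rmeas_wint _ mu)).
  - exact: (rmeas_emeas (rmeasM (rmeas_cst _) (rmeas_wint 0 mu))).
  - exact: wint_integrand_ge0.
  move=> z; rewrite -EFinM lee_fin mul0r expR0 mulr1 mulrA ler_wpM2r ?gauss_ge0//.
  have [->|uz] := eqVneq (u z) 0; first by rewrite normc0 mulr0 mul0r.
  rewrite mulrC ler_wpM2r ?normc_ge0// ler_expR mulrAC ler_wpM2r ?enorm_ge0//.
  by rewrite ler_wpM2l// urho.
have step1 : wmod (fun v => T (transform u) v - T PN v) w <=
    D * (2 * W * expR ((5 * rho) ^+ 2)) * 2^-1 ^+ N.
  rewrite -(bounded_opB bT fP fPN).
  have := HD _ (2 * 2^-1 ^+ N * W) (5 * rho) w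
    (entireB (fock_entire fP) (fock_entire fPN)).
  rewrite !mulr_gt0// => /(_ isT) h.
  rewrite (le_trans (h _)) => [//|v|]; last by rewrite le_eqVlt; apply/orP; left; apply/eqP; ring.
  apply: (le_trans (transform_tail v N tu)).
  have -> : 2 * 2^-1 ^+ N * W * expR (5 * rho * enorm v) =
    2 * 2^-1 ^+ N * (expR (5 * rho * enorm v) * W) by ring.
  by apply: ler_wpM2l; [rewrite mulr_ge0// ltW|exact: wu].
have mc : cmeas (fun z => u z * T (trunc_kernel N z) w * (gauss z)%:C).
  apply: (cmeasM (cmeasM mu _) (cmeas_real rmeas_gauss)).
  under [X in cmeas X]funext do rewrite ET.
  apply: cmeas_sum => i; apply: cmeasM; last exact: cmeas_cst.
  by apply: cmeas_conj; apply: entire_cmeas; case: (la i).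
have cT : cintegrable (fun z => u z * T (trunc_kernel N z) w * (gauss z)%:C).
  have := @cintegrable_sum _ _ _ (index_enum I)
    (fun i z => T (b i) w * (u z * (a i z)^* * (gauss z)%:C)) (fun i => cintegrableZ _ (ci i)).
  congr cintegrable; apply/funext => z; rewrite ET mulr_sumr mulr_suml.
  by apply: eq_bigr => i _; ring.
have step2 : ((wmod (T PN) w)%:E <= 2%:E * (nint (fun z => (wmod u z * k z)%:E) +
    (B * 2^-1 ^+ N * W)%:E))%E.
  rewrite /wmod TPN mulrC EFinM.
  rewrite (le_trans (lee_wpmul2l _ (normc_cintegral cT))) ?lee_fin ?expR_ge0//.
  rewrite muleCA lee_wpmul2l// -nintZ; last first.
  - by rewrite lee_fin expR_ge0.
  - exact: normcE_ge0.
  - exact: emeas_normc.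
  have e1 := rmeas_emeas (rmeasM (rmeas_wmod mu) mk).
  have e2 := rmeas_emeas (rmeas_wint 0 mu).
  have e3 : emeas (fun z => ((B * 2^-1 ^+ N)%:E *
     (normc (u z) * expR (0 * enorm z) * gauss z)%:E)%E).
    exact: (rmeas_emeas (rmeasM (rmeas_cst (B * 2^-1 ^+ N)) (rmeas_wint 0 mu))).
  have Bq : (0 <= (B * 2^-1 ^+ N)%:E)%E by rewrite lee_fin mulr_ge0// ltW.
  apply: (@le_trans _ _ (nint (fun z => (wmod u z * k z)%:E + (B * 2^-1 ^+ N)%:E *
     (normc (u z) * expR (0 * enorm z) * gauss z)%:E)%E)); last first.
    rewrite (nintD e1 e3); last 2 first.
    - by move=> z; rewrite lee_fin mulr_ge0 ?wmod_ge0.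
    - by move=> z; rewrite mule_ge0// wint_integrand_ge0.
    apply: leeD2l; rewrite (nintZ e2 (wint_integrand_ge0 u 0) Bq).
    rewrite [X in (_ <= X)%E](EFinM (B * 2^-1 ^+ N) W); apply: (lee_wpmul2l Bq).
    by rewrite -/(wint u 0) (wint_fine 0 tu) lee_fin lerDl.
  apply: le_nint.
  - exact: (rmeas_emeas (rmeasM (rmeas_cst _) (rmeas_normc mc))).
  - exact: (rmeas_emeas (rmeasD (rmeasM (rmeas_wmod mu) mk)
      (rmeasM (rmeas_cst (B * 2^-1 ^+ N)) (rmeas_wint 0 mu)))).
  - by move=> z; rewrite -EFinM lee_fin mulr_ge0 ?expR_ge0 ?normc_ge0.
  move=> z; rewrite -!EFinM -EFinD lee_fin.
  have [uz|uz] := eqVneq (u z) 0.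
    by rewrite /wmod uz !mul0r normc0 !(mul0r, mulr0) addr0.
  have h1 : wmod (T (trunc_kernel N z)) w <=
      k z * expR (enorm z ^+ 2 / 2) + B * 2^-1 ^+ N.
    have : wmod (T (trunc_kernel N z)) w <= wmod (T (rkernel z)) w +
       wmod (fun v => T (rkernel z) v - T (trunc_kernel N z) v) w.
      rewrite (le_trans _ (wmodB _ _ _))//.
      rewrite le_eqVlt; apply/orP; left; apply/eqP; congr (normc _ * _); ring.
    move=> /le_trans; apply; apply: lerD.
      by have := uk z uz; rewrite /tkernel expRN ler_pdivrMr ?expR_gt0.
    rewrite (le_trans (HD' N z w))// /B -mulrA ler_wpM2l// mulrC.
    rewrite ler_wpM2r ?(ltW q0)// ler_expR ler_wpM2l//.
    by rewrite ler_pXn2r ?nnegrE ?enorm_ge0// urho.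
  rewrite (normcM (u z * _)) (normcM (u z)) normc_real (ger0_norm (gauss_ge0 z)).
  rewrite mul0r expR0 mulr1.
  rewrite [leLHS](_ : _ = normc (u z) * gauss z * wmod (T (trunc_kernel N z)) w); last first.
    by rewrite /wmod; ring.
  have ug : 0 <= normc (u z) * gauss z by rewrite mulr_ge0 ?normc_ge0 ?gauss_ge0.
  rewrite (le_trans (ler_wpM2l ug h1))// mulrDr lerD//; last first.
    by rewrite mulrC.
  rewrite /wmod /gauss (_ : expR (- enorm z ^+ 2) =
    expR (- (enorm z ^+ 2 / 2)) * expR (- (enorm z ^+ 2 / 2))); last first.
    by rewrite -expRD; congr expR; field.
  rewrite [leLHS](_ : _ = normc (u z) * expR (- (enorm z ^+ 2 / 2)) * k z *
    (expR (- (enorm z ^+ 2 / 2)) * expR (enorm z ^+ 2 / 2))); last by ring.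
  by rewrite -expRD addNr expR0 mulr1.
have step3 : wmod (T (transform u)) w <= wmod (T PN) w +
    wmod (fun v => T (transform u) v - T PN v) w.
  rewrite (le_trans _ (wmodD _ _ _))//.
  rewrite le_eqVlt; apply/orP; left; apply/eqP; congr (normc _ * _); ring.
apply: (@le_trans _ _ ((wmod (T PN) w)%:E +
   (D * (2 * W * expR ((5 * rho) ^+ 2)) * 2^-1 ^+ N)%:E)%E).
  by rewrite -EFinD lee_fin (le_trans step3)// lerD2l.
rewrite (le_trans (leeD2r _ step2))//.
rewrite muleDr ?fin_num_adde_defl// -EFinM -addeA -EFinD leeD2l// lee_fin.
by rewrite le_eqVlt; apply/orP; left; apply/eqP; rewrite /c; ring.
Qed.

(** A cutoff to a large ball changes [u], hence [T P u] at each point, by little. *)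
Lemma kernel_bound u (k : Cn -> R) w : cmeas u -> (energy p u < +oo)%E ->
  rmeas k -> (forall z, 0 <= k z) -> (forall z, u z != 0 -> tkernel T z w <= k z) ->
  ((wmod (T (transform u)) w)%:E <= 2%:E * nint (fun z => (wmod u z * k z)%:E))%E.
Proof.
move=> mu uy mk k0 uk.
have p0 : 0 < p by rewrite (lt_trans _ p1).
have [C C0 HC] := bounded_op_wmod p1 bT.
pose Y := 4 `^ p * ghalf_mass (R := R) (n := n) `^ p.
have Y0 : 0 <= Y by rewrite mulr_ge0 ?powR_ge0.
apply/lee_addgt0Pr => e e0.
pose B := e / (C + 1).
have B0 : 0 < B by rewrite divr_gt0// ltr_wpDl.
pose bm (m : nat) z : bool := enorm z <= m%:R.
have mbm m : bmeas (bm m) by exact: bmeas_le rmeas_enorm.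
have mcm m : bmeas (fun z => ~~ bm m z) := bmeasC (mbm m).
have eta0 : 0 < B `^ p / (Y + 1) by rewrite divr_gt0 ?powR_gt0// ltr_wpDl.
have [] := @nint_null R n (fun m z => wmod (restr (fun z => ~~ bm m z) u) z `^ p)
  (fun z => wmod u z `^ p) _ _ uy _ _ _ eta0.
- by move=> m; exact: (rmeas_powR p (rmeas_wmod (cmeas_restr (mcm m) mu))).
- exact: (rmeas_powR p (rmeas_wmod mu)).
- move=> m z; rewrite powR_ge0/= le_powR ?(ltW p0) ?wmod_ge0//.
  exact: wmod_restr_le.
- move=> z d d0; exists (Num.truncn (enorm z)).+1 => m zm.
  rewrite wmod_restr (_ : bm m z) /= ?mul0r ?powR0 ?(ltW d0) ?gt_eqF//.
  by rewrite /bm (le_trans (ltW (truncnS_gt _)))// ler_nat.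
move=> K /(_ K (leqnn K)) HK.
pose u1 := restr (bm K) u; pose u2 := restr (fun z => ~~ bm K z) u.
have m1 : cmeas u1 := cmeas_restr (mbm K) mu.
have m2 : cmeas u2 := cmeas_restr (mcm K) mu.
have y1 : (energy p u1 < +oo)%E.
  apply: le_lt_trans uy; apply: (le_energy (ltW p0) m1 mu) => z.
  exact: wmod_restr_le.
have y2 : (energy p u2 < +oo)%E by rewrite (le_lt_trans HK)// ltry.
have t1 := energy_tame (ltW p1) m1 y1; have t2 := energy_tame (ltW p1) m2 y2.
have tE : transform u = fun v => transform u1 v + transform u2 v.
  apply/funext => v; rewrite /transform.
  have c1 := tame_cintegrable t1 (cmeas_rkernel v) ler01 (fun z => rkernel_le z v).
  have c2 := tame_cintegrable t2 (cmeas_rkernel v) ler01 (fun z => rkernel_le z v).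
  rewrite -cintegralD//; apply: eq_cintegral => z.
  by rewrite /u1 /u2 /restr; case: (bm K z); rewrite !mul0r ?addr0 ?add0r.
have f1 := fock_transform p1 m1 y1; have f2 := fock_transform p1 m2 y2.
rewrite tE (bounded_opD bT f1 f2).
have H2 : wmod (T (transform u2)) w <= e.
  have := HC _ B w f2 B0; rewrite (le_trans (energy_transform p1 m2 y2)); last first.
    rewrite (le_trans (lee_wpmul2l _ HK)) ?lee_fin// -/Y mulrCA ler_piMr ?powR_ge0//.
    by rewrite ler_pdivrMr ?mul1r ?lerDl// ltr_wpDl.
  move=> /(_ isT)/le_trans; apply; rewrite /B mulrCA ler_piMr ?(ltW e0)//.
  by rewrite ler_pdivrMr ?mul1r ?lerDl// ltr_wpDl.
have H1 := @kernel_bound_compact u1 k K%:R w m1 y1 mk k0 (ler0n _ _).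
have {}H1 : ((wmod (T (transform u1)) w)%:E <=
    2%:E * nint (fun z => (wmod u z * k z)%:E))%E.
  apply: (le_trans (H1 _ _)).
  - by move=> z; rewrite /u1 /restr; case: ifP => //; rewrite eqxx.
  - by move=> z; rewrite /u1 /restr; case: ifP => [_|]; [exact: uk|rewrite eqxx].
  rewrite lee_wpmul2l//; apply: le_nint.
  - exact: (rmeas_emeas (rmeasM (rmeas_wmod m1) mk)).
  - exact: (rmeas_emeas (rmeasM (rmeas_wmod mu) mk)).
  - by move=> z; rewrite lee_fin mulr_ge0 ?wmod_ge0.
  by move=> z; rewrite lee_fin ler_wpM2r// wmod_restr_le.
apply: (@le_trans _ _ ((wmod (T (transform u1)) w)%:E + (wmod (T (transform u2)) w)%:E)%E).
  by rewrite -EFinD lee_fin wmodD.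
by apply: leeD.
Qed.

End operator.
End truncated_kernel.

(** * Decay of the kernel away from the diagonal *)

Section off_diagonal.
Context {R : realType}.

(** Both sides of the reproducing formula pass to the limit, as the error is small
    compared with [e^{|y|^2/4}]. *)
Lemma reproducing_limit n (f : 'rV[R[i]]_n -> R[i]) (F : nat -> 'rV[R[i]]_n -> R[i]) (M B : R) :
  0 <= M -> 0 <= B -> (forall N, entire (F N)) ->
  (forall y, normc (f y) <= M * expR (4^-1 * enorm y ^+ 2)) ->
  (forall N y, normc (f y - F N y) <= B * 2^-1 ^+ N * expR (4^-1 * enorm y ^+ 2)) ->
  cmeas f /\ forall y, transform f y = f y.
Proof.
move=> M0 B0 eF fM fB.
have q0 N : 0 <= 2^-1 ^+ N :> R by rewrite exprn_ge0// invr_ge0.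
have mf : cmeas f.
  apply: (cmeas_limit (f := F)) => [N|z e e0]; first exact: entire_cmeas.
  have [K HK] := half_pow_null (mulr_ge0 B0 (expR_ge0 (4^-1 * enorm z ^+ 2))) e0.
  exists K => N KN; rewrite -normcNc opprB (le_trans (fB N z))//.
  by rewrite mulrAC HK.
split=> // y.
have c1 : 4^-1 < 1 :> R by rewrite invf_lt1// ltr1n.
pose E (y : 'rV[R[i]]_n) : R[i] := (expR (4^-1 * enorm y ^+ 2))%:C.
have nE y' : normc (E y') = expR (4^-1 * enorm y' ^+ 2).
  by rewrite normc_real ger0_norm ?expR_ge0.
have mE : cmeas E.
  apply: cmeas_real; apply: rmeas_expR.
  exact: (rmeasM (rmeas_cst 4^-1) (rmeasX 2 rmeas_enorm)).
have tE : tame E.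
  by apply: (tame_growth mE ler01 c1) => z; rewrite nE mul1r.
have tf : tame f := tame_growth mf M0 c1 fM.
have d0 N : 0 <= B * 2^-1 ^+ N by rewrite mulr_ge0.
have mFN N := entire_cmeas (eF N).
have td N : tame (fun z => f z - F N z).
  exact: (tame_growth (cmeasB mf (mFN N)) (d0 N) c1 (fB N)).
have tF N : tame (F N).
  apply: (tame_growth (mFN N) (addr_ge0 M0 (d0 N)) c1) => z.
  rewrite (_ : F N z = f z - (f z - F N z)); last by ring.
  by rewrite (le_trans (normcB _ _))// mulrDl lerD.
pose Q := fine (wint E (enorm y)).
have Q0 : 0 <= Q by rewrite fine_ge0// wint_ge0.
have main N : normc (transform f y - f y) <=
    (2 * B * Q + B * expR (4^-1 * enorm y ^+ 2)) * 2^-1 ^+ N.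
  have K g (tg : tame g) := tame_cintegrable tg (cmeas_rkernel y) ler01 (fun z => rkernel_le z y).
  have -> : transform f y - f y =
      cintegral (fun z => (f z - F N z) * rkernel z y * (gauss z)%:C) - (f y - F N y).
    have <- : transform f y - F N y =
        cintegral (fun z => (f z - F N z) * rkernel z y * (gauss z)%:C).
      rewrite -(reproducing y (eF N) (tF N)) /transform -(cintegralB (K _ tf) (K _ (tF N))).
      by apply: eq_cintegral => z; ring.
    by ring.
  rewrite (le_trans (normcB _ _))// mulrDl lerD//; last by rewrite mulrAC fB.
  have := tame_cintegral_le (td N) (cmeas_rkernel y) ler01 (fun z => rkernel_le z y).
  move=> /le_trans; apply.
  have -> : 2 * B * Q * 2^-1 ^+ N = 2 * (B * 2^-1 ^+ N * Q) by ring.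
  rewrite mulr1 ler_wpM2l// -lee_fin [leRHS]EFinM.
  rewrite -(wint_fine (enorm y) (td N)) -(wint_fine (enorm y) tE).
  have mwE := rmeas_emeas (rmeas_wint (enorm y) mE).
  have dE : (0 <= (B * 2^-1 ^+ N)%:E)%E by rewrite lee_fin mulr_ge0.
  rewrite -(nintZ mwE (wint_integrand_ge0 E _) dE); apply: le_nint.
  - exact: (rmeas_emeas (rmeas_wint _ (cmeasB mf (mFN N)))).
  - exact: (rmeas_emeas (rmeasM (rmeas_cst (B * 2^-1 ^+ N)) (rmeas_wint (enorm y) mE))).
  - exact: (wint_integrand_ge0 (fun z => f z - F N z)).
  move=> z; rewrite -EFinM lee_fin !mulrA ler_wpM2r ?gauss_ge0// ler_wpM2r ?expR_ge0//.
  by rewrite nE fB.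
have c0 : 0 <= 2 * B * Q + B * expR (4^-1 * enorm y ^+ 2).
  by rewrite addr_ge0 ?mulr_ge0 ?expR_ge0.
have : normc (transform f y - f y) <= 0.
  apply/ler_addgt0Pl => e e0; rewrite addr0.
  by have [K HK] := half_pow_null c0 e0; rewrite (le_trans (main K))// HK.
rewrite le_eqVlt ltNge normc_ge0 orbF => /eqP/eq0_normc/eqP.
by rewrite subr_eq0 => /eqP.
Qed.

Context {n : nat}.
Notation Cn := 'rV[R[i]]_n.
Notation C1 := 'rV[R[i]]_1.
Implicit Types (c e z w : Cn) (y : C1).
Variable p : R.
Hypothesis p1 : 1 < p.
Variable T : (Cn -> R[i]) -> (Cn -> R[i]).
Hypothesis bT : bounded_op p%:E T.

Let half : R[i] := (2^-1 : R)%:C.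

Let half_double (a : Cn) : half *: a + half *: a = a.
Proof.
rewrite -scalerDl /half -realcD (_ : 2^-1 + 2^-1 = 1) ?scale1r//; lra.
Qed.

Let half_sumD (a b : Cn) : half *: (a + b) + half *: (a - b) = a.
Proof. by rewrite -scalerDr addrACA subrr addr0 scalerDr half_double. Qed.

Let half_sumB (a b : Cn) : half *: (a + b) - half *: (a - b) = b.
Proof. by rewrite -scalerBr opprB addrC addrA subrK scalerDr half_double. Qed.

Let ant c e y := c + (y 0 0)^* *: e.
Let hol c e y := c + y 0 0 *: e.
(** Removes the growth of the kernel in the direction of [c], see [normc_chi]. *)
Let fac c e y : R[i] :=
  cexp (- dotc c c - y 0 0 * dotc e c - y 0 0 * dotc c e).

(** The kernel of [T] along a complex line: holomorphic in the parameter because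
    the kernel is antiholomorphic in its first variable. Real parameters give the
    diagonal. *)
Let chi c e y := T (rkernel (ant c e y)) (hol c e y) * fac c e y.

Let chi_trunc N c e y := T (trunc_kernel N (ant c e y)) (hol c e y) * fac c e y.

Let normc_fac c e y : normc (fac c e y) =
  expR (- enorm c ^+ 2 - complex.Re (y 0 0 * dotc e c) - complex.Re (y 0 0 * dotc c e)).
Proof. by rewrite normc_cexp !ReD !ReN dotcc. Qed.

Let enorm_ant c e y : enorm (ant c e y) ^+ 2 =
  enorm c ^+ 2 + normc (y 0 0) ^+ 2 * enorm e ^+ 2 + 2 * complex.Re (y 0 0 * dotc e c).
Proof.
rewrite enormD_sq enormZ normc_conj exprMn dotcZr; congr (_ + 2 * _).
by rewrite -(dotcC e c) -rmorphM Re_conj.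
Qed.

Let enorm_hol c e y : enorm (hol c e y) ^+ 2 =
  enorm c ^+ 2 + normc (y 0 0) ^+ 2 * enorm e ^+ 2 + 2 * complex.Re (y 0 0 * dotc c e).
Proof. by rewrite enormD_sq enormZ exprMn dotcZr. Qed.

Let exp_balance (t a q r s : R) : t * expR (- a - r - s) =
  t * expR (- ((a + q + 2 * s) / 2)) * expR (- ((a + q + 2 * r) / 2)) * expR q.
Proof.
rewrite -!mulrA -!expRD; congr (t * expR _); lra.
Qed.

Let exp_collect (b q r s t : R) :
  b * (q * expR r) * expR s * expR t = b * (q * expR (r + s + t)).
Proof. by rewrite !expRD !mulrA. Qed.

Let normc_chi c e y : normc (chi c e y) =
  tkernel T (ant c e y) (hol c e y) * expR (normc (y 0 0) ^+ 2 * enorm e ^+ 2).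
Proof.
rewrite /chi normcM normc_fac /tkernel /wmod; move: (normc (T _ _)) => t.
move: (enorm_ant c e y) (enorm_hol c e y).
move: (ant c e y) (hol c e y) => a b -> ->; exact: (exp_balance t (enorm c ^+ 2)
  (normc (y 0 0) ^+ 2 * enorm e ^+ 2) (complex.Re (y 0 0 * dotc e c))
  (complex.Re (y 0 0 * dotc c e))).
Qed.

Let entire_chi_trunc N c e : entire (chi_trunc N c e).
Proof.
have [I [a [b [la fb _ ET]]]] := op_trunc_separated p1 bT N.
have -> : chi_trunc N c e = fun y =>
    (\sum_i a i (conjv c + y 0 0 *: conjv e) * T (b i) (c + y 0 0 *: e)) *
    (cexp (- dotc c c) * rkernel (const_mx (- (dotc e c + dotc c e))^* : C1) y).
  apply/funext => y; rewrite /chi_trunc ET; congr (_ * _).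
    apply: eq_bigr => i _; have [_ -> _] := la i; congr (a i _ * _).
    by apply/rowP => j; rewrite !mxE rmorphD rmorphM/= conjCK.
  rewrite /fac /rkernel -cexpD; congr cexp.
  by rewrite /dotc big_ord1 mxE conjCK; ring.
apply: entireM.
  apply: entire_sum => i; apply: entireM.
    by apply: (entire_line (conjv c) (conjv e)); case: (la i).
  by apply: (entire_line c e); apply: fock_entire; exact: (bounded_fock bT).
by apply: entireZ; exact: entire_rkernel.
Qed.

Let chi_repr c e : enorm e <= 20^-1 -> cmeas (chi c e) /\
  forall y, transform (chi c e) y = chi c e y.
Proof.
move=> e20; have [C C0 HC] := tkernel_bound p1 bT; have [D D0 HD] := op_trunc_close p1 bT.
have e2 : enorm e ^+ 2 <= 400^-1.
  by have := enorm_ge0 e; move: e20; move: (enorm e) => x *; nra.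
apply: (@reproducing_limit 1 (chi c e) (fun N => chi_trunc N c e) C
  (D * expR (51 * enorm c ^+ 2)) C0 (mulr_ge0 D0 (expR_ge0 _))).
- by move=> N; exact: entire_chi_trunc.
- move=> y; rewrite normc_chi enorm_rV1 ler_pM ?tkernel_ge0 ?expR_ge0//.
  rewrite ler_expR mulrC ler_wpM2r ?sqr_ge0// (le_trans e2)//; lra.
move=> N y; rewrite /chi /chi_trunc -mulrBl normcM.
have := HD N (ant c e y) (hol c e y); rewrite /wmod expRN ler_pdivrMr ?expR_gt0// => h.
rewrite (le_trans (ler_wpM2r (normc_ge0 _) h))// normc_fac.
rewrite exp_collect [leRHS](_ : _ = D * (2^-1 ^+ N *
    expR (51 * enorm c ^+ 2 + 4^-1 * enorm y ^+ 2))); last first.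
  by rewrite expRD; move: (expR _) (expR _) => a b; ring.
rewrite ler_wpM2l// ler_wpM2l ?exprn_ge0 ?invr_ge0// ler_expR.
move: (enorm_ant c e y) (enorm_hol c e y) => {h}.
move: (ant c e y) (hol c e y) => a b -> ->; rewrite (enorm_rV1 y).
have y0 := normc_ge0 (y 0 0).
have r1 : complex.Re (y 0 0 * dotc e c) <= normc (y 0 0) * enorm e * enorm c.
  rewrite (le_trans (ler_norm _))// (le_trans (Re_le_normc _))// normcM -mulrA.
  by rewrite ler_wpM2l// normc_dotc.
have r2 : complex.Re (y 0 0 * dotc c e) <= normc (y 0 0) * enorm e * enorm c.
  rewrite (le_trans (ler_norm _))// (le_trans (Re_le_normc _))// normcM -mulrA.
  by rewrite ler_wpM2l// mulrC normc_dotc.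
have r3 := sqr_ge0 (normc (y 0 0) * enorm e - enorm c).
have r4 : normc (y 0 0) ^+ 2 * enorm e ^+ 2 <= normc (y 0 0) ^+ 2 * 400^-1.
  by rewrite ler_wpM2l ?sqr_ge0.
have r5 := sqr_ge0 (normc (y 0 0)).
move: r1 r2 r3 r4 r5; rewrite sqrrB exprMn.
move: (complex.Re _) (complex.Re _) => r s.
by move=> *; nra.
Qed.

(** Otherwise there are pairs [(z_k, w_k)] at bounded distance, tending to
    infinity, with large kernel. The functions [chi] on the complex lines that join
    the diagonal to these pairs are uniformly of small Gaussian growth and tend to
    0 on the real axis, where they are values of the Berezin transform; the identity
    theorem makes them tend to 0 at [- i tau], where they dominate the kernel at
    [(z_k, w_k)]. *)
Lemma off_diagonal :
  (forall e : R, 0 < e -> exists M : R, forall z, M < enorm z -> tkernel T z z < e) ->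
  forall rho d : R, 0 <= rho -> 0 < d ->
  exists M : R, forall z w, M < enorm w -> enorm (z - w) <= rho -> tkernel T z w <= d.
Proof.
move=> berezin rho d rho0 d0; apply: contrapT => /forallNP H.
have {}H (k : nat) : exists zw : Cn * Cn, [/\ k%:R < enorm zw.2,
    enorm (zw.1 - zw.2) <= rho & d < tkernel T zw.1 zw.2].
  have /existsNP[z /existsNP[w /not_implyP[h1 /not_implyP[h2 /negP h3]]]] := H k%:R.
  by exists (z, w); split=> //; rewrite ltNge.
have {H} [s Hs] := boolp.choice H.
(* [tau] is large so that the directions [e k] are short and [chi] grows slowly *)
pose tau : R := 10 * (rho + 1).
have tau0 : 0 < tau by rewrite mulr_gt0// ltr_wpDl.
pose c k := half *: ((s k).1 + (s k).2).
pose e k := ((0 : R) +i* (2 * tau)^-1) *: ((s k).2 - (s k).1).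
have e20 k : enorm (e k) <= 20^-1.
  have [_ h _] := Hs k; rewrite enormZ enormC.
  have -> : normc ((0 : R) +i* (2 * tau)^-1) = (2 * tau)^-1.
    rewrite /normc expr0n add0r sqrtr_sqr ger0_norm// invr_ge0 mulr_ge0// ltW//.
  have t2 : 0 < 2 * tau by rewrite mulr_gt0.
  apply: (le_trans (ler_wpM2l _ h)); first by rewrite invr_ge0 ltW.
  by rewrite mulrC ler_pdivrMr// /tau; lra.
have [C C0 HC] := tkernel_bound p1 bT.
have e2 k : enorm (e k) ^+ 2 <= 4^-1.
  by have := enorm_ge0 (e k); have := e20 k; move: (enorm (e k)) => x *; nra.
have := @null_seq_off_real R C (fun k => chi (c k) (e k)) C0
  (fun k => (chi_repr (c k) (e20 k)).1) _ (fun k => (chi_repr (c k) (e20 k)).2) _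
  (const_mx ((0 : R) +i* - tau)).
have h1 k (y : C1) : normc (chi (c k) (e k) y) <= C * expR (enorm y ^+ 2 / 4).
  rewrite normc_chi enorm_rV1 ler_pM ?tkernel_ge0 ?expR_ge0// ler_expR.
  by rewrite ler_wpM2l ?sqr_ge0.
move=> /(_ h1) {h1}.
have h2 (x : R) : null_seq (fun k => normc (chi (c k) (e k) (const_mx x%:C))).
  move=> eps eps0; pose E := expR (x ^+ 2 / 4).
  have E0 : 0 < E := expR_gt0 _.
  have [M HM] := berezin _ (divr_gt0 eps0 E0).
  exists (Num.truncn (`|M| + rho + `|x| * 20^-1)).+1 => k Kk.
  rewrite normc_chi mxE.
  have -> : ant (c k) (e k) (const_mx x%:C) = hol (c k) (e k) (const_mx x%:C).
    by rewrite /ant /hol mxE conj_real.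
  rewrite normc_real real_normK ?num_real//.
  have big : M < enorm (hol (c k) (e k) (const_mx x%:C)).
    have [w1 w2 _] := Hs k.
    have l1 : enorm (s k).2 <= enorm (hol (c k) (e k) (const_mx x%:C)) + rho + `|x| * 20^-1.
      have -> : (s k).2 = (hol (c k) (e k) (const_mx x%:C) -
          half *: ((s k).1 - (s k).2)) - x%:C *: e k.
        by rewrite /hol mxE addrAC addrK /c half_sumB.
      rewrite (le_trans (enormB _ _))// lerD//.
        rewrite (le_trans (enormB _ _))// lerD// enormZ normc_real ger0_norm ?invr_ge0//.
        rewrite (le_trans _ w2)// ler_piMl ?enorm_ge0// invf_le1// ler1n//.
      by rewrite enormZ normc_real ler_wpM2l.
    have l2 : `|M| + rho + `|x| * 20^-1 < enorm (s k).2.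
      by rewrite (lt_trans _ w1)// (lt_le_trans (truncnS_gt _))// ler_nat.
    by have := ler_norm M; lra.
  have := HM _ big; rewrite ltr_pdivlMr// => /ltW/(le_trans _); apply.
  by rewrite ler_wpM2l ?tkernel_ge0// ler_expR ler_wpM2l ?sqr_ge0.
move=> /(_ h2) /(_ d d0)[K /(_ K (leqnn K))].
have [_ _ hd] := Hs K; apply/negP; rewrite -ltNge (lt_le_trans hd)//.
rewrite normc_chi.
have ie : (tau%:C * ('i%C : R[i])) *: e K = half *: ((s K).1 - (s K).2).
  rewrite /e scalerA -(opprB (s K).1) scalerN -scaleNr; congr (_ *: _).
  apply: complex_eq; rewrite ?ReN ?ImN !(Re_mul, Im_mul)/=; field; by rewrite gt_eqF.
have -> : ant (c K) (e K) (const_mx ((0 : R) +i* - tau)) = (s K).1.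
  rewrite /ant mxE.
  have -> : ((0 : R) +i* - tau)^* = tau%:C * ('i%C : R[i]).
    by apply: complex_eq; rewrite ?Re_conj ?Im_conj !(Re_mul, Im_mul)/=; ring.
  by rewrite ie /c half_sumD.
have -> : hol (c K) (e K) (const_mx ((0 : R) +i* - tau)) = (s K).2.
  rewrite /hol mxE.
  have -> : ((0 : R) +i* - tau) = - (tau%:C * ('i%C : R[i])).
    by apply: complex_eq; rewrite ?ReN ?ImN !(Re_mul, Im_mul)/=; ring.
  by rewrite scaleNr ie /c half_sumB.
rewrite ler_peMr ?tkernel_ge0// -expR0 ler_expR.
by rewrite mulr_ge0 ?sqr_ge0.
Qed.

End off_diagonal.

(** * Montel's theorem in F^p *)

Section extraction.
Context {R : realType}.

Lemma powR_cvg (p : R) (x : nat -> R) (a : R) : 0 < p -> (forall k, 0 <= x k) -> 0 <= a ->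
  x @ \oo --> a -> (fun k => x k `^ p) @ \oo --> a `^ p.
Proof.
move=> p0 x0; rewrite le_eqVlt => /predU1P[<-|a0] xa.
  rewrite powR0 ?gt_eqF//; apply/cvgrPdist_le => e e0.
  have e1 : 0 < e `^ p^-1 by rewrite powR_gt0.
  have /cvgrPdist_le/(_ _ e1)[K _ HK] := xa.
  exists K => // k Kk; have := HK k Kk; rewrite !sub0r !normrN /= !ger0_norm ?powR_ge0// => h.
  have -> : e = (e `^ p^-1) `^ p by rewrite -powRrM mulVf ?gt_eqF// powRr1// ltW.
  by apply: le_powR => //; exact: ltW.
have c : {for a, continuous (fun y : R => y `^ p)}.
  apply: differentiable_continuous; apply/derivable1_diffP.
  exact: (@ex_derive _ _ _ _ _ _ _ (is_derive1_powR p a0)).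
exact: (continuous_cvg _ c xa).
Qed.

Lemma ultra_bounded_limit (U : set_system nat) (u : nat -> R) (B : R) :
  UltraFilter U -> (forall k, `|u k| <= B) ->
  exists l : R, forall e, 0 < e -> U [set k | `|u k - l| <= e].
Proof.
move=> UU uB.
have cB := @segment_compact R (- B) B.
have UB : U (u @^-1` `[- B, B]%classic).
  by apply: filterS (@filterT _ U _) => k _ /=; rewrite in_itv/= -ler_norml uB.
have [l [_ cl]] := cB (u @ U) _ UB.
exists l => e e0.
have [//|Un] := in_ultra_setVsetC [set k | `|u k - l| <= e] UU.
have nb : nbhs l [set x | `|x - l| <= e].
  apply/nbhs_ballP; exists e => //= x; rewrite /ball/= distrC => /ltW; exact: id.
have Fn : (u @ U) [set x | ~ (`|x - l| <= e)] by [].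
by have [x [/= h1 h2]] := cl _ _ Fn nb.
Qed.

Lemma increasing_choice (P : nat -> nat -> Prop) :
  (forall m k, exists k', (k < k')%N /\ P m k') ->
  exists phi : nat -> nat, {homo phi : i j / (i < j)%N} /\ forall m, P m (phi m).
Proof.
move=> H.
have [nx Hnx] := boolp.choice (fun mk : nat * nat => H mk.1 mk.2).
pose phi := fix phi m := if m is m'.+1 then nx (m, phi m') else nx (0%N, 0%N).
exists phi; split.
  apply: homo_ltn => [i j k|i]; first exact: ltn_trans.
  by have [] := Hnx (i.+1, phi i).
by case=> [|m]; [have [] := Hnx (0%N, 0%N)|have [] := Hnx (m.+1, phi m)].
Qed.

Context {n : nat}.
Notation Cn := 'rV[R[i]]_n.
Implicit Types (f g : Cn -> R[i]) (z w : Cn).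

Lemma countable_dense : exists pt : nat -> Cn, forall w (r : R), 0 < r ->
  exists j, enorm (pt j - w) < r.
Proof.
pose cell (t : nat * {ffun 'I_n -> int * int}) : Cn :=
  \row_j (((t.2 j).1%:~R / t.1.+1%:R) +i* ((t.2 j).2%:~R / t.1.+1%:R)).
exists (fun k => odflt 0 (omap cell (unpickle k))) => w r r0.
pose K := Num.truncn (2 * n%:R / r).
pose fl (x : R) := Num.floor (K.+1%:R * x).
pose t : nat * {ffun 'I_n -> int * int} :=
  (K, [ffun j => (fl (complex.Re (w 0 j)), fl (complex.Im (w 0 j)))]).
exists (pickle t); rewrite pickleK /=.
have K0 : 0 < K.+1%:R :> R by rewrite ltr0n.
rewrite (le_lt_trans (enorm_le_sum _))//.
apply: (@le_lt_trans _ _ (\sum_(j < n) (2 * K.+1%:R^-1))).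
  apply: ler_sum => j _; rewrite !mxE /= ffunE.
  rewrite (le_trans (normc_le_ReIm _))// ReD ImD ReN ImN /= mulr2n mulrDl mul1r.
  by rewrite lerD// floor_approx.
rewrite sumr_const card_ord -[ltLHS]mulr_natr mulrAC ltr_pdivrMr// [ltRHS]mulrC.
rewrite -ltr_pdivrMr//.
exact: truncnS_gt.
Qed.

Lemma cexp_sub1_le (b : R[i]) : normc (cexp b - 1) <= 2 * normc b * expR (normc b).
Proof.
have := cexp_trunc_le 1 b.
by rewrite /cexp_trunc big_ord1 expr0 mulr1 expr1 !invr1 mulr1.
Qed.

Lemma transform_lipschitz f w h : tame f -> enorm h <= 1 ->
  normc (transform f (w + h) - transform f w) <=
  4 * fine (wint f (enorm w + 2)) * enorm h.
Proof.
move=> tf h1.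
have K v := tame_cintegrable tf (cmeas_rkernel v) ler01 (fun z => rkernel_le z v).
have -> : transform f (w + h) - transform f w =
    cintegral (fun z => f z * (rkernel z (w + h) - rkernel z w) * (gauss z)%:C).
  by rewrite /transform -(cintegralB (K _) (K _)); apply: eq_cintegral => z; ring.
have -> : 4 * fine (wint f (enorm w + 2)) * enorm h =
  2 * (2 * enorm h) * fine (wint f (enorm w + 2)) by ring.
apply: tame_cintegral_le => //.
- exact: (cmeasB (cmeas_rkernel _) (cmeas_rkernel _)).
- by rewrite mulr_ge0 ?enorm_ge0.
move=> z; rewrite /rkernel dotcDr cexpD.
rewrite (_ : _ - _ = cexp (dotc z w) * (cexp (dotc z h) - 1)); last by ring.
have z0 := enorm_ge0 z; have h0 := enorm_ge0 h.
have d1 : normc (dotc z h) <= enorm z * enorm h := normc_dotc z h.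
rewrite normcM; apply: (le_trans (ler_pM (normc_ge0 _) (normc_ge0 _)
  (rkernel_le z w) (cexp_sub1_le _))).
have -> : (enorm w + 2) * enorm z = enorm w * enorm z + (enorm z + enorm z) by ring.
rewrite !expRD mul1r [leRHS]mulrCA ler_wpM2l ?expR_ge0//.
apply: (@le_trans _ _ (2 * (enorm z * enorm h) * expR (enorm z))).
  apply: ler_pM; rewrite ?mulr_ge0 ?normc_ge0 ?expR_ge0// ?ler_wpM2l//.
  by rewrite ler_expR (le_trans d1)// ler_piMr.
rewrite -!mulrA ler_wpM2l// mulrCA ler_wpM2l// ler_wpM2r ?expR_ge0//.
by rewrite (le_trans _ (expR_ge1Dx _))// lerDr.
Qed.

Section montel.
Variable p : R.
Hypothesis p1 : 1 < p.
Variables (f : nat -> Cn -> R[i]) (M : R).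
Hypothesis ff : forall k, fock p%:E (f k).
Hypothesis fM : forall k, (energy p (f k) <= M%:E)%E.

Let C : R := fock_cst (R := R) (n := n) * (`|M| + 1) `^ p^-1.

Let p0 : 0 < p. Proof. exact: lt_trans p1. Qed.

Let C0 : 0 <= C.
Proof. by rewrite mulr_ge0 ?fock_cst_ge0// powR_ge0. Qed.

Let wf k w : wmod (f k) w <= C.
Proof.
have M1 : 0 < `|M| + 1 by rewrite ltr_wpDl.
apply: (fock_bound p1 w (ff k)); first by rewrite powR_gt0.
rewrite -powRrM mulVf ?gt_eqF// powRr1 ?(ltW M1)//.
by rewrite (le_trans (fM k))// lee_fin (le_trans (ler_norm M))// lerDl.
Qed.

Let nf k w : normc (f k w) <= C * expR (2^-1 * enorm w ^+ 2).
Proof.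
have := wf k w; rewrite /wmod expRN ler_pdivrMr ?expR_gt0//.
by rewrite (mulrC _ 2^-1).
Qed.

Let tf k : tame (f k). Proof. by apply: (fock_tame (ltW p1)); exact: ff. Qed.

Let repf k w : transform (f k) w = f k w.
Proof. by apply: reproducing => //; exact: fock_entire (ff k). Qed.

(** A common integrable majorant for the sequence. *)
Let dom a z : R := C * expR (a * enorm z - 2^-1 * enorm z ^+ 2).

Let mdom a : rmeas (dom a).
Proof.
exact: (rmeasM (rmeas_cst C) (rmeas_expR_quad a 2^-1)).
Qed.

Let domy a : (nint (fun z => (dom a z)%:E) < +oo)%E.
Proof.
have h2 : 0 < 2^-1 :> R by rewrite invr_gt0.
under eq_nint do rewrite EFinM.
rewrite nintZ ?lee_fin//.
- by rewrite lte_mul_pinfty ?lee_fin//; exact: nint_expR_quad.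
- exact: (rmeas_emeas (rmeas_expR_quad a 2^-1)).
Qed.

Let dom_le (h : Cn -> R[i]) a z : normc (h z) <= C * expR (2^-1 * enorm z ^+ 2) ->
  normc (h z) * expR (a * enorm z) * gauss z <= dom a z.
Proof.
move=> hz; rewrite -mulrA.
have e0 : 0 <= expR (a * enorm z) * gauss z by rewrite mulr_ge0 ?expR_ge0 ?gauss_ge0.
rewrite (le_trans (ler_wpM2r e0 hz))// /dom -mulrA ler_wpM2l// /gauss -!expRD ler_expR.
by rewrite le_eqVlt; apply/orP; left; apply/eqP; field.
Qed.

Let wintf k a : fine (wint (f k) a) <= fine (nint (fun z => (dom a z)%:E)).
Proof.
rewrite -lee_fin -wint_fine// fineK; last first.
  rewrite ge0_fin_numE ?domy//; apply: nint_ge0 => z.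
  by rewrite lee_fin mulr_ge0 ?expR_ge0.
apply: le_nint.
- by apply: rmeas_emeas; apply: rmeas_wint; case: (tf k).
- exact: (rmeas_emeas (mdom a)).
- exact: wint_integrand_ge0.
- by move=> z; rewrite lee_fin dom_le.
Qed.

Let equicont w (e : R) : 0 < e -> exists2 r : R, 0 < r &
  forall k h, enorm h < r -> normc (f k (w + h) - f k w) <= e.
Proof.
move=> e0; pose L := 4 * fine (nint (fun z => (dom (enorm w + 2) z)%:E)).
have L0 : 0 <= L.
  rewrite mulr_ge0// fine_ge0// nint_ge0// => z.
  by rewrite lee_fin mulr_ge0 ?expR_ge0.
have L1 : 0 < L + 1 by rewrite ltr_wpDl.
exists (Num.min 1 (e / (L + 1))); first by rewrite lt_min ltr01 divr_gt0.
move=> k h; rewrite lt_min => /andP[h1 he]; rewrite -!repf.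
apply: (le_trans (transform_lipschitz w (tf k) (ltW h1))).
apply: (@le_trans _ _ ((L + 1) * enorm h)); last first.
  by rewrite mulrC -ler_pdivlMr// ltW.
rewrite ler_wpM2r ?enorm_ge0// (@le_trans _ _ L) ?lerDl//.
by rewrite ler_wpM2l// wintf.
Qed.

Let ultra_limit (U : set_system nat) : UltraFilter U ->
  exists g, forall w (e : R), 0 < e -> U [set k | normc (f k w - g w) <= e].
Proof.
move=> UU.
have H w : exists l : R[i], forall e : R, 0 < e -> U [set k | normc (f k w - l) <= e].
  have nB k := nf k w.
  have [a Ha] := @ultra_bounded_limit U (fun k => complex.Re (f k w)) _ UU
    (fun k => le_trans (Re_le_normc _) (nB k)).
  have [b Hb] := @ultra_bounded_limit U (fun k => complex.Im (f k w)) _ UU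
    (fun k => le_trans (Im_le_normc _) (nB k)).
  exists (a +i* b) => e e0; have e2 : 0 < e / 2 by rewrite divr_gt0.
  apply: filterS (filterI (Ha _ e2) (Hb _ e2)) => k [/= h1 h2].
  rewrite (le_trans (normc_le_ReIm _))// ReD ImD ReN ImN /=.
  by rewrite [leRHS](splitr e) lerD.
by have [g Hg] := boolp.choice H; exists g.
Qed.

(** By equicontinuity, convergence on a countable dense set is enough. The limits
    along an ultrafilter exist at all points at once, and a subsequence is chosen
    that follows them on more and more points of the dense set. *)
Lemma montel_pointwise : exists (phi : nat -> nat) g, {homo phi : i j / (i < j)%N} /\
  forall z, null_seq (fun k => normc (f (phi k) z - g z)).
Proof.
have [U [UU ooU]] := @ultraFilterLemma nat \oo _.
have [g Hg] := ultra_limit UU.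
have [pt Hpt] := countable_dense.
pose P m k := forall j, (j < m)%N -> normc (f k (pt j) - g (pt j)) <= m.+1%:R^-1.
have HP m : U [set k | P m k].
  have : U [set k | forall j, (j < m)%N -> normc (f k (pt j) - g (pt j)) <= m.+1%:R^-1].
    have m0 : 0 < m.+1%:R^-1 :> R by rewrite invr_gt0.
    move: (m.+1%:R^-1) m0 => e e0; elim: m => [|m IH].
      by apply: filterS filterT => k _ j.
    apply: filterS (filterI IH (Hg (pt m) _ e0)) => k [/= h1 h2] j.
    by rewrite ltnS leq_eqVlt => /predU1P[->//|]; exact: h1.
  exact: id.
have [phi [hphi HPphi]] : exists phi : nat -> nat,
    {homo phi : i j / (i < j)%N} /\ forall m, P m (phi m).
  apply: increasing_choice => m k.
  have Uk : U [set j | (k < j)%N] by apply: ooU; exists k.+1.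
  by have [k' [/= h1 h2]] := filter_ex (filterI Uk (HP m)); exists k'.
exists phi, g; split=> // z e e0.
have e4 : 0 < e / 4 by rewrite divr_gt0.
have [r r0 Hr] := equicont z e4.
have [j Hj] := Hpt z r r0.
have ptE : pt j = z + (pt j - z) by rewrite addrC subrK.
have gclose : normc (g (pt j) - g z) <= e / 2.
  have e8 : 0 < e / 8 by rewrite divr_gt0.
  have [k [/= h1 h2]] := filter_ex (filterI (Hg z _ e8) (Hg (pt j) _ e8)).
  have := Hr k _ Hj; rewrite -ptE => h3.
  rewrite (_ : _ - _ = (f k (pt j) - f k z) + ((f k z - g z) - (f k (pt j) - g (pt j))));
    last by ring.
  rewrite (le_trans (normcD _ _))//.
  have := normcB (f k z - g z) (f k (pt j) - g (pt j)) => h4.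
  by move: h1 h2 h3 h4; move: (normc _) (normc _) (normc _) (normc _) => *; lra.
exists (maxn j.+1 (Num.truncn (4 / e)).+1) => k; rewrite geq_max => /andP[jk ek].
have h1 := Hr (phi k) _ Hj; rewrite -ptE in h1.
have h2 : normc (f (phi k) (pt j) - g (pt j)) <= e / 4.
  rewrite (le_trans (HPphi k j jk))// -[leRHS]invf_div lef_pV2 ?posrE ?divr_gt0//.
  rewrite (le_trans (ltW (truncnS_gt _)))// ler_nat (leq_trans ek)//.
rewrite (_ : _ - _ = (f (phi k) (pt j) - g (pt j)) + (g (pt j) - g z)
  - (f (phi k) (pt j) - f (phi k) z)); last by ring.
rewrite (le_trans (normcB _ _))// (le_trans (lerD (normcD _ _) (lexx _)))//.
by move: h1 h2 gclose; move: (normc _) (normc _) (normc _) => *; lra.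
Qed.

(** The limit satisfies the reproducing formula by dominated convergence, hence is
    entire; Fatou's lemma bounds its norm. *)
Lemma montel : exists (phi : nat -> nat) g, [/\ {homo phi : i j / (i < j)%N},
  fock p%:E g & forall z, null_seq (fun k => normc (f (phi k) z - g z))].
Proof.
have [phi [g [hphi fg]]] := montel_pointwise.
have mg : cmeas g.
  by apply: (cmeas_limit _ fg) => k; exact: fock_cmeas (ff (phi k)).
have ng z : normc (g z) <= C * expR (2^-1 * enorm z ^+ 2).
  apply/ler_addgt0Pl => e e0; have [K HK] := fg z e e0.
  rewrite (_ : g z = f (phi K) z - (f (phi K) z - g z)); last by ring.
  by rewrite (le_trans (normcB _ _))// addrC lerD ?nf// HK.
have c1 : 2^-1 < 1 :> R by rewrite invf_lt1// ltr1n.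
have tg : tame g := tame_growth mg C0 c1 ng.
have rg w : transform g w = g w.
  have E : null_seq (fun k => normc (transform (f (phi k)) w - transform g w)).
    move=> e e0; have e2 : 0 < e / 2 by rewrite divr_gt0.
    have [] := @nint_null R n (fun k z => normc (f (phi k) z - g z) *
      (expR (enorm w * enorm z) * gauss z)) (fun z => 2 * dom (enorm w) z) _ _ _ _ _ _ e2.
    - move=> k; apply: rmeasM; last exact: (rmeasM (rmeas_expenorm _) rmeas_gauss).
      by apply: rmeas_normc; apply: cmeasB => //; exact: fock_cmeas (ff (phi k)).
    - exact: (rmeasM (rmeas_cst 2) (mdom _)).
    - under eq_nint do rewrite EFinM.
      rewrite (nintZ (rmeas_emeas (mdom _))) => [|z|//].
        by rewrite lte_mul_pinfty.
      by rewrite lee_fin mulr_ge0 ?expR_ge0.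
    - move=> k z; rewrite !mulr_ge0 ?normc_ge0 ?expR_ge0//=.
      have -> : 2 * dom (enorm w) z = dom (enorm w) z + dom (enorm w) z by ring.
      rewrite (@le_trans _ _ ((normc (f (phi k) z) + normc (g z)) *
        (expR (enorm w * enorm z) * gauss z)))//.
        by rewrite ler_wpM2r ?normcB// mulr_ge0 ?expR_ge0.
      by rewrite mulrDl !mulrA lerD// dom_le.
    - move=> z; under [X in null_seq X]funext do rewrite mulrC.
      by apply: null_seqZ => //; rewrite mulr_ge0 ?expR_ge0.
    move=> K HK; exists K => k Kk.
    have tfk := tf (phi k).
    have cf := tame_cintegrable tfk (cmeas_rkernel w) ler01 (fun z => rkernel_le z w).
    have cg := tame_cintegrable tg (cmeas_rkernel w) ler01 (fun z => rkernel_le z w).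
    rewrite /transform -(cintegralB cf cg) -lee_fin.
    apply: (le_trans (normc_cintegral (cintegrableB cf cg))).
    have -> : e%:E = (2%:E * (e / 2)%:E)%E by rewrite -EFinM mulrC divfK.
    rewrite lee_wpmul2l//; apply: le_trans (HK k Kk).
    have mfg : cmeas (fun z => f (phi k) z - g z) := cmeasB (tf (phi k)).1 mg.
    apply: le_nint.
    - by apply: emeas_normc; case: (cintegrableB cf cg).
    - apply: rmeas_emeas; apply: rmeasM; last exact: (rmeasM (rmeas_expenorm _) rmeas_gauss).
      exact: rmeas_normc.
    - exact: normcE_ge0.
    move=> z; rewrite lee_fin.
    rewrite (_ : _ - _ = (f (phi k) z - g z) * (rkernel z w * (gauss z)%:C)); last by ring.
    rewrite normcM ler_wpM2l ?normc_ge0// normcM normc_real (ger0_norm (gauss_ge0 z)).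
    by rewrite ler_wpM2r ?gauss_ge0//; have := rkernel_le z w; rewrite mul1r.
  have : normc (transform g w - g w) <= 0.
    apply/ler_addgt0Pl => e e0; rewrite addr0.
    have [K HK] := null_seqD E (fg w) e0.
    have := HK K (leqnn K); rewrite repf => /(le_trans _); apply.
    rewrite (_ : _ - _ = (f (phi K) w - g w) - (f (phi K) w - transform g w)); last by ring.
    by rewrite (le_trans (normcB _ _))// addrC.
  rewrite le_eqVlt ltNge normc_ge0 orbF => /eqP/eq0_normc/eqP.
  by rewrite subr_eq0 => /eqP.
exists phi, g; split=> //; apply/(fockP g p0); split.
  by rewrite -(funext rg); exact: entire_transform.
have cw z : (fun k => (wmod (f (phi k)) z `^ p)%:E) @ \oo --> (wmod g z `^ p)%:E.
  apply: cvg_EFin; first by near=> k.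
  apply: powR_cvg => //; [by move=> k; exact: wmod_ge0|exact: wmod_ge0|].
  apply/cvgrPdist_le => e e0; have [K HK] := fg z e e0.
  exists K => // k /= Kk; rewrite /wmod -mulrBl normrM (ger0_norm (expR_ge0 _)).
  apply: (@le_trans _ _ (normc (f (phi k) z - g z))); last exact: HK.
  rewrite (@le_trans _ _ (`|normc (g z) - normc (f (phi k) z)|))//.
    rewrite ler_piMr// -expR0 ler_expR oppr_le0.
    by rewrite divr_ge0 ?sqr_ge0.
  have t1 := normcD (g z) (f (phi k) z - g z); have t2 := normcB (f (phi k) z) (f (phi k) z - g z).
  rewrite addrC subrK in t1; rewrite opprB addrC subrK in t2.
  by rewrite ler_norml; apply/andP; split; lra.
apply: (@le_lt_trans _ _ M%:E); last exact: ltry.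
have := @fatou _ _ R (dv n) setT measurableT
  (fun k x => (wmod (f (phi k)) (cvec x) `^ p)%:E)
  (fun k => emeas_energy p (fock_cmeas (ff (phi k)))) (fun k x _ => wmod_powE_ge0 p _ _).
have -> : (\int[dv n]_x limn_einf (fun k => (wmod (f (phi k)) (cvec x) `^ p)%:E))%E = energy p g.
  apply: eq_integral => x _.
  rewrite is_cvg_limn_einfE; last by apply/cvg_ex; eexists; exact: cw.
  exact: (cvg_lim _ (cw (cvec x))).
move=> /le_trans; apply; rewrite limn_einf_lim; apply: lime_le; first exact: is_cvg_einfs.
near=> k; apply: le_trans (fM (phi k)).
by apply: ereal_inf_lbound; exists k => //=.
Unshelve. all: end_near. Qed.

End montel.
End extraction.

(** * Averaging over boxes *)

Section boxes.
Context {R : realType} {n : nat}.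
Notation MR := (measurableTypeR R).
Notation Cn := 'rV[R[i]]_n.
Implicit Types (z w c : Cn) (L : R).

Definition box L z : bool :=
  [forall j, (`|complex.Re (z 0 j)| <= L) && (`|complex.Im (z 0 j)| <= L)].

Let ind L (x : MR) : R := \1_(`[- L, L]%classic) x.

Let boxE L x : ((box L (cvec x))%:R : R) =
  \prod_j (ind L (tnth x j).1 * ind L (tnth x j).2).
Proof.
have indE a : ind L a = (`|a| <= L)%R%:R.
  rewrite /ind indicE; congr (_ : bool)%:R.
  by apply/idP/idP; rewrite inE/= in_itv/= ler_norml.
have [/forallP H|/forallPn[j]] := boolP (box L (cvec x)).
  rewrite big1// => j _; have := H j; rewrite mxE/= !indE.
  by move=> /andP[-> ->]; rewrite mulr1.
rewrite mxE/= (bigD1 j)//= !indE => /nandP[]/negbTE ->; by rewrite ?mulr0 !mul0r.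
Qed.

Let mind L : measurable_fun [set: MR] (ind L : MR -> MR).
Proof. exact: measurable_indic. Qed.

Let mind2 L : measurable_fun [set: MR * MR] (fun a : MR * MR => ind L a.1 * ind L a.2 : MR).
Proof.
apply: measurable_funM.
  exact: (measurableT_comp (@mind L)).
exact: (measurableT_comp (@mind L)).
Qed.

Lemma bmeas_box L : bmeas (box L).
Proof.
rewrite /bmeas /rmeas; under [X in measurable_fun _ X]funext do rewrite boxE.
exact: (measurable_prod_tnth (g := fun a : MR * MR => ind L a.1 * ind L a.2) (mind2 L)).
Qed.

Lemma bmeas_box_shift L c : bmeas (fun z => box L (c - z)).
Proof.
have := rmeas_shift (- c) (bmeas_box L); congr rmeas; apply/funext => z.
congr (nat_of_bool _)%:R; rewrite -opprB /box.
by apply/eq_forallb => j; rewrite !mxE !ReN !ImN !normrN.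
Qed.

Definition box_volume L : R := (4 * L ^+ 2 / pi) ^+ n.

Lemma box_volume_gt0 L : 0 < L -> 0 < box_volume L.
Proof. by move=> L0; rewrite exprn_gt0// divr_gt0 ?pi_gt0// mulr_gt0// exprn_gt0. Qed.

Lemma box_volume_double L : box_volume (2 * L) = 4 ^+ n * box_volume L.
Proof. by rewrite /box_volume -exprMn; congr (_ ^+ n); rewrite exprMn !mulrA; ring. Qed.

(** The factor [pi^-n] is the normalization of [dv]. *)
Lemma nint_box L : 0 < L -> nint (fun z => ((box L z)%:R)%:E) = (box_volume L)%:E.
Proof.
move=> L0; rewrite /nint /dv; under eq_integral do rewrite boxE.
have ind0 a : 0 <= ind L a by rewrite /ind.
have iL : (\int[@lebesgue_measure R]_a (ind L a)%:E = (2 * L)%:E)%E.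
  rewrite /ind integral_indic// setIT.
  have := @lebesgue_measure_itv R `[- L, L]; rewrite /= lte_fin => ->.
  by rewrite gtrN// -EFinD opprK -mulr2n mulr_natl.
apply: (@integral_tuple_prod_pow R _ _ (@area R) n
  (fun a : MR * MR => ind L a.1 * ind L a.2)); first exact: mind2.
  by move=> x; rewrite mulr_ge0.
rewrite ge0_integral_mscale//=; last 2 first.
- by apply/measurable_EFinP; exact: mind2.
- by move=> x _; rewrite lee_fin mulr_ge0.
rewrite (@fubini_tonelli_prod _ _ _ _ R lebesgue_measure lebesgue_measure (ind L) (ind L)
  (mind L) ind0 (mind L) ind0).
rewrite iL -!EFinM; congr EFin; ring.
Qed.

Lemma box_near L c w z : box L (c - w) -> box (2 * L) (c - z) ->
  enorm (z - w) <= 6 * L * n%:R.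
Proof.
move=> /forallP bw /forallP bz.
rewrite (le_trans (enorm_le_sum _))//.
apply: (@le_trans _ _ (\sum_(j < n) 6 * L)); last first.
  by rewrite sumr_const card_ord mulr_natr.
apply: ler_sum => j _; apply: (le_trans (normc_le_ReIm _)).
have /andP[] := bw j; have /andP[] := bz j.
rewrite !mxE !ReD !ImD !ReN !ImN !ler_norml => /andP[? ?] /andP[? ?] /andP[? ?] /andP[? ?].
have -> : 6 * L = 3 * L + 3 * L by ring.
by apply: lerD; rewrite ler_norml; apply/andP; split; lra.
Qed.

Lemma box_far L c w z : box L (c - w) -> ~~ box (2 * L) (c - z) -> L <= enorm (w - z).
Proof.
move=> /forallP bw /forallPn[j].
apply: contraNT; rewrite -ltNge => wz.
have wj := le_lt_trans (normc_le_enorm (w - z) j) wz.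
have r1 := le_lt_trans (Re_le_normc _) wj; have r2 := le_lt_trans (Im_le_normc _) wj.
have /andP[] := bw j; move: r1 r2.
rewrite !mxE !ReD !ImD !ReN !ImN !ler_norml !ltr_norml.
by move=> /andP[? ?] /andP[? ?] /andP[? ?] /andP[? ?]; apply/andP; split; apply/andP; split; lra.
Qed.

(** Integrate over [c]: by Tonelli each side becomes a product with the volume of a
    box, and the ratio [4^n] of the volumes does not depend on [L]. *)
Lemma box_average L (F D G : Cn -> R) (a : R) : 0 < L -> 0 <= a ->
  rmeas F -> rmeas D -> rmeas G ->
  (forall z, 0 <= F z) -> (forall z, 0 <= D z) -> (forall z, 0 <= G z) ->
  (forall c, (nint (fun w => (F w)%:E * ((box L (c - w))%:R)%:E) <=
     nint (fun w => (D w)%:E * ((box L (c - w))%:R)%:E) +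
     a%:E * nint (fun z => (G z)%:E * ((box (2 * L) (c - z))%:R)%:E))%E) ->
  (nint (fun w => (F w)%:E) <=
     nint (fun w => (D w)%:E) + (a * 4 ^+ n)%:E * nint (fun z => (G z)%:E))%E.
Proof.
move=> L0 a0 mF mD mG F0 D0 G0 H.
have V0 := box_volume_gt0 L0.
have L2 : 0 < 2 * L by rewrite mulr_gt0.
have mb l : emeas (fun z : Cn => ((box l z)%:R)%:E) := rmeas_emeas (@bmeas_box l).
have b0 l (z : Cn) : (0 <= ((box l z)%:R)%:E :> \bar R)%E by rewrite lee_fin.
have mc l (f : Cn -> R) : rmeas f -> (forall z, 0 <= f z) ->
    emeas (fun c => nint (fun w => (f w)%:E * ((box l (c - w))%:R)%:E)%E).
  move=> mf f0; apply: (emeas_nint (F := fun c w => ((f w)%:E * ((box l (c - w))%:R)%:E)%E)).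
    by apply: emeas2M; [exact: (emeas2_snd (rmeas_emeas mf))|exact: (emeas2_sub (mb l))].
  by move=> c w; rewrite mule_ge0// lee_fin.
have c0 l (f : Cn -> R) : (forall z, 0 <= f z) -> forall c,
    (0 <= nint (fun w => (f w)%:E * ((box l (c - w))%:R)%:E))%E.
  by move=> f0 c; apply: nint_ge0 => w; rewrite mule_ge0// lee_fin.
have swap l (f : Cn -> R) : 0 < l -> rmeas f -> (forall z, 0 <= f z) ->
    nint (fun c => nint (fun w => (f w)%:E * ((box l (c - w))%:R)%:E)%E) =
    (nint (fun w => (f w)%:E) * (box_volume l)%:E)%E.
  move=> l0 mf f0; rewrite -(nint_box l0).
  exact: (nint_swap_conv (rmeas_emeas mf) (mb l) (fun z => f0 z) (b0 l)).
have aE : (0 <= a%:E)%E by rewrite lee_fin.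
have maG : emeas (fun c => a%:E * nint (fun z => (G z)%:E * ((box (2 * L) (c - z))%:R)%:E))%E.
  by apply: measurable_funeM; exact: mc.
have := le_nint (mc L F mF F0) _ (c0 L F F0) H.
have mR : emeas (fun c => nint (fun w => (D w)%:E * ((box L (c - w))%:R)%:E) +
   a%:E * nint (fun z => (G z)%:E * ((box (2 * L) (c - z))%:R)%:E))%E.
  by apply: emeasurable_funD; [exact: mc|exact: maG].
move=> /(_ mR); rewrite (nintD (mc L D mD D0) maG (c0 L D D0)); last first.
  by move=> c; rewrite mule_ge0// c0.
rewrite (nintZ (mc _ G mG G0) (c0 _ G G0) aE) !swap// box_volume_double => h.
have dD : (0 <= nint (fun w => (D w)%:E))%E by apply: nint_ge0 => z; rewrite lee_fin.
have dG : (0 <= nint (fun w => (G w)%:E))%E by apply: nint_ge0 => z; rewrite lee_fin.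
move: h dD dG; move: (nint (fun w => (F w)%:E)) (nint (fun w => (D w)%:E))
  (nint (fun w => (G w)%:E)) => x d g h d0 g0.
rewrite -(@lee_pmul2r _ (box_volume L)%:E)//.
apply: (le_trans h); rewrite ge0_muleDl//; last by rewrite mule_ge0// lee_fin mulr_ge0// exprn_ge0.
rewrite leeD2l// !EFinM -!muleA (muleCA g).
by rewrite (muleC g) !muleA.
Qed.

End boxes.

(** * Near and far parts of an operator *)

Section compactness.
Context {R : realType} {n : nat}.
Notation Cn := 'rV[R[i]]_n.
Implicit Types (f g u : Cn -> R[i]) (z w c : Cn).
Variable p : R.
Hypothesis p1 : 1 < p.

Let p0 : 0 < p. Proof. exact: lt_trans p1. Qed.

Lemma small_powR (a e : R) : 0 <= a -> 0 < e -> exists2 t, 0 < t & a * t `^ p <= e.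
Proof.
move=> a0 e0; have a1 : 0 < a + 1 by rewrite ltr_wpDl.
exists ((e / (a + 1)) `^ p^-1); first by rewrite powR_gt0// divr_gt0.
rewrite -powRrM mulVf ?gt_eqF// powRr1; last by rewrite divr_ge0 ?(ltW e0) ?(ltW a1).
by rewrite mulrCA ler_piMr ?(ltW e0)// ler_pdivrMr// mul1r lerDl.
Qed.

Lemma nint_ball_le (r : R) : 0 <= r ->
  (nint (fun z : Cn => ((enorm z <= r)%R%:R)%:E) <= (expR (r ^+ 2))%:E)%E.
Proof.
move=> r0; rewrite -[leRHS]mule1 -(@nint_gauss R n).
have e0 : (0 <= (expR (r ^+ 2))%:E)%E by rewrite lee_fin expR_ge0.
rewrite -(nintZ (rmeas_emeas rmeas_gauss)) => [|z|//]; last by rewrite lee_fin gauss_ge0.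
apply: le_nint.
- exact: (rmeas_emeas (bmeas_le r rmeas_enorm)).
- exact: (rmeas_emeas (rmeasM (rmeas_cst _) rmeas_gauss)).
- by move=> z; rewrite lee_fin.
move=> z; rewrite -EFinM lee_fin /gauss -expRD.
have [zr|_] := leP (enorm z) r; last exact: expR_ge0.
by rewrite -expR0 ler_expR subr_ge0 ler_pXn2r ?nnegrE ?enorm_ge0.
Qed.

(** Bounds the kernel of a localized operator at distance at least [L] from the
    diagonal. *)
Definition tail (C b L : R) z : R := C * (1 + enorm z) `^ (- b) * (L <= enorm z)%R%:R.

Lemma tail_ge0 C b L z : 0 <= C -> 0 <= tail C b L z.
Proof. by move=> C0; rewrite !mulr_ge0 ?powR_ge0. Qed.

Lemma rmeas_tail C b L : rmeas (tail C b L : Cn -> R).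
Proof.
apply: (rmeasM (rmeasM (rmeas_cst C) (rmeas_powR (- b) (rmeasD (rmeas_cst 1) rmeas_enorm)))).
have := bmeas_le (- L) (rmeasM (rmeas_cst (-1)) (@rmeas_enorm R n)).
by congr rmeas; apply/funext => z; rewrite mulN1r lerN2.
Qed.

Lemma tail_null (C b e : R) : 0 <= C -> 2 * n%:R < b -> 0 < e ->
  exists2 L : R, 0 < L & (nint (fun z : Cn => (tail C b L z)%:E) <= e%:E)%E.
Proof.
move=> C0 nb e0.
have md : rmeas (fun z : Cn => (1 + enorm z) `^ (- b)).
  exact: (rmeas_powR (- b) (rmeasD (rmeas_cst 1) rmeas_enorm)).
have CE : (0 <= C%:E)%E by rewrite lee_fin.
have [] := @nint_null R n (fun m => tail C b m.+1%:R)
  (fun z => C * (1 + enorm z) `^ (- b)) _ _ _ _ _ e e0.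
- by move=> m; exact: rmeas_tail.
- exact: (rmeasM (rmeas_cst C) md).
- under eq_nint do rewrite EFinM.
  rewrite (nintZ (rmeas_emeas md)) => [|z|//]; last by rewrite lee_fin powR_ge0.
  by rewrite lte_mul_pinfty//; exact: nint_decay.
- move=> m z; rewrite tail_ge0//= ler_piMr ?mulr_ge0 ?powR_ge0//.
  by rewrite (ler_nat _ _ 1) leq_b1.
- move=> z d d0; exists (Num.truncn (enorm z)).+1 => m zm.
  have h : enorm z < m.+1%:R.
    by rewrite (lt_trans (truncnS_gt (enorm z)))// ltr_nat ltnS.
  by rewrite /tail (leNgt m.+1%:R) h mulr0; exact: ltW.
by move=> K HK; exists K.+1%:R => //; exact: HK.
Qed.

Lemma nkernel_span z : kernel_span (nkernel z : Cn -> R[i]).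
Proof.
exists 1%N, (fun=> (expR (- (enorm z ^+ 2 / 2)))%:C), (fun=> z).
by apply/funext => w; rewrite big_ord1 nkernelE.
Qed.

(** [S] and the operator that it extends agree on the normalized kernels, which are the
    only functions that the localization condition tests. *)
Lemma localized_tkernel S : sufficiently_localized_on p%:E S ->
  bounded_op p%:E S /\ exists b C : R, [/\ 2 * n%:R < b, 0 <= C &
    forall z w, tkernel S z w <= C * (1 + enorm (w - z)) `^ (- b)].
Proof.
move=> [bS [S' [_ [b [C [nb C0 H]]]] SS']]; split=> //; exists b, C.
split=> //; first exact: ltW.
move=> z w; rewrite -(tkernel_pairing p1 z w bS) SS'; last exact: nkernel_span.
by rewrite powRN -(enormC z w); exact: H.
Qed.

Variable T : (Cn -> R[i]) -> (Cn -> R[i]).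
Hypothesis bT : bounded_op p%:E T.

(** With [f = P u + P v], where [u] is the part of [f] in the box of size [2 L]
    around [c], one has [T f = T P u + S P v + E f - E P u] for [E = T - S]. In
    [T P u] only the kernel of [T] near the diagonal occurs, which is at most [d]
    unless [w] is in a fixed ball; in [S P v] only the kernel of [S] far from the
    diagonal. Except for [E P u], the bound does not depend on [c]. *)
Lemma local_estimate S f (b C CT d L R0 : R) c w :
  bounded_op p%:E S -> fock p%:E f -> 0 <= C -> 0 <= CT -> 0 <= d ->
  (forall z w, tkernel S z w <= C * (1 + enorm (w - z)) `^ (- b)) ->
  (forall z w, tkernel T z w <= CT) ->
  (forall z w, R0 < enorm w -> enorm (z - w) <= 6 * L * n%:R -> tkernel T z w <= d) ->
  box L (c - w) ->
  ((wmod (T f) w)%:E <=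
    2%:E * nint (fun z => (wmod f z * (d * (enorm (w - z) <= 6 * L * n%:R)%R%:R +
                                      tail C b L (w - z)))%:E) +
    (2 * CT * (enorm w <= R0)%R%:R)%:E *
      nint (fun z => (wmod f z * (enorm z <= R0 + 6 * L * n%:R)%R%:R)%:E) +
    (wmod (fun z => T f z - S f z) w +
     wmod (fun z => T (transform (restr (fun z => box (2 * L) (c - z)) f)) z -
       S (transform (restr (fun z => box (2 * L) (c - z)) f)) z) w)%:E)%E.
Proof.
move=> bS ff C0 CT0 d0 SC TC Td cw.
set rho := 6 * L * n%:R.
pose bx z := box (2 * L) (c - z).
have mf := fock_cmeas ff; have fy := fock_energy p1 ff.
have mbx : bmeas bx := bmeas_box_shift (2 * L) c.
have mcbx : bmeas (fun z => ~~ bx z) := bmeasC mbx.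
pose u := restr bx f; pose v := restr (fun z => ~~ bx z) f.
have mu : cmeas u := cmeas_restr mbx mf; have mv : cmeas v := cmeas_restr mcbx mf.
have uy : (energy p u < +oo)%E.
  by apply: le_lt_trans fy; apply: (le_energy (ltW p0) mu mf) => z; exact: wmod_restr_le.
have vy : (energy p v < +oo)%E.
  by apply: le_lt_trans fy; apply: (le_energy (ltW p0) mv mf) => z; exact: wmod_restr_le.
have fu := fock_transform p1 mu uy; have fv := fock_transform p1 mv vy.
have fE : f = fun z => transform u z + transform v z.
  apply/funext => y; have tf := fock_tame (ltW p1) ff.
  rewrite -(reproducing y (fock_entire ff) tf) /transform.
  have c1 := tame_cintegrable (energy_tame (ltW p1) mu uy) (cmeas_rkernel y) ler01 (fun z => rkernel_le z y).
  have c2 := tame_cintegrable (energy_tame (ltW p1) mv vy) (cmeas_rkernel y) ler01 (fun z => rkernel_le z y).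
  rewrite -cintegralD//; apply: eq_cintegral => z.
  by rewrite /u /v /restr; case: (bx z); rewrite !mul0r ?addr0 ?add0r.
have TE : T f = fun z => T (transform u) z + T (transform v) z.
  by rewrite {1}fE (bounded_opD bT fu fv).
have SE : S f = fun z => S (transform u) z + S (transform v) z.
  by rewrite {1}fE (bounded_opD bS fu fv).
pose e1 z := T f z - S f z; pose e2 z := T (transform u) z - S (transform u) z.
have main : wmod (T f) w <= wmod (T (transform u)) w + wmod (S (transform v)) w +
    (wmod e1 w + wmod e2 w).
  rewrite /wmod -!mulrDl ler_wpM2r ?expR_ge0//.
  have -> : T f w = (T (transform u) w + S (transform v) w) + (e1 w - e2 w).
    by rewrite /e1 /e2 SE; ring.
  by rewrite (le_trans (normcD _ _))// lerD ?normcD ?normcB.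
pose ball1 z : R := (enorm (w - z) <= rho)%R%:R.
pose ball2 z : R := (enorm z <= R0 + rho)%R%:R.
pose a : R := CT * (enorm w <= R0)%R%:R.
have a0 : 0 <= a by rewrite mulr_ge0.
have mball1 : rmeas ball1.
  rewrite /ball1; under [X in rmeas X]funext do rewrite enormC.
  exact: (bmeas_le rho (rmeas_enormB w)).
have mball2 : rmeas ball2 := bmeas_le (R0 + rho) rmeas_enorm.
have mtail : rmeas (fun z => tail C b L (w - z)).
  have := rmeas_shift (- w) (rmeas_tail C b L); congr rmeas; apply/funext => z.
  by rewrite /tail enormC.
have ball10 z : 0 <= ball1 z by [].
have ball20 z : 0 <= ball2 z by [].
have mk1 : rmeas (fun z => d * ball1 z + a * ball2 z).
  exact: (rmeasD (rmeasM (rmeas_cst d) mball1) (rmeasM (rmeas_cst a) mball2)).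
have Tu := @kernel_bound R n p p1 T bT u (fun z => d * ball1 z + a * ball2 z) w mu uy mk1.
have {}Tu : ((wmod (T (transform u)) w)%:E <= 2%:E *
    nint (fun z => (wmod u z * (d * ball1 z + a * ball2 z))%:E))%E.
  apply: Tu => [z|z]; first by rewrite addr_ge0// mulr_ge0.
  rewrite /u /restr; case: ifP; last by rewrite eqxx.
  move=> bz _; have near := box_near cw bz; rewrite -/rho in near.
  have -> : ball1 z = 1 by rewrite /ball1 enormC near.
  rewrite mulr1 /a; have [wR|wR] := leP (enorm w) R0; last first.
    by rewrite mulr0 mul0r addr0 Td.
  have -> : ball2 z = 1.
    rewrite /ball2 (_ : (_ <= _) = true)//.
    by rewrite -(subrK w z) (le_trans (enormD _ _))// addrC lerD.
  by rewrite !mulr1 (le_trans (TC z w))// lerDr.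
have Sv : ((wmod (S (transform v)) w)%:E <= 2%:E *
    nint (fun z => (wmod v z * tail C b L (w - z))%:E))%E.
  apply: (kernel_bound p1 bS mv vy mtail) => [z|z]; first exact: tail_ge0.
  rewrite /v /restr; case: ifP; last by rewrite eqxx.
  move=> bz _; have far := box_far cw bz.
  by rewrite /tail far mulr1.
have up (h : Cn -> R[i]) (k : Cn -> R) : cmeas h -> rmeas k -> (forall z, 0 <= k z) ->
    (forall z, wmod h z <= wmod f z) ->
    (nint (fun z => (wmod h z * k z)%:E) <= nint (fun z => (wmod f z * k z)%:E))%E.
  move=> mh mk k0 hf; apply: le_nint.
  - exact: (rmeas_emeas (rmeasM (rmeas_wmod mh) mk)).
  - exact: (rmeas_emeas (rmeasM (rmeas_wmod mf) mk)).
  - by move=> z; rewrite lee_fin mulr_ge0 ?wmod_ge0.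
  - by move=> z; rewrite lee_fin ler_wpM2r.
have two0 : (0 <= 2%:E :> \bar R)%E by rewrite lee_fin.
have {}Tu := le_trans Tu (lee_wpmul2l two0 (up _ _ mu mk1
  (fun z => addr_ge0 (mulr_ge0 d0 (ball10 z)) (mulr_ge0 a0 (ball20 z)))
  (fun z => wmod_restr_le _ _ _))).
have {}Sv := le_trans Sv (lee_wpmul2l two0 (up _ _ mv mtail
  (fun z => tail_ge0 _ _ _ C0) (fun z => wmod_restr_le _ _ _))).
have i1 : emeas (fun z => (wmod f z * (d * ball1 z))%:E).
  exact: (rmeas_emeas (rmeasM (rmeas_wmod mf) (rmeasM (rmeas_cst d) mball1))).
have i2 : emeas (fun z => (wmod f z * ball2 z)%:E).
  exact: (rmeas_emeas (rmeasM (rmeas_wmod mf) mball2)).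
have i2a : emeas (fun z => (a%:E * (wmod f z * ball2 z)%:E)%E).
  exact: (rmeas_emeas (rmeasM (rmeas_cst a) (rmeasM (rmeas_wmod mf) mball2))).
have i3 : emeas (fun z => (wmod f z * tail C b L (w - z))%:E).
  exact: (rmeas_emeas (rmeasM (rmeas_wmod mf) mtail)).
have w1 z : (0 <= (wmod f z * (d * ball1 z))%:E)%E.
  by rewrite lee_fin; apply: mulr_ge0; [exact: wmod_ge0|exact: mulr_ge0].
have w2 z : (0 <= (wmod f z * ball2 z)%:E)%E.
  by rewrite lee_fin; apply: mulr_ge0; [exact: wmod_ge0|].
have w3 z : (0 <= (wmod f z * tail C b L (w - z))%:E)%E.
  by rewrite lee_fin mulr_ge0 ?wmod_ge0// tail_ge0.
have aE : (0 <= a%:E)%E by rewrite lee_fin.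
have Tsplit : nint (fun z => (wmod f z * (d * ball1 z + a * ball2 z))%:E) =
   (nint (fun z => (wmod f z * (d * ball1 z))%:E) +
    a%:E * nint (fun z => (wmod f z * ball2 z)%:E))%E.
  rewrite -(nintZ i2 w2 aE) -(nintD i1 i2a w1) => [|z]; last by rewrite mule_ge0.
  by apply: eq_nint => z; rewrite -EFinM -EFinD; congr EFin; ring.
have Ksplit : nint (fun z => (wmod f z * (d * ball1 z + tail C b L (w - z)))%:E) =
   (nint (fun z => (wmod f z * (d * ball1 z))%:E) +
    nint (fun z => (wmod f z * tail C b L (w - z))%:E))%E.
  rewrite -(nintD i1 i3 w1 w3).
  by apply: eq_nint => z; rewrite -EFinD; congr EFin; ring.
apply: (@le_trans _ _ ((wmod (T (transform u)) w)%:E + (wmod (S (transform v)) w)%:E +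
    (wmod e1 w + wmod e2 w)%:E)%E).
  by rewrite -!EFinD lee_fin.
apply: leeD => //; rewrite -/rho -/(ball1 _) Ksplit.
apply: (le_trans (leeD Tu Sv)); rewrite Tsplit.
have n1 := nint_ge0 w1; have n2 := nint_ge0 w2; have n3 := nint_ge0 w3.
move: n1 n2 n3; move: (nint _) (nint _) (nint _) => x y t x0 t0 y0.
rewrite !ge0_muleDr ?mule_ge0// -!addeA leeD2l// addeC leeD2l//.
by rewrite muleA -EFinM mulrA.
Qed.

End compactness.

(** * From pointwise to norm convergence *)

Section weak_to_strong.
Context {R : realType} {n : nat}.
Notation Cn := 'rV[R[i]]_n.
Implicit Types (f g u : Cn -> R[i]) (z w c : Cn).
Variable p : R.
Hypothesis p1 : 1 < p.
Variable T : (Cn -> R[i]) -> (Cn -> R[i]).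
Hypothesis bT : bounded_op p%:E T.

Let p0 : 0 < p. Proof. exact: lt_trans p1. Qed.

Let Y : R := 4 `^ p * ghalf_mass (R := R) (n := n) `^ p.

Let Y0 : 0 <= Y. Proof. by rewrite mulr_ge0 ?powR_ge0. Qed.

(** The term [E P u] depends on [c]; averaged over [c], the energies of [u] add up to
    the energy of [f] times the volume of a box, so nothing is lost in [L]. The
    other terms are convolutions or supported in a ball. *)
Lemma energy_estimate S f (b C CT d L R0 e m A C' : R) :
  bounded_op p%:E S -> fock p%:E f -> 0 <= C -> 0 <= CT -> 0 <= d -> 0 < L -> 0 <= R0 ->
  0 < m -> 0 <= A -> 0 <= e -> 0 <= C' ->
  (forall z w, tkernel S z w <= C * (1 + enorm (w - z)) `^ (- b)) ->
  (forall z w, tkernel T z w <= CT) ->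
  (forall z w, R0 < enorm w -> enorm (z - w) <= 6 * L * n%:R -> tkernel T z w <= d) ->
  (forall g, fock p%:E g ->
    (energy p (fun z => (T g z - S g z)%R) <= (e `^ p)%:E * energy p g)%E) ->
  (nint (fun z : Cn => (d * (enorm z <= 6 * L * n%:R)%R%:R + tail C b L z)%:E) <= m%:E)%E ->
  (nint (fun z => (wmod f z * (enorm z <= R0 + 6 * L * n%:R)%R%:R)%:E) <= A%:E)%E ->
  (forall z, wmod f z <= C') ->
  (energy p (T f) <= (4 `^ p)%:E * ((4 `^ p * m `^ p)%:E * energy p f +
     ((2 * CT * A) `^ p * expR (R0 ^+ 2))%:E +
     (e `^ p * (1 + Y * 4 ^+ n))%:E * energy p f))%E.
Proof.
move=> bS ff C0 CT0 d0 L0 R00 m0 A0 e0 C'0 SC TC Td ES km fA fC'.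
have mf := fock_cmeas ff; have fy := fock_energy p1 ff.
have mTf := fock_cmeas (bounded_fock bT ff).
pose rho := 6 * L * n%:R.
pose k z : R := d * (enorm z <= rho)%R%:R + tail C b L z.
have k0 z : 0 <= k z by rewrite addr_ge0 ?tail_ge0// mulr_ge0.
have keven z w : k (z - w) = k (w - z) by rewrite /k /tail enormC.
have mk : rmeas (k : Cn -> R).
  exact: (rmeasD (rmeasM (rmeas_cst d) (bmeas_le rho rmeas_enorm)) (rmeas_tail C b L)).
have mkw w : rmeas (fun z => k (w - z)).
  under [X in rmeas X]funext do rewrite keven.
  exact: (rmeas_shift (- w) mk).
pose X w := nint (fun z => ((wmod f z)%:E * (k (w - z))%:E)%E).
have X0 w : (0 <= X w)%E by apply: nint_ge0 => z; rewrite mule_ge0 ?lee_fin ?wmod_ge0.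
have Xfin w : X w = (fine (X w))%:E.
  rewrite fineK// ge0_fin_numE//.
  apply: (@le_lt_trans _ _ (C'%:E * m%:E)%E); last by rewrite -EFinM ltry.
  have C'E : (0 <= C'%:E)%E by rewrite lee_fin.
  have kw0 z : (0 <= (k (w - z))%:E)%E by rewrite lee_fin.
  have kint : (nint (fun z => (k (w - z))%:E) <= m%:E)%E.
    under eq_nint do rewrite keven.
    by rewrite (nint_shift (- w) (rmeas_emeas mk)) => [//|z]; rewrite lee_fin.
  apply: le_trans (lee_wpmul2l C'E kint).
  rewrite -(nintZ (rmeas_emeas (mkw w)) kw0 C'E); apply: le_nint.
  - exact: (rmeas_emeas (rmeasM (rmeas_wmod mf) (mkw w))).
  - exact: (rmeas_emeas (rmeasM (rmeas_cst C') (mkw w))).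
  - by move=> z; rewrite mule_ge0 ?lee_fin ?wmod_ge0.
  - by move=> z; rewrite -!EFinM lee_fin ler_wpM2r.
pose x w := fine (X w).
have x0 w : 0 <= x w by rewrite fine_ge0.
have mx : rmeas x.
  have mX : emeas X.
    apply: (emeas_nint (F := fun w z => ((wmod f z)%:E * (k (w - z))%:E)%E)).
      by apply: emeas2M; [exact: (emeas2_snd (rmeas_emeas (rmeas_wmod mf)))
        |exact: (emeas2_sub (rmeas_emeas mk))].
    by move=> z w; rewrite mule_ge0 ?lee_fin ?wmod_ge0.
  apply/measurable_EFinP; move: mX; rewrite /emeas; congr measurable_fun.
  by apply/funext => y; rewrite Xfin.
pose E g z := T g z - S g z.
have fE g : fock p%:E g -> fock p%:E (E g).
  by move=> fg; apply: fockB => //; exact: bounded_fock.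
pose a : R := 2 * CT * A.
have a0 : 0 <= a by rewrite !mulr_ge0.
pose y w : R := a * (enorm w <= R0)%R%:R.
have y0 w : 0 <= y w by rewrite mulr_ge0.
pose D w := 4 `^ p * ((2 * x w) `^ p + a `^ p * (enorm w <= R0)%R%:R + wmod (E f) w `^ p).
have mEf := fock_cmeas (fE f ff).
have mball : rmeas (fun w : Cn => (enorm w <= R0)%R%:R : R) := bmeas_le R0 rmeas_enorm.
have mD1 := rmeas_powR p (rmeasM (rmeas_cst 2) mx).
have mD2 := rmeasM (rmeas_cst (a `^ p)) mball.
have mD3 := rmeas_powR p (rmeas_wmod mEf).
have mDs := rmeasD (rmeasD mD1 mD2) mD3.
have mD : rmeas D := rmeasM (rmeas_cst (4 `^ p)) mDs.
have D0 w : 0 <= D w by rewrite mulr_ge0 ?addr_ge0 ?mulr_ge0 ?powR_ge0.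
have mTp := rmeas_powR p (rmeas_wmod mTf); have mfp := rmeas_powR p (rmeas_wmod mf).
have P4 : 0 <= 4 `^ p * (e `^ p * Y) by rewrite !mulr_ge0 ?powR_ge0.
have := @box_average R n L (fun w => wmod (T f) w `^ p) D (fun z => wmod f z `^ p)
  (4 `^ p * (e `^ p * Y)) L0 P4 mTp mD mfp (fun z => powR_ge0 _ _) D0 (fun z => powR_ge0 _ _).
have avg c : (nint (fun w => (wmod (T f) w `^ p)%:E * ((box L (c - w))%:R)%:E) <=
    nint (fun w => (D w)%:E * ((box L (c - w))%:R)%:E) +
    (4 `^ p * (e `^ p * Y))%:E *
      nint (fun z => (wmod f z `^ p)%:E * ((box (2 * L) (c - z))%:R)%:E))%E.
  pose bx z := box (2 * L) (c - z).
  have mbox l : bmeas (fun z : Cn => box l (c - z)) := bmeas_box_shift l c.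
  have mbx : bmeas bx := mbox _.
  pose u := restr bx f.
  have mu : cmeas u := cmeas_restr mbx mf.
  have uy : (energy p u < +oo)%E.
    by apply: le_lt_trans fy; apply: (le_energy (ltW p0) mu mf) => z; exact: wmod_restr_le.
  have fu := fock_transform p1 mu uy.
  pose g := E (transform u).
  have mg : cmeas g := fock_cmeas (fE _ fu).
  have mgp := rmeas_powR p (rmeas_wmod mg).
  have P0 : (0 <= (4 `^ p)%:E)%E by rewrite lee_fin powR_ge0.
  have Pe : (0 <= (e `^ p)%:E)%E by rewrite lee_fin powR_ge0.
  apply: (@le_trans _ _ (nint (fun w => (D w)%:E * ((box L (c - w))%:R)%:E +
      (4 `^ p)%:E * (wmod g w `^ p)%:E)%E)); last first.
    have iD : emeas (fun w => ((D w)%:E * ((box L (c - w))%:R)%:E)%E).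
      exact: (rmeas_emeas (rmeasM mD (mbox L))).
    have ig : emeas (fun w => ((4 `^ p)%:E * (wmod g w `^ p)%:E)%E).
      exact: (rmeas_emeas (rmeasM (rmeas_cst (4 `^ p)) mgp)).
    rewrite (nintD iD ig) => [|w|w]; last 2 first.
    - by rewrite -EFinM lee_fin mulr_ge0.
    - by rewrite mule_ge0 ?wmod_powE_ge0.
    rewrite leeD2l// (nintZ (rmeas_emeas mgp) (wmod_powE_ge0 p g) P0).
    rewrite [in leRHS]EFinM -muleA lee_wpmul2l//.
    rewrite (le_trans (ES _ fu))// EFinM -muleA lee_wpmul2l//.
    rewrite (le_trans (energy_transform p1 mu uy))// lee_wpmul2l ?lee_fin//.
    rewrite le_eqVlt; apply/orP; left; apply/eqP; apply: eq_nint => z.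
    by rewrite wmod_restr_pow ?gt_eqF// -EFinM mulrC.
  apply: le_nint.
  - exact: (rmeas_emeas (rmeasM mTp (mbox L))).
  - exact: (rmeas_emeas (rmeasD (rmeasM mD (mbox L)) (rmeasM (rmeas_cst (4 `^ p)) mgp))).
  - by move=> w; rewrite -EFinM lee_fin mulr_ge0 ?powR_ge0.
  move=> w; rewrite -!EFinM -EFinD lee_fin.
  have [cw|_] := boolP (box L (c - w)); last first.
    by rewrite !mulr0 add0r mulr_ge0 ?powR_ge0.
  rewrite !mulr1.
  have := @local_estimate R n p p1 T bT S f b C CT d L R0 c w bS ff C0 CT0 d0 SC TC Td cw.
  have -> : nint (fun z => (wmod f z * (d * (enorm (w - z) <= 6 * L * n%:R)%R%:R +
      tail C b L (w - z)))%:E) = (x w)%:E.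
    by rewrite /x -Xfin; apply: eq_nint => z; rewrite -EFinM.
  move=> h.
  have {h} : wmod (T f) w <= 2 * x w + y w + wmod (E f) w + wmod g w.
    rewrite -lee_fin (le_trans h)// !EFinD -!addeA EFinM leeD2l// leeD2r//.
    rewrite /y /a.
    have q0 : (0 <= (2 * CT * (enorm w <= R0)%R%:R)%:E)%E by rewrite lee_fin !mulr_ge0.
    rewrite (le_trans (lee_wpmul2l q0 fA))// -EFinM lee_fin.
    by rewrite mulrAC.
  have x20 : 0 <= 2 * x w by rewrite mulr_ge0.
  move=> /(le_powR (ltW p0) (wmod_ge0 _ _))/le_trans; apply.
  apply: (le_trans (powRD4_le (ltW p0) x20 (y0 w) (wmod_ge0 _ w) (wmod_ge0 g w))).
  rewrite [leLHS]mulrDr lerD2r ler_wpM2l ?powR_ge0// lerD2r lerD2l /y.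
  by case: (enorm w <= R0); rewrite ?mulr1 ?mulr0 ?powR0 ?gt_eqF.
move=> /(_ avg) /le_trans; apply.
have P0 : (0 <= (4 `^ p)%:E)%E by rewrite lee_fin powR_ge0.
have e1 : emeas (fun w => ((2 * x w) `^ p)%:E) := rmeas_emeas mD1.
have e2 : emeas (fun w => (a `^ p * (enorm w <= R0)%R%:R)%:E) := rmeas_emeas mD2.
have n1 w : (0 <= ((2 * x w) `^ p)%:E)%E by rewrite lee_fin powR_ge0.
have n2 w : (0 <= (a `^ p * (enorm w <= R0)%R%:R)%:E)%E.
  by rewrite lee_fin mulr_ge0 ?powR_ge0.
have nD : nint (fun w => (D w)%:E) = ((4 `^ p)%:E *
    (nint (fun w => ((2 * x w) `^ p)%:E) +
     nint (fun w => (a `^ p * (enorm w <= R0)%R%:R)%:E) + energy p (E f)))%E.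
  have e12 : emeas (fun w => ((2 * x w) `^ p)%:E + (a `^ p * (enorm w <= R0)%R%:R)%:E)%E.
    exact: (rmeas_emeas (rmeasD mD1 mD2)).
  have n12 w : (0 <= ((2 * x w) `^ p)%:E + (a `^ p * (enorm w <= R0)%R%:R)%:E)%E.
    by rewrite adde_ge0.
  rewrite -(nintD e1 e2 n1 n2) /energy.
  rewrite -(nintD e12 (emeas_energy p mEf) n12 (wmod_powE_ge0 p _)).
  have e123 : emeas (fun w => ((2 * x w) `^ p)%:E + (a `^ p * (enorm w <= R0)%R%:R)%:E +
      (wmod (E f) w `^ p)%:E)%E by exact: (rmeas_emeas mDs).
  by rewrite -(nintZ e123) => [//|w|//]; rewrite adde_ge0 ?wmod_powE_ge0.
rewrite nD.
have y1 : (nint (fun w => ((2 * x w) `^ p)%:E) <= (4 `^ p * m `^ p)%:E * energy p f)%E.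
  have := @young R n p p1 (wmod f) k x m (rmeas_wmod mf) mk mx (wmod_ge0 f) k0 x0 keven m0 km.
  have xX w : ((x w)%:E <= nint (fun z => (wmod f z * k (w - z))%:E))%E.
    by rewrite /x -Xfin; under eq_nint do rewrite EFinM.
  move=> /(_ xX) h.
  under eq_nint do rewrite (powRM p (ler0n _ 2) (x0 _)) EFinM.
  rewrite nintZ; [|exact: (rmeas_emeas (rmeas_powR p mx))
    |by move=> w; rewrite lee_fin powR_ge0|by rewrite lee_fin powR_ge0].
  rewrite (le_trans (lee_wpmul2l _ h)) ?lee_fin ?powR_ge0// muleA -EFinM mulrA.
  by rewrite (_ : 4 = 2 * 2)%R ?powRM// -natrM.
have y2 : (nint (fun w : Cn => (a `^ p * (enorm w <= R0)%R%:R)%:E) <=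
    (a `^ p * expR (R0 ^+ 2))%:E)%E.
  under eq_nint do rewrite EFinM.
  have aE : (0 <= (a `^ p)%:E)%E by rewrite lee_fin powR_ge0.
  rewrite (nintZ (rmeas_emeas mball)) => [|w|//]; last by rewrite lee_fin.
  by rewrite EFinM lee_wpmul2l// nint_ball_le.
have y3 := ES f ff.
have [q q0 qE] := energy_finE fy.
have {}y3 : (energy p (E f) <= (e `^ p * q)%:E)%E by rewrite EFinM -qE.
rewrite -/(energy p f) qE.
apply: (@le_trans _ _ ((4 `^ p)%:E * ((4 `^ p * m `^ p * q)%:E + (a `^ p * expR (R0 ^+ 2))%:E +
   (e `^ p * q)%:E) + (4 `^ p * (e `^ p * Y) * 4 ^+ n * q)%:E)%E).
  rewrite leeD2r// lee_wpmul2l// leeD// leeD//.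
  by rewrite [leRHS]EFinM -qE.
rewrite [leLHS](_ : _ = (4 `^ p * (4 `^ p * m `^ p * q + a `^ p * expR (R0 ^+ 2) +
  e `^ p * q) + 4 `^ p * (e `^ p * Y) * 4 ^+ n * q)%:E)//.
rewrite [leRHS](_ : _ = (4 `^ p * (4 `^ p * m `^ p * q + a `^ p * expR (R0 ^+ 2) +
  e `^ p * (1 + Y * 4 ^+ n) * q))%:E)// lee_fin.
rewrite le_eqVlt; apply/orP; left; apply/eqP; ring.
Qed.

Hypothesis locT : in_localized_closure p%:E T.
Hypothesis berezin : forall e : R, 0 < e ->
  exists M : R, forall z, M < enorm z -> tkernel T z z < e.

(** The constants are chosen in the order: [S], then [L] from the decay of its
    kernel, then [d], then the radius [R0] from the decay of the kernel of [T], then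
    [k] large enough for the mass of [h k] in a ball to be small. *)
Lemma energy_null (h : nat -> Cn -> R[i]) (M : R) : 0 <= M ->
  (forall k, fock p%:E (h k)) -> (forall k, (energy p (h k) <= M%:E)%E) ->
  (forall z, null_seq (fun k => normc (h k z))) ->
  forall e : R, 0 < e -> exists K, forall k, (K <= k)%N -> (energy p (T (h k)) <= e%:E)%E.
Proof.
move=> M0 fh hM h0 eps eps0.
have [CT CT0 HCT] := tkernel_bound p1 bT.
have eps3 : 0 < eps / 3 by rewrite divr_gt0.
have c1 : 0 <= 4 `^ p * (1 + Y * 4 ^+ n) * M.
  by rewrite !mulr_ge0 ?powR_ge0// addr_ge0// mulr_ge0// exprn_ge0.
have [e e0 He] := small_powR p1 c1 eps3.
have [S locS opS] := locT e0.
have [bS [b [C [nb C0 HS]]]] := localized_tkernel p1 locS.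
have ES : forall g, fock p%:E g ->
    (energy p (fun z => (T g z - S g z)%R) <= (e `^ p)%:E * energy p g)%E.
  apply: (opnorm_energy p1 (A := fun f z => T f z - S f z)) (ltW e0) (ltW opS).
    by move=> f ff; apply: (fockB p1); exact: bounded_fock.
  by move=> c f ff; apply/funext => z; rewrite (bounded_opZ p1 bT)// (bounded_opZ p1 bS)//; ring.
have c2 : 0 <= 4 `^ p * 4 `^ p * M by rewrite !mulr_ge0 ?powR_ge0.
have [m m0 Hm] := small_powR p1 c2 eps3.
have m2 : 0 < m / 2 by rewrite divr_gt0.
have [L L0 HL] := tail_null C0 nb m2.
pose rho := 6 * L * n%:R.
have rho0 : 0 <= rho by rewrite !mulr_ge0// ltW.
pose d := m / 2 / expR (rho ^+ 2).
have d0 : 0 < d by rewrite divr_gt0 ?expR_gt0.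
have [R1 HR1] := off_diagonal p1 bT berezin rho0 d0.
pose R0 := Num.max R1 0.
have R00 : 0 <= R0 by rewrite le_max lexx orbT.
have Td z w : R0 < enorm w -> enorm (z - w) <= rho -> tkernel T z w <= d.
  by rewrite gt_max => /andP[wR _]; exact: HR1.
have c3 : 0 <= 4 `^ p * ((2 * CT) `^ p * expR (R0 ^+ 2)).
  by rewrite !mulr_ge0 ?powR_ge0 ?expR_ge0.
have [A A0 HA] := small_powR p1 c3 eps3.
have M1 : 0 < M + 1 by rewrite ltr_wpDl.
pose C' := fock_cst (R := R) (n := n) * (M + 1) `^ p^-1.
have C'0 : 0 <= C' by rewrite mulr_ge0 ?fock_cst_ge0// powR_ge0.
have hC' k z : wmod (h k) z <= C'.
  apply: (fock_bound p1 z (fh k)); first by rewrite powR_gt0.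
  rewrite -powRrM mulVf ?gt_eqF// powRr1 ?(ltW M1)//.
  by rewrite (le_trans (hM k))// lee_fin lerDl.
have mball r : rmeas (fun w : Cn => (enorm w <= r)%R%:R : R) := bmeas_le r rmeas_enorm.
have [] := @nint_null R n (fun k z => wmod (h k) z * (enorm z <= R0 + rho)%R%:R)
  (fun z => C' * (enorm z <= R0 + rho)%R%:R) _ _ _ _ _ A A0.
- by move=> k; exact: (rmeasM (rmeas_wmod (fock_cmeas (fh k))) (mball _)).
- exact: (rmeasM (rmeas_cst C') (mball _)).
- under eq_nint do rewrite EFinM.
  have C'E : (0 <= C'%:E)%E by rewrite lee_fin.
  rewrite (nintZ (rmeas_emeas (mball _))) => [|w|//]; last by rewrite lee_fin.
  rewrite lte_mul_pinfty// (le_lt_trans (nint_ball_le _))//; last exact: ltry.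
  exact: addr_ge0.
- by move=> k z; rewrite mulr_ge0 ?wmod_ge0//= ler_wpM2r.
- move=> z; have r0 : 0 <= (enorm z <= R0 + rho)%R%:R * expR (- (enorm z ^+ 2 / 2)) :> R.
    by rewrite mulr_ge0 ?expR_ge0.
  apply: le_null_seq (null_seqZ r0 (h0 z)) => k.
  by rewrite /wmod le_eqVlt; apply/orP; left; apply/eqP; ring.
move=> K HK; exists K => k Kk.
have km : (nint (fun z : Cn => (d * (enorm z <= rho)%R%:R + tail C b L z)%:E) <= m%:E)%E.
  have i1 : emeas (fun z : Cn => (d%:E * ((enorm z <= rho)%R%:R)%:E)%E).
    exact: (rmeas_emeas (rmeasM (rmeas_cst d) (mball rho))).
  under eq_nint do rewrite EFinD EFinM.
  rewrite (nintD i1 (rmeas_emeas (rmeas_tail C b L))) => [|z|z]; last 2 first.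
  - by rewrite -EFinM lee_fin mulr_ge0// ltW.
  - by rewrite lee_fin tail_ge0.
  have -> : m = m / 2 + m / 2 by exact: splitr.
  rewrite EFinD leeD//.
  have dE : (0 <= d%:E)%E by rewrite lee_fin ltW.
  rewrite (nintZ (rmeas_emeas (mball rho))) => [|z|//]; last by rewrite lee_fin.
  rewrite (le_trans (lee_wpmul2l dE (nint_ball_le rho0)))// -EFinM lee_fin.
  by rewrite /d divfK// gt_eqF// expR_gt0.
have := energy_estimate bS (fh k) C0 CT0 (ltW d0) L0 R00 m0 (ltW A0) (ltW e0) C'0
  HS HCT Td ES km (HK k Kk) (hC' k).
move=> /le_trans; apply.
have [q q0 qE] := energy_finE (fock_energy p1 (fh k)).
have qM : q <= M by have := hM k; rewrite qE lee_fin.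
rewrite qE (_ : ((4 `^ p)%:E * _)%E = (4 `^ p * (4 `^ p * m `^ p * q +
  (2 * CT * A) `^ p * expR (R0 ^+ 2) + e `^ p * (1 + Y * 4 ^+ n) * q))%:E)// lee_fin.
have -> : eps = eps / 3 + eps / 3 + eps / 3 by field.
rewrite !(mulrDr (4 `^ p)) lerD//; first apply: lerD.
- rewrite (le_trans _ Hm)// [leRHS](_ : _ = 4 `^ p * (4 `^ p * m `^ p * M)); last by ring.
  by rewrite ler_wpM2l ?powR_ge0// ler_wpM2l// mulr_ge0 ?powR_ge0.
- rewrite (le_trans _ HA)// (powRM p _ (ltW A0)) ?mulr_ge0//.
  by rewrite le_eqVlt; apply/orP; left; apply/eqP; ring.
rewrite (le_trans _ He)//.
rewrite [leRHS](_ : _ = 4 `^ p * (e `^ p * (1 + Y * 4 ^+ n) * M)); last by ring.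
rewrite ler_wpM2l ?powR_ge0// ler_wpM2l// mulr_ge0 ?powR_ge0//.
by rewrite addr_ge0// mulr_ge0// exprn_ge0.
Qed.

Theorem compact_of_berezin : compact_op p%:E T.
Proof.
move=> f ff [M0 fM0].
pose M := `|M0| `^ p.
have fM k : (energy p (f k) <= M%:E)%E.
  rewrite -fock_norm_le//; apply: (le_trans (fM0 k)); by rewrite lee_fin ler_norm.
have [phi [g [hphi fg pg]]] := montel p1 ff fM.
exists phi, (T g); split=> //; first exact: bounded_fock.
have [q q0 qE] := energy_finE (fock_energy p1 fg).
have fd k : fock p%:E (fun z => f (phi k) z - g z) by exact: fockB.
pose M' := 2 `^ p * (M + q).
have M'0 : 0 <= M' by rewrite mulr_ge0 ?addr_ge0 ?powR_ge0.
have dM k : (energy p (fun z => (f (phi k) z - g z)%R) <= M'%:E)%E.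
  apply: (le_trans (energyD_le (ltW p0) (fock_cmeas (ff _)) (fock_cmeas fg)
    (fock_cmeas (fd k)) (fun z => wmodB _ _ _))).
  by rewrite qE EFinM EFinD lee_wpmul2l ?leeD2r// lee_fin powR_ge0.
have null := energy_null M'0 fd dM pg.
have ge0 k : (0 <= fock_norm p%:E (fun z => (T (f (phi k)) z - T g z)%R))%E.
  by rewrite fock_normE// poweR_ge0.
have le e : 0 < e -> exists K, forall k, (K <= k)%N ->
    (fock_norm p%:E (fun z => (T (f (phi k)) z - T g z)%R) <= e%:E)%E.
  move=> e0; have [K HK] := null _ (powR_gt0 p e0).
  exists K => k Kk; rewrite fock_norm_le ?(ltW e0)//.
  by rewrite -(bounded_opB bT (ff _) fg); exact: HK.
have [K1 HK1] := le 1 ltr01.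
apply/fine_cvgP; split.
  exists K1 => // k /= /HK1 h.
  by rewrite ge0_fin_numE// (le_lt_trans h)// ltry.
apply/cvgrPdist_le => e e0; have [K2 HK2] := le e e0.
exists (maxn K1 K2) => // k /=; rewrite geq_max => /andP[/HK1 h1 /HK2 h2].
rewrite sub0r normrN ger0_norm ?fine_ge0//.
by rewrite -lee_fin fineK// ge0_fin_numE// (le_lt_trans h1)// ltry.
Qed.

End weak_to_strong.

(** * Compactness *)

Theorem theorem1p3 (R : realType) (n : nat) (p : R)
    (T : ('rV[R[i]]_n -> R[i]) -> ('rV[R[i]]_n -> R[i])) :
  1 < p ->
  bounded_op p%:E T ->
  in_localized_closure p%:E T ->
  (forall e : R, 0 < e -> exists M : R, forall z : 'rV[R[i]]_n, M < enorm z ->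
    normc (pairing (T (nkernel z)) (nkernel z)) < e) ->
  compact_op p%:E T.
Proof.
move=> p1 bT locT berezin; apply: (compact_of_berezin p1 bT locT) => e e0.
have [M HM] := berezin e e0; exists M => z zM.
by rewrite -(tkernel_pairing p1 z z bT); exact: HM.
Qed.
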